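(* Let $G$ be a group presented by a finite convergent length-reducing rewriting system $(\Sigma,T)$ (not assumed inverse-closed). Define a relation $\sim$ on the set of non-trivial finite-order elements of $G$ by $a\sim b$ if and only if the product $ab$ has finite order. Then the following are equivalent: (1) $G$ is plain; (2) any non-trivial finite-order element in $G$ is contained in a unique maximal finite subgroup of $G$; (3) the relation $\sim$ is transitive on the set of non-trivial finite-order elements in $G$.
   Context: A group is plain if it is isomorphic to a free product of finitely many finite groups and finitely many copies of $\mathbb{Z}$. A length-reducing rewriting system is a pair $(\Sigma,T)$ with $\Sigma$ a non-empty finite alphabet and $T\subseteq \Sigma^*\times\Sigma^*$ such that $|\ell|_\Sigma>|r|_\Sigma$ for all $(\ell,r)\in T$, where $|\cdot|_\Sigma$ is word length. Write $u\ell v\to urv$ for $u,v\in\Sigma^*$, $(\ell,r)\in T$; $\overset{*}{\to}$ is the reflexive transitive closure and $\overset{*}{\leftrightarrow}$ the reflexive, transitive and symmetric closure. The system is finite if $T$ is finite, and convergent if it is terminating (automatic here) and confluent (whenever $w\overset{*}{\to}x$ and $w\overset{*}{\to}y$ there is $z$ with $x\overset{*}{\to}z$ and $y\overset{*}{\to}z$). $G$ is presented by $(\Sigma,T)$ if the monoid $M(\Sigma,T)=\Sigma^*/\overset{*}{\leftrightarrow}$ is a group and $G$ is (identified with) it. *)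

(* Defs.v *)
(* MathComp, with the classical sets and logic of MathComp-Analysis. *)
From HB Require Import structures.
From Stdlib Require Import Relations.Relation_Operators.
(* all_boot comes after fingroup so that repr denotes quotient representatives. *)
From mathcomp Require Import fingroup all_boot ssrint.
From mathcomp Require Import boolp classical_sets cardinality.
From mathcomp Require Import nmodule.

Set Implicit Arguments.
Unset Strict Implicit.
Unset Printing Implicit Defensive.

Local Open Scope classical_set_scope.
Local Open Scope group_scope.
Local Open Scope quotient_scope.

Section Rewriting.
Variables (X : Type) (T : set (seq X * seq X)).

Definition step (x y : seq X) : Prop :=
  exists u v l r, [/\ T (l, r), x = u ++ l ++ v & y = u ++ r ++ v].

Definition reduces : seq X -> seq X -> Prop := clos_refl_trans _ step.

Definition congruent : seq X -> seq X -> Prop := clos_refl_sym_trans _ step.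

Definition length_reducing : Prop :=
  forall l r, T (l, r) -> (size r < size l)%N.

Definition terminating : Prop := well_founded (fun y x => step x y).

Definition confluent : Prop :=
  forall w x y, reduces w x -> reduces w y ->
    exists z, reduces x z /\ reduces y z.

Definition convergent : Prop := terminating /\ confluent.

Lemma congruent_cat2 p q x y :
  congruent x y -> congruent (p ++ x ++ q) (p ++ y ++ q).
Proof.
elim=> {x y} [x y [u [v [l [r [Tlr -> ->]]]]]|x|x y _ IH|x y z _ IH1 _ IH2].
- apply: rst_step; exists (p ++ u), (v ++ q), l, r.
  by rewrite -!catA.
- exact: rst_refl.
- exact: rst_sym.
- exact: rst_trans IH1 IH2.
Qed.

Lemma congruent_cat x x' y y' :
  congruent x x' -> congruent y y' -> congruent (x ++ y) (x' ++ y').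
Proof.
move=> xx' yy'; apply: (@rst_trans _ _ _ (x' ++ y)).
  exact: (congruent_cat2 [::] y).
by have := congruent_cat2 x' [::] yy'; rewrite !cats0.
Qed.

End Rewriting.

Section PresentedMonoid.
Variables (X : choiceType) (T : set (seq X * seq X)).

Definition congruentb : rel (seq X) := fun x y => `[< congruent T x y >].

Lemma congruentb_refl : reflexive congruentb.
Proof. by move=> x; apply/asboolP; exact: rst_refl. Qed.

Lemma congruentb_sym : symmetric congruentb.
Proof. by move=> x y; apply/asboolP/asboolP => h; exact: rst_sym. Qed.

Lemma congruentb_trans : transitive congruentb.
Proof.
by move=> y x z /asboolP xy /asboolP yz; apply/asboolP; exact: rst_trans xy yz.
Qed.

Canonical congruentb_equiv :=
  EquivRel congruentb congruentb_refl congruentb_sym congruentb_trans.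

(* X^* / <->*, with word_class w the class of w. *)
Definition presented_monoid : Type := {eq_quot congruentb}.

HB.instance Definition _ : EqQuotient (seq X) congruentb presented_monoid :=
  EqQuotient.on presented_monoid.
HB.instance Definition _ := Choice.on presented_monoid.

Definition word_class (w : seq X) : presented_monoid := \pi_presented_monoid w.

Definition pm_mul (x y : presented_monoid) : presented_monoid :=
  word_class (repr x ++ repr y).

Lemma word_classP w w' : word_class w = word_class w' <-> congruent T w w'.
Proof.
split=> [/eqmodP/asboolP //|ww'].
by apply/eqmodP/asboolP.
Qed.

Lemma word_classK x : word_class (repr x) = x.
Proof. exact: reprK. Qed.

Lemma pm_mulE w w' : pm_mul (word_class w) (word_class w') = word_class (w ++ w').
Proof.
by apply/word_classP/congruent_cat; apply/word_classP; rewrite word_classK.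
Qed.

Lemma pm_mulA : associative pm_mul.
Proof.
move=> x y z; rewrite -(word_classK x) -(word_classK y) -(word_classK z).
by rewrite !pm_mulE catA.
Qed.

Lemma pm_mul1m : left_id (word_class [::]) pm_mul.
Proof. by move=> x; rewrite -(word_classK x) pm_mulE. Qed.

Lemma pm_mulm1 : right_id (word_class [::]) pm_mul.
Proof. by move=> x; rewrite -(word_classK x) pm_mulE cats0. Qed.

HB.instance Definition _ :=
  isMonoid.Build presented_monoid pm_mulA pm_mul1m pm_mulm1.

End PresentedMonoid.

(* Used for monoids and for groups: a monoid isomorphism between groups is a
   group isomorphism. *)
Definition isomorphic (M N : baseUMagmaType) : Prop :=
  exists f : M -> N, monoid_morphism f /\ bijective f.

Section FreeProduct.
Variables (I : choiceType) (F : I -> groupType).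

(* The free product of the F i is the monoid presented by their disjoint union,
   subject to their multiplication tables and to the identification of each
   unit with the empty word; it is shown below to be a group. *)
Definition free_prod_letter : Type := {i : I & (F i : choiceType)}.
HB.instance Definition _ := Choice.on free_prod_letter.

Definition letter (i : I) (g : F i) : free_prod_letter :=
  existT (fun i => F i : Type) i g.

Definition free_prod_rules : set (seq free_prod_letter * seq free_prod_letter) :=
  [set p | (exists i, p = ([:: letter (1 : F i)], [::])) \/
           (exists i (g h : F i),
              p = ([:: letter g; letter h], [:: letter (g * h)]))].

Definition free_prod : Type := presented_monoid free_prod_rules.
HB.instance Definition _ := Monoid.on free_prod.

Definition letter_inv (a : free_prod_letter) : free_prod_letter :=
  letter (projT2 a)^-1.

Definition word_inv (w : seq free_prod_letter) := rev (map letter_inv w).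

Lemma word_inv_cat u v : word_inv (u ++ v) = word_inv v ++ word_inv u.
Proof. by rewrite /word_inv map_cat rev_cat. Qed.

Let cong := congruent free_prod_rules.

Lemma cong_rule l r : free_prod_rules (l, r) -> cong l r.
Proof.
move=> lr; apply: rst_step; exists [::], [::], l, r.
by rewrite !cats0.
Qed.

Lemma cong_one i : cong [:: letter (1 : F i)] [::].
Proof. by apply: cong_rule; left; exists i. Qed.

Lemma cong_mul i (g h : F i) : cong [:: letter g; letter h] [:: letter (g * h)].
Proof. by apply: cong_rule; right; exists i, g, h. Qed.

Lemma word_invK : involutive word_inv.
Proof.
move=> w; rewrite /word_inv map_rev revK -map_comp -[RHS]map_id.
by apply: eq_map => -[i g]; rewrite /letter_inv /letter /= invgK.
Qed.

Lemma word_mulV w : cong (w ++ word_inv w) [::].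
Proof.
elim/last_ind: w => [|w [i g] IH]; first exact: rst_refl.
have -> : rcons w (letter g) ++ word_inv (rcons w (letter g))
    = w ++ [:: letter g; letter g^-1] ++ word_inv w.
  by rewrite -cats1 word_inv_cat -!catA.
apply: rst_trans IH.
rewrite -[w ++ word_inv w]/(w ++ [::] ++ word_inv w).
apply: congruent_cat2.
apply: rst_trans (cong_one i).
by rewrite -(mulgV g); exact: cong_mul.
Qed.

Definition free_prod_inv (x : free_prod) : free_prod :=
  word_class free_prod_rules (word_inv (repr x)).

Lemma free_prod_mulgV (x : free_prod) :
  x * free_prod_inv x = 1.
Proof.
rewrite -{1}(word_classK x) /free_prod_inv.
rewrite [LHS]pm_mulE; apply/word_classP; exact: word_mulV.
Qed.

Lemma free_prod_mulVg (x : free_prod) :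
  free_prod_inv x * x = 1.
Proof.
rewrite -{2}(word_classK x) /free_prod_inv.
rewrite [LHS]pm_mulE; apply/word_classP.
by rewrite -{2}(word_invK (repr x)); exact: word_mulV.
Qed.

HB.instance Definition _ := hasInv.Build free_prod free_prod_inv.
HB.instance Definition _ :=
  Monoid_isGroup.Build free_prod free_prod_mulVg free_prod_mulgV.

End FreeProduct.

(* n finite groups F j and m copies of Z, the latter being the additive group
   of int written multiplicatively. *)
Definition plain_factor n m (F : 'I_n -> finGroupType) (i : 'I_n + 'I_m)
    : groupType :=
  match i with
  | inl j => F j
  | inr _ => Algebra.to_multiplicative int
  end.

Definition plain (G : groupType) : Prop :=
  exists n m (F : 'I_n -> finGroupType),
    isomorphic G (free_prod (@plain_factor n m F)).

Section FiniteOrder.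
Variable G : groupType.

Definition finite_order (a : G) : Prop := exists n, (0 < n)%N /\ a ^+ n = 1.

Definition nontrivial_torsion : set G := [set a | a <> 1 /\ finite_order a].

(* group_closed H: H contains 1 and is closed under x, y |-> x * y^-1. *)
Definition finite_subgroup (H : set G) : Prop :=
  group_closed [in H] /\ finite_set H.

Definition maximal_finite_subgroup (H : set G) : Prop :=
  finite_subgroup H /\
  forall K, finite_subgroup K -> H `<=` K -> K = H.

Definition prod_finite_order (a b : G) : Prop := finite_order (a * b).

End FiniteOrder.

(* Main.v *)
(* Multiplication by a fixed element changes a bounded part of the end of an
   irreducible word, so that cones (irreducible words with a given prefix) have
   finite boundary in the Cayley graph and form finitely many types up to
   translation; moreover elements of finite order have finite centralisers, by
   uniqueness of normal forms. Following Dunwoody, the cuts with at most M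
   boundary edges are Boolean combinations of a nested invariant family E of
   such cuts, namely those that are not combinations of cuts with fewer boundary
   edges or with as many edges but fewer crossings. E is the set of
   half-spaces of a tree on which the group acts with finitely many orbits of
   edges; the tree is locally finite because its cuts generate the cones.
   Under either torsion condition, the elements of finite order fall into
   classes such that products within a class are torsion. The edges whose
   stabilisers meet a given class are then finite in number, since elements
   fixing remote edges have a product of infinite order. Contracting the edges
   with nontrivial stabilisers leaves a tree with trivial edge stabilisers and
   finite vertex stabilisers, and the group is plain by Bass-Serre theory.
   Conversely, in a plain group the torsion elements having a torsion product
   with b, together with 1, form a finite subgroup: a conjugate of a factor. *)
From HB Require Import structures.
From Stdlib Require Import Relations.Relation_Operators.
Require Import Defs.
From mathcomp Require Import fingroup all_boot ssrint finmap.
From mathcomp Require Import boolp classical_sets cardinality.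
From mathcomp Require Import zify.

Set Implicit Arguments.
Unset Strict Implicit.
Unset Printing Implicit Defensive.

Local Open Scope classical_set_scope.
Local Open Scope group_scope.

(** * Rewriting and normal forms *)

(** Accessibility, that is, one bound M on boundary sizes that captures enough cuts, comes from the
    finiteness of cone types: M is the largest boundary among their representatives and the
    singleton of 1. The cones give local finiteness, the singleton makes the half-spaces separate
    points. The alphabet need not be closed under inverses: it generates G as a monoid, and the
    edges of the Cayley graph are pairs [(g, s)] read in both directions, with separate estimates
    for [s] and for its inverse. The danger in contracting edges is an infinite vertex stabiliser;
    the finiteness of each class of edges excludes it by keeping the contracted tree locally finite.
    Both torsion conditions enter through one abstract relation [R]; condition (2) also calls for a
    bound on the orders of finite subgroups, which the uncontracted tree supplies. No graph is ever
    built: half-spaces serve as oriented edges and classes of [adjacent] as vertices. Simple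
    connectivity takes the form of integrating cocycles along the tree, and the potential so
    obtained is the isomorphism from G onto the free product. *)

Lemma cat_eq_cat (A : Type) (w z u t : seq A) : w ++ z = u ++ t ->
  (exists m, w = u ++ m /\ t = m ++ z) \/ (exists m, u = w ++ m /\ z = m ++ t).
Proof.
elim: w u => [|a w IH] [|b u] /=; first by move=> ->; left; exists [::].
- by move=> ->; right; exists (b :: u).
- by move=> <-; left; exists (a :: w).
- by case=> <- /IH[] [m [-> ->]]; [left|right]; exists m.
Qed.

Section Reduction.
Variables (X : eqType) (T : set (seq X * seq X)).
Hypothesis redT : length_reducing T.

Definition irr (w : seq X) := forall y, ~ step T w y.

Lemma irr_factor u v w : irr (u ++ v ++ w) -> irr v.
Proof.
move=> h y [p [q [l [r [Tlr ev _]]]]]; apply: (h (u ++ p ++ r ++ q ++ w)).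
by exists (u ++ p), (q ++ w), l, r; split; rewrite // ?ev -?catA.
Qed.

Lemma irr_prefix u v : irr (u ++ v) -> irr u.
Proof. exact: (@irr_factor [::]). Qed.

Lemma irr_suffix u v : irr (u ++ v) -> irr v.
Proof. by move=> h; apply: (@irr_factor u v [::]); rewrite cats0. Qed.

Lemma step_size x y : step T x y -> (size y < size x)%N.
Proof.
move=> [u [v [l [r [/redT lr -> ->]]]]]; rewrite !size_cat; lia.
Qed.

Lemma reduces_size x y : reduces T x y -> (size y <= size x)%N.
Proof.
elim=> {x y} [x y /step_size/ltnW //|//|x y z _ h1 _ h2]; exact: leq_trans h1.
Qed.

Lemma reduces_irr x y : irr x -> reduces T x y -> x = y.
Proof.
move=> + xy; elim: xy => {x y} [x y s /(_ _ s)//|//|x y z _ h1 _ h2 xi].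
by have e := h1 xi; rewrite e in xi *; exact: h2.
Qed.

Lemma exists_irr x : exists2 y, reduces T x y & irr y.
Proof.
have [n] := ubnP (size x); elim: n x => // n IH x xn.
have [[y s]|h] := pselect (exists y, step T x y); last first.
  by exists x; [exact: rt_refl|move=> y s; apply: h; exists y].
have [|z yz zi] := IH y; first by move: (step_size s); lia.
by exists z => //; apply: rt_trans yz; exact: rt_step.
Qed.

Lemma congruent_reduces x y : reduces T x y -> congruent T x y.
Proof.
elim=> {x y} [x y|x|x y z _ h1 _ h2]; [exact: rst_step|exact: rst_refl|].
exact: rst_trans h2.
Qed.

Lemma church_rosser : confluent T -> forall x y, congruent T x y ->
  exists z, reduces T x z /\ reduces T y z.
Proof.
move=> cT x y; elim=> {x y} [x y s|x|x y _ [z [? ?]]|x y z _ [a [xa ya]] _ [b [yb zb]]].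
- by exists y; split; [exact: rt_step|exact: rt_refl].
- by exists x; split; exact: rt_refl.
- by exists z.
- have [c [ac bc]] := cT _ _ _ ya yb.
  by exists c; split; [exact: rt_trans ac|exact: rt_trans bc].
Qed.

Variable L : nat.
Hypothesis sizeL : forall l r, T (l, r) -> (size l <= L)%N.

(** A left-hand side cannot lie inside the irreducible [w], so a redex reaching into [w] straddles
    its end and touches at most [L] of its letters. *)
Lemma step_prefix w z y : irr w -> step T (w ++ z) y ->
  exists w1 w2 q, [/\ w = w1 ++ w2, y = w1 ++ q & (size w2 <= L)%N].
Proof.
move=> wi [u [v [l [r [Tlr /cat_eq_cat e ->]]]]].
case: e => [[m [ew elv]]|[m [eu ez]]]; last first.
  by exists w, [::], (m ++ r ++ v); rewrite cats0 eu -!catA.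
exists u, m, (r ++ v); split => //.
have [[m' [el _]]|[m' [em _]]] := cat_eq_cat elv.
  by have := sizeL Tlr; rewrite el size_cat; lia.
case: (wi (u ++ r ++ m')); exists u, m', l, r; split=> //; by rewrite ew em.
Qed.

Lemma step_suffix w z y : irr w -> step T (z ++ w) y ->
  exists w1 w2 q, [/\ w = w1 ++ w2, y = q ++ w2 & (size w1 <= L)%N].
Proof.
move=> wi [u [v [l [r [Tlr e ->]]]]].
rewrite catA in e; case/cat_eq_cat: e => [[m [ez ev]]|[m [eul ew]]].
  by exists [::], w, (u ++ r ++ m); split => //; rewrite ev -!catA.
exists m, v, (u ++ r); split; rewrite -?catA //.
have [[m' [eu el]]|[m' [ez el]]] := cat_eq_cat eul; last first.
  by have := sizeL Tlr; rewrite el size_cat; lia.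
case: (wi (m' ++ r ++ v)); exists m', v, l, r; split=> //.
by rewrite ew el catA.
Qed.

(** Each step shortens the word, so the size difference bounds the number of steps, and each step
    spoils at most [L] more letters of the intact prefix. *)
Lemma reduces_prefix x y : reduces T x y -> forall w z, irr w -> x = w ++ z ->
  exists w1 w2 q, [/\ w = w1 ++ w2, y = w1 ++ q &
    (size w2 <= L * (size x - size y))%N].
Proof.
elim=> {x y} [x y s|x|x y t xy IH1 yt IH2] w z wi e.
- have sx := step_size s; rewrite e in s; have [w1 [w2 [q [? ? ?]]]] := step_prefix wi s.
  by exists w1, w2, q; split=> //; nia.
- by exists w, [::], z; rewrite cats0.
- have [w1 [w2 [q [e1 e2 s1]]]] := IH1 _ _ wi e.
  have wi1 : irr w1 by apply: (@irr_prefix _ w2); rewrite -e1.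
  have [w3 [w4 [q' [e3 e4 s2]]]] := IH2 _ _ wi1 e2.
  exists w3, (w4 ++ w2), q'; split=> //; first by rewrite e1 e3 catA.
  have := reduces_size xy; have := reduces_size yt; rewrite size_cat; nia.
Qed.

Lemma reduces_suffix x y : reduces T x y -> forall w z, irr w -> x = z ++ w ->
  exists w1 w2 q, [/\ w = w1 ++ w2, y = q ++ w2 &
    (size w1 <= L * (size x - size y))%N].
Proof.
elim=> {x y} [x y s|x|x y t xy IH1 yt IH2] w z wi e.
- have sx := step_size s; rewrite e in s; have [w1 [w2 [q [? ? ?]]]] := step_suffix wi s.
  by exists w1, w2, q; split=> //; nia.
- by exists [::], w, z.
- have [w1 [w2 [q [e1 e2 s1]]]] := IH1 _ _ wi e.
  have wi1 : irr w2 by apply: (@irr_suffix w1); rewrite -e1.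
  have [w3 [w4 [q' [e3 e4 s2]]]] := IH2 _ _ wi1 e2.
  exists (w1 ++ w3), w4, q'; split=> //; first by rewrite e1 e3 catA.
  have := reduces_size xy; have := reduces_size yt; rewrite size_cat; nia.
Qed.

(** A left-hand side has at most [L] letters, hence would lie in [u ++ v] or in [v ++ w]. *)
Lemma irr_overlap u v w : (L <= size v)%N -> irr (u ++ v) -> irr (v ++ w) ->
  irr (u ++ v ++ w).
Proof.
move=> Lv uv vw y [p [q [l [r [Tlr e _]]]]].
have [[m [eu em]]|[m [ep em]]] := cat_eq_cat e; last first.
  by apply: (vw (m ++ r ++ q)); exists m, q, l, r; rewrite -em.
rewrite catA in em; have [[m' [emv ew]]|[m' [el _]]] := cat_eq_cat (esym em).
  by apply: (uv (p ++ r ++ m')); exists p, m', l, r; rewrite eu -catA emv.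
have sl := sizeL Tlr.
have m0 : (size m' <= 0)%N by move: (congr1 size el); rewrite !size_cat; lia.
have m'0 : m' = [::] by case: m' m0 {el}.
apply: (uv (p ++ r)); exists p, [::], l, r; rewrite !cats0; split => //.
by rewrite eu -catA el m'0 cats0.
Qed.

End Reduction.

(** All that is used of the rewriting system from here on. Right multiplication bounds only what is
    lost from the word; left multiplication also bounds the replacement [q], for the sake of
    centralisers. *)
Record normal_forms (G : groupType) (S : finType) := NormalForms {
  word_val : seq S -> G;
  irreducible : seq S -> Prop;
  nf : G -> seq S;
  word_val_nil : word_val [::] = 1;
  word_val_cat : forall u v, word_val (u ++ v) = word_val u * word_val v;
  nf_irr : forall g, irreducible (nf g);
  nfK : forall g, word_val (nf g) = g;
  nf_word_val : forall w, irreducible w -> nf (word_val w) = w;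
  irreducible_factor : forall u v w, irreducible (u ++ v ++ w) -> irreducible v;
  overlap : nat;
  irreducible_overlap : forall u v w, (overlap <= size v)%N ->
    irreducible (u ++ v) -> irreducible (v ++ w) -> irreducible (u ++ v ++ w);
  nf_mulr : forall p, exists C, forall w, irreducible w ->
    exists w1 w2 q, [/\ w = w1 ++ w2, nf (word_val w * p) = w1 ++ q & (size w2 <= C)%N];
  nf_mull : forall p, exists C, forall w, irreducible w ->
    exists w1 w2 q, [/\ w = w1 ++ w2, nf (p * word_val w) = q ++ w2,
      (size w1 <= C)%N & (size q <= C)%N] }.

Section Presented.
Variables (S : finType) (T : set (seq S * seq S)) (G : groupType).
Hypotheses (finT : finite_set T) (redT : length_reducing T) (conT : confluent T).
Variable f : presented_monoid T -> G.
Hypotheses (fM : monoid_morphism f) (fB : bijective f).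

Let evalw w := f (word_class T w).

Lemma evalw_cat u v : evalw (u ++ v) = evalw u * evalw v.
Proof. by rewrite /evalw -pm_mulE fM.2. Qed.

Lemma evalw_nil : evalw [::] = 1.
Proof. exact: fM.1. Qed.

Lemma evalw_surj g : exists2 w, irr T w & evalw w = g.
Proof.
have [h fK hK] := fB; have [w cw iw] := exists_irr redT (repr (h g)).
exists w => //; rewrite -[RHS]hK -(word_classK (h g)); congr f.
by apply/word_classP; apply: rst_sym; exact: congruent_reduces.
Qed.

Lemma evalw_reduces u w : irr T w -> evalw u = evalw w -> reduces T u w.
Proof.
move=> iw /(bij_inj fB)/word_classP/(church_rosser conT)[z [uz wz]].
by rewrite (reduces_irr iw wz).
Qed.

Let nfw g := sval (cid2 (evalw_surj g)).

Lemma nfw_irr g : irr T (nfw g).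
Proof. by rewrite /nfw; case: cid2. Qed.

Lemma nfwK g : evalw (nfw g) = g.
Proof. by rewrite /nfw; case: cid2. Qed.

Lemma nfw_reduces w g : evalw w = g -> reduces T w (nfw g).
Proof. by move=> wg; apply: evalw_reduces; [exact: nfw_irr|rewrite nfwK]. Qed.

Lemma evalwK w : irr T w -> nfw (evalw w) = w.
Proof. by move=> iw; have := nfw_reduces (erefl (evalw w)); move/(reduces_irr iw). Qed.

Lemma nfw_size w : (size (nfw (evalw w)) <= size w)%N.
Proof. exact/(reduces_size redT)/nfw_reduces. Qed.

Lemma nfwM_size x y : (size (nfw (x * y)) <= size (nfw x) + size (nfw y))%N.
Proof. by have := nfw_size (nfw x ++ nfw y); rewrite evalw_cat !nfwK size_cat. Qed.

Lemma lhs_bounded : exists L, forall l r, T (l, r) -> (size l <= L)%N.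
Proof.
have /finite_seqP[s Ts] := finT; exists (\max_(p <- s) size p.1)%N => l r.
by rewrite Ts /= => /(@leq_bigmax_seq _ s xpredT (fun p => size p.1)) -> .
Qed.

Let L := sval (cid lhs_bounded).
Let sizeL : forall l r, T (l, r) -> (size l <= L)%N := svalP (cid lhs_bounded).

Lemma nfw_mulr p : exists C, forall w, irr T w ->
  exists w1 w2 q, [/\ w = w1 ++ w2, nfw (evalw w * p) = w1 ++ q & (size w2 <= C)%N].
Proof.
(* The number of steps is at most [size w + size (nfw p)] minus the final length, and multiplying
   back by [p^-1] bounds [size w] by that length plus [size (nfw p^-1)]. *)
exists (L * (size (nfw p) + size (nfw p^-1)))%N => w iw.
have r : reduces T (w ++ nfw p) (nfw (evalw w * p)).
  by apply: nfw_reduces; rewrite evalw_cat nfwK.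
have [w1 [w2 [q [ew e s]]]] := reduces_prefix redT sizeL r iw erefl.
exists w1, w2, q; split => //; apply: leq_trans s _.
have := nfwM_size (evalw w * p) p^-1; rewrite mulgK evalwK //.
move=> h; apply: leq_mul => //; move: h; rewrite size_cat; lia.
Qed.

Lemma nfw_mull p : exists C, forall w, irr T w ->
  exists w1 w2 q, [/\ w = w1 ++ w2, nfw (p * evalw w) = q ++ w2,
    (size w1 <= C)%N & (size q <= C)%N].
Proof.
have [C CE] : {C | C = L * (size (nfw p) + size (nfw p^-1))}%N by exists (L * (size (nfw p) + size (nfw p^-1)))%N.
(* The extra [size (nfw p)] pays for [q], which is at most that much longer than [w1]. *)
exists (C + size (nfw p))%N => w iw.
have r : reduces T (nfw p ++ w) (nfw (p * evalw w)).
  by apply: nfw_reduces; rewrite evalw_cat nfwK.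
have [w1 [w2 [q [ew e s]]]] := reduces_suffix redT sizeL r iw erefl.
have sC : (size w1 <= C)%N.
  apply: leq_trans s _; rewrite CE.
  have := nfwM_size p^-1 (p * evalw w); rewrite mulKg evalwK //.
  move=> h; apply: leq_mul => //; move: h; rewrite size_cat; lia.
exists w1, w2, q; split => //; first by apply: leq_trans sC (leq_addr _ _).
have := nfwM_size p (evalw w); rewrite e evalwK // ew !size_cat; lia.
Qed.

Definition presented_normal_forms : normal_forms G S :=
  NormalForms evalw_nil evalw_cat nfw_irr nfwK evalwK (@irr_factor _ T)
    (irr_overlap sizeL) nfw_mulr nfw_mull.

End Presented.

Section NormalForms.
Variables (G : groupType) (S : finType) (N : normal_forms G S).

Lemma irreducible_prefix u v : irreducible N (u ++ v) -> irreducible N u.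
Proof. exact: (@irreducible_factor _ _ _ [::]). Qed.

Lemma irreducible_suffix u v : irreducible N (u ++ v) -> irreducible N v.
Proof. by move=> h; apply: (@irreducible_factor _ _ _ u v [::]); rewrite cats0. Qed.

Lemma nf1 : nf N 1 = [::].
Proof.
rewrite -(word_val_nil N); apply: nf_word_val; apply: (@irreducible_prefix _ (nf N 1)).
exact: nf_irr.
Qed.

Lemma word_val_inj u v : irreducible N u -> irreducible N v -> word_val N u = word_val N v -> u = v.
Proof. by move=> /nf_word_val{2}<- /nf_word_val{2}<- ->. Qed.

Lemma finite_words n : finite_set [set w : seq S | (size w <= n)%N].
Proof.
apply: (@sub_finite_set _ _
  (\bigcup_(k in `I_n.+1) ((fun t : k.-tuple S => t : seq S) @` setT))).
  by move=> w wn; exists (size w) => //; exists (in_tuple w).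
apply: bigcup_finite; first exact: finite_II.
by move=> k _; apply: finite_image; exact: finite_finset.
Qed.

Lemma finite_ball n : finite_set [set g | (size (nf N g) <= n)%N].
Proof.
apply: (sub_finite_set _ (finite_image (word_val N) (finite_words n))) => g gn.
by exists (nf N g) => //; exact: nfK.
Qed.

Lemma word_val_pow u n : word_val N (flatten (nseq n u)) = word_val N u ^+ n.
Proof. by elim: n => [|n IH] /=; rewrite ?word_val_nil // word_val_cat IH expgS. Qed.

Lemma prefix_pow (x u : seq S) m : prefix x (u ++ x) -> (m * size u <= size x)%N ->
  prefix (flatten (nseq m u)) x.
Proof.
move=> xu mx.
have h : prefix x (flatten (nseq m u) ++ x).
  elim: m {mx} => [|m IH]; first exact: prefix_refl.
  rewrite /= -catA; apply: prefix_trans xu _.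
  by case/prefixP: IH => t ->; rewrite catA; exact: prefix_prefix.
have s : size (flatten (nseq m u)) = (m * size u)%N.
  by rewrite size_flatten /shape map_nseq sumn_nseq mulnC.
move: h; rewrite !prefixE => /eqP; rewrite take_cat s ltnNge mx /= => e.
by apply/eqP; rewrite -e take_size_cat.
Qed.

(** A prefix of [u ++ x] has period [u], so the [m]-th power of [u] is a prefix of the irreducible
    [x]; being irreducible with value 1, it is empty. *)
Lemma irreducible_pow_eq1 (x u : seq S) m : irreducible N x -> prefix x (u ++ x) ->
  (m * size u <= size x)%N -> (0 < m)%N -> word_val N u ^+ m = 1 -> u = [::].
Proof.
move=> xi xu mx m0 um; have /prefixP[t et] := prefix_pow xu mx.
have : flatten (nseq m u) = [::].
  apply: word_val_inj; last by rewrite word_val_pow um word_val_nil.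
    by apply: (@irreducible_prefix _ t); rewrite -et.
  by rewrite -nf1; exact: nf_irr.
by case: m m0 {mx um et} => //= m _; case: u {xu}.
Qed.

Lemma prefix_total (s x y t u : seq S) : s = x ++ t -> s = y ++ u ->
  (size y <= size x)%N -> prefix y x.
Proof.
move=> sx sy yx; rewrite prefixE -(take_size_cat t (erefl (size x))) -sx take_takel //.
by rewrite sy take_size_cat.
Qed.

(* [nf (a * g) = nf (g * a)] keeps a long suffix of [nf g] on the one hand and
   a long prefix on the other. If the two are not aligned, then [nf g] is
   periodic, and the period is a conjugate of [a] or of [a^-1], hence a word of
   finite order all of whose powers are irreducible. *)
Lemma finite_centraliser (a : G) : a <> 1 -> finite_order a ->
  finite_set [set g | a * g = g * a].
Proof.
move=> a1 [m [m0 am]].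
have [C1 rC] := nf_mulr N a; have [C2 lC] := nf_mull N a.
(* Past this length, removing the last [C1] letters of [nf g] and a prefix of at most [C2] letters
   leaves room for [m] periods of length at most [C2]. *)
apply: (sub_finite_set _ (finite_ball (C1 + C2 + m * C2))) => g ag.
rewrite /= leqNgt; apply/negP => big.
have [w1 [w2 [q1 [ew1 ez1 s1]]]] := rC _ (nf_irr N g).
have [r [s [p [ew2 ez2 sr sp]]]] := lC _ (nf_irr N g).
rewrite nfK in ez1 ez2; rewrite ag in ez2.
have sw := congr1 size ew1; rewrite size_cat in sw.
have arp : a * word_val N r = word_val N p.
  have := congr1 (mul a) (nfK N g).
  rewrite ag -[RHS](nfK N) ez2 ew2 !word_val_cat mulgA; exact: mulIg.
have [x exr] : exists x, w1 = r ++ x.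
  have [[x [-> _]]|[x [er _]]] := cat_eq_cat (etrans (esym ew1) ew2); first by exists x.
  by have := congr1 size er; rewrite size_cat; lia.
have [y eyp] : exists y, w1 = p ++ y.
  have [[y [-> _]]|[y [ep _]]] := cat_eq_cat (etrans (esym ez1) ez2); first by exists y.
  by have := congr1 size ep; rewrite size_cat; lia.
have w1i : irreducible N w1 by apply: (@irreducible_prefix _ w2); rewrite -ew1; exact: nf_irr.
have xi : irreducible N x by apply: (@irreducible_suffix r); rewrite -exr.
have yi : irreducible N y by apply: (@irreducible_suffix p); rewrite -eyp.
have xs : s = x ++ w2.
  have : r ++ s = r ++ (x ++ w2) by rewrite -ew2 ew1 exr catA.
  by move/eqP; rewrite eqseq_cat // eqxx => /eqP.
have ys : s = y ++ q1.
  have : p ++ s = p ++ (y ++ q1) by rewrite -ez2 ez1 eyp catA.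
  by move/eqP; rewrite eqseq_cat // eqxx => /eqP.
have sx := congr1 size exr; have sy := congr1 size eyp; rewrite !size_cat in sx sy.
have [[u [ep ex]]|[u [er ey]]] := cat_eq_cat (etrans (esym eyp) exr).
- have u0 : u = [::]; last by move: arp; rewrite ep u0 cats0 => /(canRL (mulgK _)); rewrite mulgV.
  have su := congr1 size ep; rewrite size_cat in su.
  have mu : (m * size u <= m * C2)%N by rewrite leq_mul2l; lia.
  apply: (irreducible_pow_eq1 yi (m := m)) => //; last 2 first.
  + by lia.
  + have -> : word_val N u = a ^ word_val N r.
      by rewrite conjgE arp ep word_val_cat mulKg.
    by rewrite -conjXg am conj1g.
  by rewrite -ex; apply: (prefix_total xs ys); rewrite ex size_cat; lia.
- have u0 : u = [::]; last by move: arp; rewrite er u0 cats0 => /(canRL (mulgK _)); rewrite mulgV.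
  have su := congr1 size er; rewrite size_cat in su.
  have mu : (m * size u <= m * C2)%N by rewrite leq_mul2l; lia.
  apply: (irreducible_pow_eq1 xi (m := m)) => //; last 2 first.
  + by lia.
  + have -> : word_val N u = a^-1 ^ word_val N r.
      rewrite conjgE; apply: (canRL (mulKg _)); apply: (canRL (mulKg _)).
      by apply: (mulIg (word_val N u)^-1); rewrite -mulgA mulgK arp er word_val_cat mulgK.
    by rewrite -conjXg expVgn am invg1 conj1g.
  by rewrite -ey; apply: (prefix_total ys xs); rewrite ey size_cat; lia.
Qed.

End NormalForms.

(** * Cuts of the Cayley graph *)

(** Takes the value 0 on infinite sets, hence the finiteness hypotheses below. *)
Definition card (T : choiceType) (A : set T) : nat := #|` fset_set A|.

Lemma card_count (T : choiceType) (A : set T) (s : seq T) : uniq s ->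
  A `<=` [set` s] -> card A = count (fun x => `[<A x>]) s.
Proof.
move=> us As; have fA : finite_set A by apply: (sub_finite_set As); exact: finite_seq.
rewrite -size_filter /card; apply: perm_size; apply: uniq_perm.
- exact: fset_uniq.
- exact: filter_uniq.
- move=> x; rewrite mem_filter [LHS]in_fset_set //.
  apply/idP/andP => [/set_mem Ax|[/asboolP/mem_set]//].
  by split; [apply/asboolP|exact: As].
Qed.

Lemma card_sum (T : choiceType) (A : set T) (s : seq T) : uniq s ->
  A `<=` [set` s] -> card A = (\sum_(x <- s) `[<A x>])%N.
Proof.
move=> us As; rewrite (card_count us As) -sum1_count big_mkcond /=.
by apply: eq_bigr => x _; case: asbool.
Qed.

Lemma finite_uniq_seq (T : choiceType) (A : set T) : finite_set A ->
  exists2 s : seq T, uniq s & A = [set` s].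
Proof. by move=> fA; exists (fset_set A); [exact: fset_uniq|rewrite fset_setK]. Qed.

Lemma card_image_inj (T U : choiceType) (f : T -> U) (A : set T) : injective f ->
  finite_set A -> card (f @` A) = card A.
Proof. by move=> fI fA; rewrite /card fset_set_image // card_imfset. Qed.

Lemma card_leq (T : choiceType) (A B : set T) : finite_set B -> A `<=` B ->
  (card A <= card B)%N.
Proof.
move=> /finite_uniq_seq[s us ->] As; rewrite (card_count us As) (card_count us) //.
by apply: sub_count => x /asboolP/As h; apply/asboolP.
Qed.

Lemma card_ltn (T : choiceType) (A B : set T) x : finite_set B -> A `<=` B ->
  B x -> ~ A x -> (card A < card B)%N.
Proof.
move=> fB AB Bx nAx; have fA := sub_finite_set AB fB.
rewrite /card [X in (_ < X)%N](cardfsD1 x) in_fset_set // (mem_set Bx) add1n ltnS.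
apply: fsubset_leq_card; apply/fsubsetP => y; rewrite in_fsetD1 !in_fset_set //.
move=> /set_mem Ay; rewrite (mem_set (AB _ Ay)) andbT; apply/eqP => yx.
by rewrite yx in Ay.
Qed.

Lemma card_gt0 (T : choiceType) (A : set T) : finite_set A -> A !=set0 ->
  (0 < card A)%N.
Proof.
move=> fA [x Ax]; rewrite /card cardfs_gt0; apply/fset0Pn; exists x.
by rewrite in_fset_set //; apply/mem_set.
Qed.

Lemma card_seq (T : choiceType) (A : set T) (s : seq T) : uniq s ->
  finite_set A -> [set` s] `<=` A -> (size s <= card A)%N.
Proof.
move=> us fA /(card_leq fA); apply: leq_trans.
by rewrite (card_count us) // (eq_in_count (a2 := xpredT)) ?count_predT // => x /= ->; apply/asboolP.
Qed.

Section CardPair.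
Variables (T : choiceType) (A B C D : set T).
Hypotheses (fC : finite_set C) (fD : finite_set D).
Hypothesis le : forall x, (`[<A x>] + `[<B x>] <= `[<C x>] + `[<D x>])%N.

Let AB : A `<=` C `|` D /\ B `<=` C `|` D.
Proof.
split=> x /asboolP Ax; have := le x; rewrite Ax; case: (asboolP (C x)); [by left| |by left|];
  case: (asboolP (D x)); [by right|by case: asbool|by right|by case: asbool].
Qed.

(** Submodularity, of boundary sizes and of crossing numbers, is thus checked pointwise on indicator
    functions. *)
Lemma card_pair_leq : (card A + card B <= card C + card D)%N.
Proof.
have [s us CD] : exists2 s : seq T, uniq s & C `|` D = [set` s].
  by apply: finite_uniq_seq; rewrite finite_setU.
have [AC BC] := AB; rewrite CD in AC BC.
have Cs : C `<=` [set` s] by rewrite -CD; exact: subsetUl.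
have Ds : D `<=` [set` s] by rewrite -CD; exact: subsetUr.
rewrite !(card_sum us) //.
by rewrite -!big_split /=; apply: leq_sum.
Qed.

Lemma card_pair_ltn x0 : (`[<A x0>] + `[<B x0>] < `[<C x0>] + `[<D x0>])%N ->
  (card A + card B < card C + card D)%N.
Proof.
move=> lt0.
have [s us CD] : exists2 s : seq T, uniq s & C `|` D = [set` s].
  by apply: finite_uniq_seq; rewrite finite_setU.
have [AC BC] := AB; rewrite CD in AC BC.
have Cs : C `<=` [set` s] by rewrite -CD; exact: subsetUl.
have Ds : D `<=` [set` s] by rewrite -CD; exact: subsetUr.
have x0s : x0 \in s.
  have : [set` s] x0 by rewrite -CD; move: lt0; case: (asboolP (C x0)); [by left|];
   case: (asboolP (D x0)); [by right|by rewrite ltn0].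
  by [].
rewrite !(card_sum us) //.
rewrite -!big_split /= !(big_rem _ x0s) /= -addSn; apply: leq_add => //.
by apply: leq_sum.
Qed.
End CardPair.

Section SetGroup.
Variable G : groupType.

Definition lset (g : G) (A : set G) : set G := [set x | A (g^-1 * x)].

Lemma lset1 A : lset 1 A = A.
Proof. by apply/seteqP; split=> x; rewrite /lset /= invg1 mul1g. Qed.

Lemma lsetM g h A : lset (g * h) A = lset g (lset h A).
Proof. by apply/seteqP; split=> x; rewrite /lset /= invgM mulgA. Qed.

Lemma lsetK g : cancel (lset g) (lset g^-1).
Proof. by move=> A; rewrite -lsetM mulVg lset1. Qed.

Lemma lsetVK g : cancel (lset g^-1) (lset g).
Proof. by move=> A; rewrite -lsetM mulgV lset1. Qed.

Lemma lset_inj g : injective (lset g).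
Proof. exact: can_inj (lsetK g). Qed.

Lemma lsetC g A : lset g (~` A) = ~` lset g A.
Proof. by []. Qed.

Lemma lset_sub g A B : lset g A `<=` lset g B <-> A `<=` B.
Proof.
split=> h x; last by move/h.
by have := h (g * x); rewrite /lset /= mulKg.
Qed.

Lemma lset_mul g A x : lset g A (g * x) <-> A x.
Proof. by rewrite /lset /= mulKg. Qed.

End SetGroup.

(** * Boolean combinations and crossing sets *)

Inductive span (T : Type) (F : set (set T)) : set T -> Prop :=
| span_mem A : F A -> span F A
| span0 : span F set0
| spanC A : span F A -> span F (~` A)
| spanU A B : span F A -> span F B -> span F (A `|` B).

Lemma span_trans (T : Type) (F F' : set (set T)) A :
  (forall B, F B -> span F' B) -> span F A -> span F' A.
Proof.
move=> FF'; elim=> {A} [A /FF' //||A _|A B _ hA _ hB]; [exact: span0|exact: spanC|].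
exact: spanU.
Qed.

Definition crosses (T : Type) (A B : set T) :=
  [/\ A `&` B !=set0, A `&` ~` B !=set0, ~` A `&` B !=set0 & ~` A `&` ~` B !=set0].

Section Crosses.
Variable T : Type.
Implicit Types A B D : set T.

Lemma crossesC A B : crosses A B -> crosses B A.
Proof. by move=> [? ? ? ?]; split; rewrite setIC. Qed.

Lemma crosses_setCr A B : crosses A B -> crosses A (~` B).
Proof. by move=> [? ? ? ?]; split; rewrite ?setCK. Qed.

Lemma crosses_setCl A B : crosses A B -> crosses (~` A) B.
Proof. by move=> [? ? ? ?]; split; rewrite ?setCK. Qed.

Lemma not_crosses A B : ~ crosses A B <->
  [\/ A `<=` B, A `<=` ~` B, ~` A `<=` B | ~` A `<=` ~` B].
Proof.
have e C D : (C `<=` D) = ~ (C `&` ~` D !=set0).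
  apply/propext; split=> [CD [x [Cx]]|h x Cx]; first by apply; exact: CD.
  by apply: contra_notP h => Dx; exists x.
rewrite !e !setCK; split=> [|[h [? ? ? ?]|h [? ? ? ?]|h [? ? ? ?]|h [? ? ? ?]] //].
apply: contra_notP => h; split; apply: contra_notP h => h.
- by apply: Or42.
- by apply: Or41.
- by apply: Or44.
- by apply: Or43.
Qed.

Lemma crosses_corner A B D : crosses A B -> crosses (A `&` B) D ->
  crosses A D \/ crosses B D.
Proof.
move=> [_ _ _ [x [nAx nBx]]] cr; apply: contrapT => /not_orP[/not_crosses nA /not_crosses nB].
apply/not_crosses: cr; rewrite setCI.
case: nA => hA; [by apply: Or41 => y [/hA]|by apply: Or42 => y [/hA]|..].
- case: nB => hB; [by apply: Or41 => y [_ /hB]|by apply: Or42 => y [_ /hB]|..].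
  + by apply: Or43 => y [/hA|/hB].
  + by case: (hB _ nBx); exact: hA.
- case: nB => hB; [by apply: Or41 => y [_ /hB]|by apply: Or42 => y [_ /hB]|..].
  + by case: (hA _ nAx); exact: hB.
  + by apply: Or44 => y [/hA|/hB].
Qed.

Lemma crosses_corners A B D : crosses A B ->
  crosses (A `&` B) D -> crosses (~` A `&` ~` B) D -> crosses A D /\ crosses B D.
Proof.
move=> AB c1 c2; split; apply: contrapT => /not_crosses n;
  case: n => h; move: c1 c2 => [p1 p2 p3 p4] [q1 q2 q3 q4].
- by case: p2 => x [[/h]].
- by case: p1 => x [[/h]].
- by case: q2 => x [[/h]].
- by case: q1 => x [[/h]].
- by case: p2 => x [[_ /h]].
- by case: p1 => x [[_ /h]].
- by case: q2 => x [[_ /h]].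
- by case: q1 => x [[_ /h]].
Qed.

(** A set crossing both opposite corners has, on each of its sides, points on both sides of [A] and
    of [B]; a set crossing one corner crosses [A] or [B], because the opposite corner is
    nonempty. *)
Lemma crosses_opposite A B D : crosses A B -> 
  (`[<crosses (A `&` B) D>] + `[<crosses (~` A `&` ~` B) D>] <=
   `[<crosses A D>] + `[<crosses B D>])%N.
Proof.
move=> AB.
have c1 := @crosses_corner A B D AB.
have c2 : crosses (~` A `&` ~` B) D -> crosses A D \/ crosses B D.
  move/(crosses_corner (crosses_setCl (crosses_setCr AB))).
  by case=> /crosses_setCl; rewrite setCK; [left|right].
have c3 := @crosses_corners A B D AB.
case: asboolP => [h1|_]; case: asboolP => [h2|_] //=.
- by have [/asboolP-> /asboolP->] := c3 h1 h2.
- by have [/asboolP->|/asboolP->] := c1 h1; rewrite ?addn1 // leq_addr.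
- by have [/asboolP->|/asboolP->] := c2 h2; rewrite ?addn1 // leq_addr.
Qed.

End Crosses.

(** * Edge boundaries in the Cayley graph *)

Section Cuts.
Variables (G : groupType) (S : finType) (gen : S -> G).
(** Connectedness of the Cayley graph, with edges [(g, s)] from [g] to [g * gen s]; the equivalence
    lets edges be followed backwards. *)
Hypothesis genP : forall (Q : set G) g0, Q g0 ->
  (forall g s, Q g <-> Q (g * gen s)) -> forall g, Q g.

Definition bd (A : set G) : set (G * S) :=
  [set p | `[<A p.1>] != `[<A (p.1 * gen p.2)>]].

(** Connectedness of the induced subgraph, phrased without paths. *)
Definition connected (A : set G) := forall B : set G, B `<=` A -> B !=set0 ->
  (forall g s, A g -> A (g * gen s) -> (B g <-> B (g * gen s))) -> A `<=` B.

Definition cut (A : set G) := finite_set (bd A).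
Definition bsize (A : set G) : nat := card (bd A).

Lemma bd0 : bd set0 = set0.
Proof. by apply/seteqP; split=> // p; rewrite /bd /= eqxx. Qed.

Lemma bdC A : bd (~` A) = bd A.
Proof.
apply/seteqP; split=> -[g s]; rewrite /bd /= !asbool_neg; by do 2!case: asbool.
Qed.

Lemma cutC A : cut A -> cut (~` A).
Proof. by rewrite /cut bdC. Qed.

Lemma bsizeC A : bsize (~` A) = bsize A.
Proof. by rewrite /bsize bdC. Qed.

Lemma bd_setI A B : bd (A `&` B) `<=` bd A `|` bd B.
Proof.
move=> [g s]; rewrite /bd /= !asbool_and.
by do 4!case: asbool => //=; by [left|right].
Qed.

Lemma cutI A B : cut A -> cut B -> cut (A `&` B).
Proof.
by move=> fA fB; apply: (sub_finite_set (@bd_setI _ _)); rewrite finite_setU.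
Qed.

Lemma bd_neq0 A : A !=set0 -> ~` A !=set0 -> bd A !=set0.
Proof.
move=> [x Ax] [y nAy]; apply: contrapT => h; apply: nAy; apply: (genP Ax) => g s.
have e : `[<A g>] = `[<A (g * gen s)>].
  by apply/eqP; apply: contrapT => /negP n; apply: h; exists (g, s).
by split=> /asboolP; [rewrite e|rewrite -e] => /asboolP.
Qed.

Lemma asbool_bd A p : `[<bd A p>] = `[<A p.1>] (+) `[<A (p.1 * gen p.2)>].
Proof. by rewrite /bd /= asboolb addbC; do 2!case: asbool. Qed.

Lemma bsize_corner A B : cut A -> cut B ->
  (bsize (A `&` B) + bsize (~` A `&` ~` B) <= bsize A + bsize B)%N.
Proof.
move=> fA fB; apply: card_pair_leq => // -[g s]; rewrite !asbool_bd /=.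
by rewrite !asbool_and !asbool_neg; do 4!case: asbool.
Qed.

(** No edge joins [B] to the rest of [A], so the boundary of [A] is the disjoint union of two
    boundaries, both nonempty because the Cayley graph is connected. *)
Lemma bsize_disconnected A B : cut A -> B `<=` A -> B !=set0 -> A `\` B !=set0 ->
  (forall g s, A g -> A (g * gen s) -> (B g <-> B (g * gen s))) ->
  [/\ cut B, cut (A `\` B), (bsize B < bsize A)%N & (bsize (A `\` B) < bsize A)%N].
Proof.
move=> fA BA B0 AB0 h.
have hb g s : `[<A g>] -> `[<A (g * gen s)>] -> `[<B g>] = `[<B (g * gen s)>].
  by move=> /asboolP a1 /asboolP a2; apply/asboolP/asboolP; move/(h _ _ a1 a2).
have hB g : `[<B g>] -> `[<A g>] by move=> /asboolP/BA/asboolP.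
have e p : (`[<bd B p>] + `[<bd (A `\` B) p>] = `[<bd A p>])%N.
  case: p => g s; rewrite !asbool_bd /= !asbool_and !asbool_neg.
  have := hb g s; have := hB g; have := hB (g * gen s).
  do 4!case: asbool => //=; do ?[by move=> /(_ isT)|by move=> _ /(_ isT)].
  all: try by move=> _ _ /(_ isT isT).
have s1 : bd B `<=` bd A.
  by move=> p /asboolP Bp; have := e p; rewrite Bp; case: (asboolP (bd A p)) => //; case: asbool.
have s2 : bd (A `\` B) `<=` bd A.
  by move=> p /asboolP Bp; have := e p; rewrite Bp; case: (asboolP (bd A p)) => //; case: asbool.
have c1 : cut B := sub_finite_set s1 fA.
have c2 : cut (A `\` B) := sub_finite_set s2 fA.
(* The empty set fills the fourth slot of [card_pair_leq]. *)
have le : (bsize B + bsize (A `\` B) <= bsize A + bsize set0)%N.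
  apply: card_pair_leq => // [|p]; last by rewrite e leq_addr.
  by rewrite bd0; exact: finite_set0.
have z0 : bsize set0 = 0%N by rewrite /bsize bd0 /card fset_set0.
have p1 : (0 < bsize B)%N.
  apply: card_gt0 => //; apply: bd_neq0 => //; case: AB0 => x [_ ?]; by exists x.
have p2 : (0 < bsize (A `\` B))%N.
  apply: card_gt0 => //; apply: bd_neq0 => //; case: B0 => x Bx; exists x => -[_ //].
by split=> //; lia.
Qed.

End Cuts.

(** * Optimal cuts and their nestedness *)

Section Optimal.
Variables (G : groupType) (S : finType) (gen : S -> G).
Hypothesis genP : forall (Q : set G) g0, Q g0 ->
  (forall g s, Q g <-> Q (g * gen s)) -> forall g, Q g.

Local Notation bd := (bd gen).
Local Notation cut := (cut gen).
Local Notation bsize := (bsize gen).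
Local Notation connected := (connected gen).

Definition reach (F : set (G * S)) : G -> G -> Prop :=
  clos_refl_sym_trans _ (fun x y => exists2 s, y = x * gen s & ~ F (x, s)).

Lemma reach_path F u v : reach F u v -> exists p : seq (G * S),
  (forall f, f \in p -> ~ F f) /\
  forall D : set G, `[<D u>] != `[<D v>] -> exists2 f, f \in p & bd D f.
Proof.
elim=> {u v} [x y [s -> nF]|x|x y _ [p [pF h]]|x y z _ [p [pF hp]] _ [q [qF hq]]].
- exists [:: (x, s)]; split=> [f|D h]; first by rewrite inE => /eqP->.
  by exists (x, s); rewrite ?inE.
- by exists [::]; split=> // D; rewrite eqxx.
- by exists p; split=> // D; rewrite eq_sym; exact: h.
- exists (p ++ q); split=> [f|D h].
    by rewrite mem_cat => /orP[]; [exact: pF|exact: qF].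
  case: (eqVneq `[<D x>] `[<D y>]) => [e|/hp[f fp Df]].
    by have [|f fq Df] := hq D; [rewrite -e|exists f => //; rewrite mem_cat fq orbT].
  by exists f => //; rewrite mem_cat fp.
Qed.

Lemma reach_all x y : reach set0 x y.
Proof.
apply: (genP (rst_refl _ _ x)) => g s; split=> h.
  by apply: rst_trans h _; apply: rst_step; exists s.
by apply: rst_trans h _; apply: rst_sym; apply: rst_step; exists s.
Qed.

Variable N : nat.

Definition edge_cut (D : set G) :=
  [/\ connected D, connected (~` D), cut D & (bsize D <= N)%N].

Lemma edge_cutC D : edge_cut D -> edge_cut (~` D).
Proof. by move=> [? ? ? ?]; split; rewrite ?setCK ?bsizeC //; exact: cutC. Qed.

(** [D] and its complement are connected and have no edge of [F] inside, so each stays within one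
    component left by [F]. *)
Lemma edge_cut_component (F : seq (G * S)) e D : e \in F ->
  ~ reach [set` F] e.1 (e.1 * gen e.2) -> edge_cut D ->
  (forall f, f \in F -> bd D f) -> D e.1 -> D = [set x | reach [set` F] e.1 x].
Proof.
move=> eF nr [cD cnD _ _] FD De.
have nDe : ~ D (e.1 * gen e.2).
  by move/asboolP=> h; have := FD _ eF; rewrite /bd /= h; move/asboolP: De => ->.
have noF (C : set G) : (forall f, f \in F -> bd C f) ->
    forall g s, C g -> C (g * gen s) -> ~ [set` F] (g, s).
  by move=> FC g s /asboolP h1 /asboolP h2 /FC; rewrite /bd /= h1 h2.
have key (C : set G) u : (forall f, f \in F -> bd C f) -> connected C -> C u ->
    C `<=` [set x | reach [set` F] u x].
  move=> FC cC Cu x Cx; suff [] : (C `&` [set x | reach [set` F] u x]) x by [].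
  apply: cC Cx; first by move=> ? [].
  - by exists u; split=> //; exact: rst_refl.
  - move=> g s Cg Cgs.
    have e1 : reach [set` F] g (g * gen s).
      by apply: rst_step; exists s => //; exact: noF Cgs.
    split=> -[_ /= r]; split=> //; apply: rst_trans r _ => //; exact: rst_sym.
apply/seteqP; split; first exact: key.
move=> x /= rx; apply: contrapT => nDx.
apply: nr; apply: rst_trans rx _; apply: rst_sym.
apply: (key (~` D)) => // f /FD; by rewrite bdC.
Qed.

(** Dunwoody's finiteness argument. If [F] does not separate the ends of [e], a path avoiding [F]
    joins them, and every [D] cuts one of its finitely many edges, which is added to [F]. If it
    does, [D] or its complement is a fixed component. Once [F] has more than [N] edges, no [D] is
    left. *)
Lemma finite_edge_cuts_through k (F : seq (G * S)) e : e \in F -> uniq F ->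
  (N < size F + k)%N ->
  finite_set [set D | edge_cut D /\ forall f, f \in F -> bd D f].
Proof.
elim: k F => [|k IH] F eF uF NF.
  apply: (@sub_finite_set _ _ set0) => [D [[_ _ fD sD] FD]|]; last exact: finite_set0.
  rewrite addn0 in NF.
  by have := leq_trans NF (leq_trans (card_seq uF fD FD) sD); rewrite ltnn.
have [r|nr] := pselect (reach [set` F] e.1 (e.1 * gen e.2)).
  have [p [pF hp]] := reach_path r.
  apply: (@sub_finite_set _ _ (\bigcup_(f in [set` p])
    [set D | edge_cut D /\ forall f', f' \in f :: F -> bd D f'])).
    move=> D [eD FD]; have [f fp Df] := hp D (FD _ eF).
    exists f => //; split=> // f'; rewrite inE => /predU1P[-> //|]; exact: FD.
  apply: bigcup_finite; first exact: finite_seq.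
  move=> f fp; apply: IH; rewrite ?inE ?eF ?orbT //=; last by lia.
  by rewrite uF andbT; apply/negP => /(pF _ fp).
pose U := [set x | reach [set` F] e.1 x].
apply: (@sub_finite_set _ _ [set U; ~` U]) => [D [eD FD]|]; last exact: finite_set2.
have [De|nDe] := pselect (D e.1); first by left; apply: edge_cut_component FD De.
right; rewrite /U -(edge_cut_component eF nr (edge_cutC eD) _ nDe) ?setCK //.
by move=> f /FD; rewrite bdC.
Qed.

Lemma finite_edge_cuts x y : finite_set [set D | edge_cut D /\ D x /\ ~ D y].
Proof.
have [p [_ hp]] := reach_path (reach_all x y).
apply: (@sub_finite_set _ _ (\bigcup_(f in [set` p])
    [set D | edge_cut D /\ forall f', f' \in [:: f] -> bd D f'])).
  move=> D [eD [/asboolP Dx /asboolPn nDy]].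
  have [|f fp Df] := hp D; first by rewrite Dx (negbTE nDy).
  by exists f => //; split=> // f'; rewrite inE => /eqP->.
apply: bigcup_finite; first exact: finite_seq.
by move=> f _; apply: (@finite_edge_cuts_through N _ f); rewrite ?inE.
Qed.

Definition crossing (A : set G) : set (set G) := [set D | edge_cut D /\ crosses A D].
Definition mu A : nat := card (crossing A).

Lemma connected_edge A D : connected D -> D `&` A !=set0 -> D `&` ~` A !=set0 ->
  exists g s, [/\ D g, D (g * gen s) & bd A (g, s)].
Proof.
move=> cD DA [y [Dy nAy]]; apply: contrapT => h.
have [] := cD (D `&` A) _ DA _ _ Dy; [by move=> ? []| |by []].
move=> g s Dg Dgs.
have e : `[<A g>] = `[<A (g * gen s)>].
  by apply/eqP; apply: contrapT => /negP n; apply: h; exists g, s.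
by split=> -[_ /asboolP Ag]; split=> //; apply/asboolP; [rewrite -e|rewrite e].
Qed.

(** [D] and its complement are connected and meet both sides of [A], so each contains a boundary
    edge of [A]; hence [D] separates two ends of these finitely many edges. *)
Lemma finite_crossing A : cut A -> finite_set (crossing A).
Proof.
move=> fA; pose W := (fst @` bd A) `|` ((fun p => p.1 * gen p.2) @` bd A).
have fW : finite_set W by rewrite finite_setU; split; exact: finite_image.
apply: (@sub_finite_set _ _ (\bigcup_(p in W `*` W)
    [set D | edge_cut D /\ D p.1 /\ ~ D p.2])).
  move=> D [eD [c1 c2 c3 c4]].
  have [g [s [Dg _ b1]]] : exists g s, [/\ D g, D (g * gen s) & bd A (g, s)].
    by apply: connected_edge; [case: eD|rewrite setIC|rewrite setIC].
  have [h [t [Dh _ b2]]] : exists g s, [/\ ~ D g, ~ D (g * gen s) & bd A (g, s)].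
    by apply: (@connected_edge A (~` D)); [case: eD|rewrite setIC|rewrite setIC].
  exists (g, h) => //; split; left; [by exists (g, s)|by exists (h, t)].
apply: bigcup_finite; first exact: finite_setX.
by move=> p _; exact: finite_edge_cuts.
Qed.

Lemma muC A : mu (~` A) = mu A.
Proof.
rewrite /mu; congr card; apply/seteqP; split=> D [eD /crosses_setCl c];
  by split=> //; rewrite setCK in c.
Qed.

(** Strict because [A] itself crosses [B] but neither corner. *)
Lemma mu_corner A B : cut A -> cut B -> edge_cut A -> edge_cut B -> crosses A B ->
  (mu (A `&` B) + mu (~` A `&` ~` B) < mu A + mu B)%N.
Proof.
move=> fA fB eA eB AB; apply: (@card_pair_ltn _ _ _ _ _ _ _ _ A).
- exact: finite_crossing.
- exact: finite_crossing.
- move=> D; rewrite /crossing /= !asbool_and.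
  by have := crosses_opposite D AB; case: (asboolP (edge_cut D)).
have nc C : C `<=` A \/ C `<=` ~` A -> `[<crossing C A>] = false.
  move=> CA; apply/asboolPn => -[_]; apply/not_crosses.
  by case: CA; [exact: Or41|exact: Or42].
have h1 : `[<crossing (A `&` B) A>] = false by apply: nc; left=> x [].
have h2 : `[<crossing (~` A `&` ~` B) A>] = false by apply: nc; right=> x [].
have h3 : `[<crossing B A>] by apply/asboolP; split=> //; exact: crossesC.
by rewrite h1 h2 h3 addn1.
Qed.

Definition simpler C A := (bsize C < bsize A)%N \/ bsize C = bsize A /\ (mu C < mu A)%N.

Definition lower A : set (set G) := [set C | cut C /\ simpler C A].

Definition optimal A := [/\ cut A, (bsize A <= N)%N & ~ span (lower A) A].

Lemma optimal_span A : cut A -> (bsize A <= N)%N -> span optimal A.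
Proof.
have [n] := ubnP (bsize A); elim: n A => // n IHn A An.
have [m] := ubnP (mu A); elim: m A An => // m IHm A An Am fA AN.
have [oA|] := pselect (optimal A); first exact: span_mem.
move=> noA; have : span (lower A) A by apply: contrapT => h; apply: noA.
apply: span_trans => C [fC [lt|[eC lt]]].
- by apply: IHn => //; lia.
- by apply: IHm => //; lia.
Qed.

Lemma lowerC A : lower (~` A) = lower A.
Proof. by rewrite /lower /simpler bsizeC muC. Qed.

Lemma optimalC A : optimal A -> optimal (~` A).
Proof.
move=> [fA AN nA]; split; [exact: cutC|by rewrite bsizeC|].
by rewrite lowerC => /spanC; rewrite setCK => /nA.
Qed.

(** Otherwise [A] is the union of two cuts with fewer boundary edges. *)
Lemma optimal_connected A : optimal A -> connected A.
Proof.
move=> [fA AN nA] B BA B0 h x Ax; apply: contrapT => nBx.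
have AB0 : A `\` B !=set0 by exists x.
have [cB cAB sB sAB] := bsize_disconnected genP fA BA B0 AB0 h.
apply: nA; rewrite -[X in span _ X](setDUK BA).
by apply: spanU; apply: span_mem; split=> //; left.
Qed.

Lemma optimal_edge_cut A : optimal A -> edge_cut A.
Proof.
move=> oA; split; [exact: optimal_connected| |by case: oA|by case: oA].
by apply: optimal_connected; exact: optimalC.
Qed.

Lemma optimal_neq0 A : optimal A -> A !=set0.
Proof.
move=> [_ _ nA]; apply: contrapT => h; apply: nA.
suff -> : A = set0 by exact: span0.
by apply/seteqP; split=> // x Ax; case: h; exists x.
Qed.

Let not_both A C D : optimal A -> cut C -> cut D -> (A = C `|` D \/ ~` A = C `|` D) ->
  simpler C A -> simpler D A -> False.
Proof.
move=> [_ _ nA] fC fD e sC sD.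
have h : span (lower A) (C `|` D) by apply: spanU; apply: span_mem.
by case: e => e; rewrite -e in h => //; apply: nA; move/spanC: h; rewrite setCK.
Qed.

(** Order sets by the pair [(bsize, mu)], lexicographically: opposite corners add up to less than
    [A] and [B], while two corners making up [A], [B] or a complement are never both simpler than
    that set. If, say, [a >= A], then [d < B], so [b >= B], so [c < A], so [d >= A]; now
    [c < A <= d < B] gives [a >= B], whence [d < A], a contradiction. The case [b >= A] is
    symmetric. *)
Lemma optimal_nested A B : optimal A -> optimal B -> ~ crosses A B.
Proof.
move=> oA oB AB.
have fA : cut A by case: oA. have fB : cut B by case: oB.
have eA := optimal_edge_cut oA; have eB := optimal_edge_cut oB.
have fA' := cutC fA; have fB' := cutC fB.
pose a := A `&` B; pose b := A `&` ~` B; pose c := ~` A `&` B; pose d := ~` A `&` ~` B.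
have ca : cut a by exact: cutI. have cb : cut b by exact: cutI.
have cc : cut c by exact: cutI. have cd : cut d by exact: cutI.
have s1 : (bsize a + bsize d <= bsize A + bsize B)%N by exact: bsize_corner.
have s2 : (bsize b + bsize c <= bsize A + bsize B)%N.
  by have := bsize_corner fA fB'; rewrite bsizeC setCK.
have m1 : (mu a + mu d < mu A + mu B)%N by exact: mu_corner.
have m2 : (mu b + mu c < mu A + mu B)%N.
  have := mu_corner fA fB' eA (edge_cutC eB) (crosses_setCr AB).
  by rewrite muC setCK.
have eab : A = a `|` b by rewrite /a /b -setIUr setUv setIT.
have ecd : ~` A = c `|` d by rewrite /c /d -setIUr setUv setIT.
have eac : B = a `|` c by rewrite /a /c -setIUl setUv setTI.
have ebd : ~` B = b `|` d by rewrite /b /d -setIUl setUv setTI.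
have h1 := not_both oA ca cb (or_introl eab); have h2 := not_both oA cc cd (or_intror ecd).
have h3 := not_both oB ca cc (or_introl eac); have h4 := not_both oB cb cd (or_intror ebd).
move: h1 h2 h3 h4; rewrite /simpler.
move: (bsize A) (bsize B) (bsize a) (bsize b) (bsize c) (bsize d) s1 s2.
move: (mu A) (mu B) (mu a) (mu b) (mu c) (mu d) m1 m2.
clear; lia.
Qed.

End Optimal.

Lemma crosses_lset (G : groupType) (g : G) A B :
  crosses A B -> crosses (lset g A) (lset g B).
Proof.
have h C D : C `&` D !=set0 -> lset g C `&` lset g D !=set0.
  by move=> [x [Cx Dx]]; exists (g * x); split; apply/lset_mul.
by move=> [? ? ? ?]; split; rewrite -?lsetC; apply: h.
Qed.

(** * Translates, orbits and stabilisers of optimal cuts *)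

Section OptimalInvariance.
Variables (G : groupType) (S : finType) (gen : S -> G).
Hypothesis genP : forall (Q : set G) g0, Q g0 ->
  (forall g s, Q g <-> Q (g * gen s)) -> forall g, Q g.
Variable N : nat.

Local Notation bd := (bd gen).
Local Notation cut := (cut gen).
Local Notation bsize := (bsize gen).
Local Notation connected := (connected gen).
Local Notation edge_cut := (edge_cut gen N).
Local Notation mu := (mu gen N).
Local Notation optimal := (optimal gen N).

Let sh (g : G) (p : G * S) := (g * p.1, p.2).

Let sh_inj g : injective (sh g).
Proof. by move=> [x s] [y t] [/mulgI-> ->]. Qed.

Lemma bd_lset g A : bd (lset g A) = sh g @` bd A.
Proof.
apply/seteqP; split=> [[x s]|_ [[x s] h <-]]; rewrite /bd /lset /=.
  by move=> h; exists (g^-1 * x, s); rewrite /= -?mulgA // /sh /= mulVKg.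
by move: h; rewrite /bd /= -!mulgA !mulKg.
Qed.

Lemma cut_lset g A : cut A -> cut (lset g A).
Proof. by move=> fA; rewrite /cut bd_lset; exact: finite_image. Qed.

Lemma bsize_lset g A : cut A -> bsize (lset g A) = bsize A.
Proof. by move=> fA; rewrite /bsize bd_lset card_image_inj. Qed.

Lemma connected_lset g A : connected A -> connected (lset g A).
Proof.
move=> cA B BA [b Bb] h x; rewrite -{1}(mulVKg g x) lset_mul => Ax.
suff : lset g^-1 B (g^-1 * x) by rewrite lset_mul.
apply: cA Ax.
- by move=> y; rewrite -{1}(mulKg g y) lset_mul => /BA; rewrite lset_mul.
- by exists (g^-1 * b); apply/lset_mul.
- move=> y s Ay Ays; rewrite -{1}(mulKg g y) -{1}(mulKg g (y * _)) !lset_mul mulgA.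
  by apply: h; rewrite -?mulgA lset_mul.
Qed.

Lemma edge_cut_lset g A : edge_cut A -> edge_cut (lset g A).
Proof.
move=> [cA cA' fA sA]; split; rewrite ?bsize_lset -?lsetC //;
  [exact: connected_lset|exact: connected_lset|exact: cut_lset].
Qed.

Lemma crossing_lset g A : crossing gen N (lset g A) = lset g @` crossing gen N A.
Proof.
have h k B D : crossing gen N B D -> crossing gen N (lset k B) (lset k D).
  by move=> [eD c]; split; [exact: edge_cut_lset|exact: crosses_lset].
apply/seteqP; split=> [D cD|_ [D cD <-]]; last exact: h.
exists (lset g^-1 D); last exact: lsetVK.
by rewrite -[A](lsetK g); apply: h.
Qed.

Lemma mu_lset g A : cut A -> mu (lset g A) = mu A.
Proof.
move=> fA; rewrite /mu crossing_lset card_image_inj //; first exact: lset_inj.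
exact: finite_crossing.
Qed.

Lemma span_lset g A B : cut A -> span (lower gen N A) B ->
  span (lower gen N (lset g A)) (lset g B).
Proof.
move=> fA; elim=> {B} [B [cB sB]||B _|B C _ hB _ hC].
- apply: span_mem; split; first exact: cut_lset.
  by rewrite /simpler !bsize_lset // !mu_lset.
- exact: span0.
- exact: spanC.
- exact: spanU.
Qed.

Lemma optimal_lset g A : optimal A -> optimal (lset g A).
Proof.
move=> [fA sA nA]; split; rewrite ?bsize_lset //; first exact: cut_lset.
move=> h; apply: nA.
by have := span_lset g^-1 (cut_lset g fA) h; rewrite !lsetK.
Qed.

(** Translating a boundary edge to start at 1 leaves half-spaces separating 1 from some [gen s], of
    which there are finitely many. *)
Lemma optimal_finite_orbits : exists R : set (set G), [/\ finite_set R,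
  R `<=` optimal & forall A, optimal A -> exists g, exists2 B, R B & A = lset g B].
Proof.
exists [set D | optimal D /\ exists s, (edge_cut D /\ D 1 /\ ~ D (gen s)) \/
                              (edge_cut D /\ D (gen s) /\ ~ D 1)].
split=> [|D []//|A oA].
  apply: (@sub_finite_set _ _ (\bigcup_(s in setT)
    ([set D | edge_cut D /\ D 1 /\ ~ D (gen s)] `|`
     [set D | edge_cut D /\ D (gen s) /\ ~ D 1]))).
    by move=> D [_ [s h]]; exists s.
  apply: bigcup_finite; first exact: finite_finset.
  by move=> s _; rewrite finite_setU; split; exact: finite_edge_cuts.
have [[x s] b] : bd A !=set0.
  by apply: (bd_neq0 genP); apply: optimal_neq0; [exact: oA|exact: (optimalC oA)].
exists x, (lset x^-1 A); last by rewrite lsetVK.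
have eA := edge_cut_lset x^-1 (optimal_edge_cut genP oA).
split; first exact: optimal_lset.
exists s.
have -> : lset x^-1 A 1 = A x by rewrite /lset /= invgK mulg1.
have -> : lset x^-1 A (gen s) = A (x * gen s) by rewrite /lset /= invgK.
move: b; rewrite /bd /=.
by case: asboolP => ?; case: asboolP => // ? _; [left|right].
Qed.

(** The stabiliser acts freely on the boundary edges, of which there are at most [N]. *)
Lemma optimal_stab e : optimal e -> finite_set [set g | lset g e = e] /\
  (card [set g | lset g e = e] <= N)%N.
Proof.
move=> oe; have [p b] : bd e !=set0.
  by apply: (bd_neq0 genP); apply: optimal_neq0; [exact: oe|exact: (optimalC oe)].
pose i (g : G) := sh g p.
have ii : injective i by move=> g h [/mulIg].
have sub : i @` [set g | lset g e = e] `<=` bd e.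
  by move=> _ [g /= ge <-]; rewrite -ge bd_lset; exists p.
have [fe se _] := oe.
have fin : finite_set [set g | lset g e = e].
  apply: (sub_finite_set _ (finite_preimage (in2W ii) fe)) => g ge.
  by apply: sub; exists g.
split=> //; apply: leq_trans se; rewrite -(card_image_inj ii) //.
exact: card_leq.
Qed.

End OptimalInvariance.

(** * Trees of half-spaces *)

(** The oriented edges of a tree: complement reverses an edge, inclusion orders edges along paths,
    and the last axiom makes paths finite. *)
Record tree_set (G : groupType) (E : set (set G)) : Prop := TreeSet {
  tree_setC : forall e, E e -> E (~` e);
  tree_lset : forall g e, E e -> E (lset g e);
  tree_neq0 : forall e, E e -> e !=set0;
  tree_nested : forall e f, E e -> E f -> ~ crosses e f;
  tree_finite : forall x y, finite_set [set e | E e /\ e x /\ ~ e y] }.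

(* Half-spaces [e] and [f] are adjacent when they start at the same vertex of
   the tree, each half-space being the part of the tree beyond an edge. *)
Definition adjacent (T : Type) (E : set (set T)) (e f : set T) :=
  e = f \/ [/\ e `<=` ~` f, e <> ~` f &
    forall x, E x -> e `<=` x -> x `<=` ~` f -> x = e \/ x = ~` f].

Lemma subsetCr (T : Type) (A B : set T) : A `<=` ~` B -> B `<=` ~` A.
Proof. by move=> h x Bx /h. Qed.

Lemma subsetCl (T : Type) (A B : set T) : ~` A `<=` B -> ~` B `<=` A.
Proof. by move=> h x nBx; apply: contrapT => /h. Qed.

Lemma subsetCC (T : Type) (A B : set T) : ~` A `<=` ~` B -> B `<=` A.
Proof. by move=> h x Bx; apply: contrapT => /h. Qed.

Section TreeSet.
Variables (G : groupType) (E : set (set G)).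
Hypothesis tE : tree_set E.

Let EC := tree_setC tE.

Lemma tree_nest e f : E e -> E f ->
  [\/ e `<=` f, e `<=` ~` f, ~` e `<=` f | ~` e `<=` ~` f].
Proof. by move=> Ee Ef; apply/not_crosses/(tree_nested tE). Qed.

Lemma tree_disjoint e f : E e -> E f -> e `<=` f -> e `<=` ~` f -> False.
Proof. by move=> Ee Ef ef enf; have [x ex] := tree_neq0 tE Ee; exact: enf (ef _ ex). Qed.

Lemma tree_cover e f : E e -> E f -> e `<=` f -> ~` e `<=` f -> False.
Proof.
move=> Ee Ef ef nef; have [x nfx] := tree_neq0 tE (EC Ef); apply: (nfx).
by have [/ef|/nef] := pselect (e x).
Qed.

Lemma tree_nest_out e f p : E e -> E f -> ~ e p -> ~ f p ->
  [\/ e `<=` f, f `<=` e | e `<=` ~` f].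
Proof.
move=> Ee Ef ep fp; have [h|h|h|h] := tree_nest Ee Ef.
- exact: Or31. - exact: Or33. - by case: fp; exact: h.
- by apply: Or32; exact: subsetCC.
Qed.

Lemma finite_above e p : E e -> finite_set [set x | E x /\ e `<=` x /\ ~ x p].
Proof.
move=> Ee; have [a ea] := tree_neq0 tE Ee.
by apply: (sub_finite_set _ (tree_finite tE a p)) => x [Ex [/(_ _ ea) xa xp]].
Qed.

(** The first edge after [e] on the path to [f]; it exists because intervals are finite. *)
Lemma next_above e f : E e -> E f -> e `<=` f -> e <> f ->
  exists x, [/\ E x, x <> e, e `<=` x, x `<=` f & adjacent E e (~` x)].
Proof.
move=> Ee; have [n] := ubnP (card [set x | E x /\ e `<=` x /\ x `<=` f]).
elim: n f => // n IH f cn Ef ef nef.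
have [h|] := pselect (forall x, E x -> e `<=` x -> x `<=` f -> x = e \/ x = f).
  exists f; split=> //; [exact: nesym|right; rewrite setCK; split=> //].
move=> /existsNP[y /not_implyP[Ey /not_implyP[ey /not_implyP[yf /not_orP[ye yf']]]]].
have [||x [Ex xe ex xy ax]] := IH y _ Ey ey; [|exact: nesym|]; last first.
  by exists x; split=> //; exact: subset_trans yf.
apply: leq_trans (_ : card _ < card [set x | E x /\ e `<=` x /\ x `<=` f])%N _ => //.
have [p nfp] := tree_neq0 tE (EC Ef).
have fin : finite_set [set x | E x /\ e `<=` x /\ x `<=` f].
  by apply: (sub_finite_set _ (finite_above p Ee)) => x [Ex [ex xf]]; split=> //; split=> // /xf.
have fin' : finite_set [set x | E x /\ e `<=` x /\ x `<=` y].
  by apply: (sub_finite_set _ fin) => x [Ex [ex xy]]; split=> //; split=> // z /xy/yf.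
apply: (card_ltn (x := f)) => // [x [Ex [ex xy]]||[_ [_ fy]]].
- by split=> //; split=> // z /xy/yf.
- by split=> //; split.
by apply: yf'; exact/seteqP.
Qed.

(** A point [p] determines a vertex, every edge being oriented towards the side of [p]; the maximal
    half-spaces avoiding [p] are the edges leaving that vertex. *)
Lemma maximal_outside e p : E e -> ~ e p -> exists x, [/\ E x, e `<=` x, ~ x p &
  forall y, E y -> x `<=` y -> ~ y p -> y = x].
Proof.
have [n] := ubnP (card [set x | E x /\ e `<=` x /\ ~ x p]).
elim: n e => // n IH e cn Ee ep.
have [h|] := pselect (forall y, E y -> e `<=` y -> ~ y p -> y = e); first by exists e; split.
move=> /existsNP[y /not_implyP[Ey /not_implyP[ey /not_implyP[yp ye]]]].
have [|||x [Ex yx xp xm]] := IH y => //; last by exists x; split=> // z /ey/yx.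
apply: leq_trans (_ : card _ < card [set x | E x /\ e `<=` x /\ ~ x p])%N _ => //.
apply: (card_ltn (x := e)) => // [|x [Ex [yx xp]]||[_ [yE _]]].
- exact: finite_above.
- by split=> //; split=> // z /ey/yx.
- by split=> //; split.
- by apply: ye; exact/seteqP.
Qed.

Lemma adjacent_sym e f : adjacent E e f -> adjacent E f e.
Proof.
move=> [->|[h1 h2 h3]]; [by left|right; split; first exact: subsetCr].
  by move=> fe; apply: h2; rewrite fe setCK.
move=> x Ex fx xe; have [||<-|] := h3 (~` x) (EC Ex).
- exact: subsetCr. - exact: subsetC.
- by right; rewrite setCK.
- by move/(congr1 setC); rewrite !setCK => ->; left.
Qed.

Lemma adjacent_sub e f : adjacent E e f -> e <> f -> e `<=` ~` f.
Proof. by case=> // -[]. Qed.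

(** Makes adjacency an equivalence relation, whose classes are the vertices of the tree. *)
Lemma adjacent_trans e f k : E e -> E f -> E k ->
  adjacent E e f -> adjacent E f k -> adjacent E e k.
Proof.
move=> Ee Ef Ek [->//|[ef nef hef]] /adjacent_sym[->|[kf nkf hkf]]; first by right.
have [->|nek] := pselect (e = k); first by left.
have [h|h|h|h] := tree_nest Ee Ek.
- by have [|ke|] := hef k Ek h => //; case: nek.
- right; split=> // [e0|x Ex ex xk].
    apply: (tree_cover Ek (EC Ef) kf); by rewrite -e0.
  have [h1|h1|h1|h1] := tree_nest Ex Ef.
  + by case: (tree_disjoint Ee Ef (subset_trans ex h1) ef).
  + have [xf|xf] := hef x Ex ex h1; [by left|].
    rewrite xf in xk; case: (tree_disjoint Ek Ef) => //.
    by rewrite -(setCK f); exact: subsetCr.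
  + case: (tree_disjoint Ek Ef) => //; apply: subset_trans h1; exact: subsetCr.
  + have [||xf|xf] := hkf (~` x) (EC Ex) => //; first exact: subsetCr.
      by right; rewrite -xf setCK.
    have {}xf : x = f by rewrite -(setCK x) xf setCK.
    by case: (tree_disjoint Ee Ef) => //; rewrite -xf.
- case: (tree_cover Ek (EC Ef) kf); apply: subset_trans ef; exact: subsetCl.
- have [|ke|] := hkf e Ee _ ef => //.
    exact: subsetCC.
Qed.

Lemma adjacent_lset g e f : adjacent E e f -> adjacent E (lset g e) (lset g f).
Proof.
move=> [->|[h1 h2 h3]]; [by left|right; split].
- by rewrite -lsetC; apply/lset_sub.
- by rewrite -lsetC => /lset_inj.
- move=> x Ex ex xf; have [||xe|xe] := h3 (lset g^-1 x) (tree_lset tE _ Ex).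
  + by rewrite -(lsetK g e); apply/lset_sub.
  + by rewrite -(lsetK g (~` f)); apply/lset_sub.
  + by left; rewrite -xe lsetVK.
  + by right; rewrite -lsetC -xe lsetVK.
Qed.

(** Seen from the origin of [e0], the edge [f] lies in the direction of some edge of the star. *)
Lemma star_side e0 f : E e0 -> E f -> exists e, [/\ E e, adjacent E e0 e &
  f `<=` e \/ ~` f `<=` e].
Proof.
move=> Ee Ef.
have key k : E k -> e0 `<=` k -> exists e, [/\ E e, adjacent E e0 e & k `<=` e \/ ~` k `<=` e].
  move=> Ek ek; have [ek'|nek] := pselect (e0 = k).
    by exists e0; split=> //; [left|left; rewrite ek'].
  have [x [Ex xe ex xk ax]] := next_above Ee Ek ek nek.
  by exists (~` x); split=> //; [exact: EC|right; exact: subsetC].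
have [h|h|h|h] := tree_nest Ef Ee.
- by exists e0; split=> //; [left|left].
- have [e [? ? h']] := key _ (EC Ef) (subsetCr h).
  by exists e; split=> //; case: h'; [right|rewrite setCK; left].
- by exists e0; split=> //; [left|right].
- by apply: key => //; exact: subsetCC.
Qed.

End TreeSet.

(** * Local finiteness of the tree *)

Section Star.
Variables (G : groupType) (E : set (set G)).
Hypothesis tE : tree_set E.

Let EC := tree_setC tE.

Definition star (e0 : set G) : set (set G) := [set e | E e /\ adjacent E e0 e].

Lemma star_lset g e0 e : star e0 e -> star (lset g e0) (lset g e).
Proof. by move=> [Ee a]; split; [exact: tree_lset|exact: adjacent_lset]. Qed.

Lemma star_sub e0 e f : E e0 -> star e0 e -> star e0 f -> e <> f -> e `<=` ~` f.
Proof.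
move=> E0 [Ee ae] [Ef af]; apply: adjacent_sub.
exact: (adjacent_trans tE Ee E0 Ef (adjacent_sym tE ae) af).
Qed.

Definition almost n e0 (C : set G) := exists2 t : seq (set G), (size t <= n)%N &
  (forall e, star e0 e -> e \notin t -> e `<=` C) \/
  (forall e, star e0 e -> e \notin t -> e `<=` ~` C).

(* Each half-space of the tree has all but one element of a star on one side. *)
Lemma almost_span C : span E C -> exists n, forall e0, E e0 -> almost n e0 C.
Proof.
elim=> {C} [f Ef||C _ [n h]|C D _ [n hC] _ [m hD]].
- exists 1%N => e0 E0; have [e [Ee a h]] := star_side tE E0 Ef.
  exists [:: e] => //; case: h => h; [right|left] => k sk; rewrite inE => /eqP nke.
    apply: subset_trans (_ : ~` e `<=` _); last exact: subsetC.
    exact: (star_sub E0 sk).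
  apply: subset_trans (_ : ~` e `<=` _); last exact: subsetCl.
  exact: (star_sub E0 sk).
- by exists 0%N => e0 E0; exists [::] => //; right=> e _ _ x _ [].
- exists n => e0 E0; have [t tn [ht|ht]] := h e0 E0; exists t => //; [right|by left].
  by move=> e se et; rewrite setCK; exact: ht.
- exists (n + m)%N => e0 E0; have [t tn ht] := hC e0 E0; have [u um hu] := hD e0 E0.
  exists (t ++ u); first by rewrite size_cat leq_add.
  case: ht => ht; first by left=> e se; rewrite mem_cat negb_or => /andP[et _] x /(ht e se et); left.
  case: hu => hu; first by left=> e se; rewrite mem_cat negb_or => /andP[_ eu] x /(hu e se eu); right.
  right=> e se; rewrite mem_cat negb_or setCU => /andP[et eu] x ex.
  by split; [exact: ht ex|exact: hu ex].
Qed.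

Lemma almost_lset n g e0 C : almost n (lset g^-1 e0) C -> almost n e0 (lset g C).
Proof.
move=> [t tn h]; exists (map (lset g) t); first by rewrite size_map.
have nt e : e \notin map (lset g) t -> lset g^-1 e \notin t.
  by apply: contra => et; rewrite -(lsetVK g e); exact: map_f.
case: h => h; [left|right] => e /(star_lset g^-1) se /nt et.
  by rewrite -(lsetVK g e); apply/lset_sub; exact: h.
by rewrite -lsetC -(lsetVK g e); apply/lset_sub; exact: h.
Qed.

Variables (S : finType) (N : normal_forms G S).

Definition cone (w : seq S) : set G := [set g | prefix w (nf N g)].

Lemma cone_rcons w x : cone w x -> x = word_val N w \/ exists s, cone (rcons w s) x.
Proof.
rewrite /cone /= => /prefixP[[|s t] e].
  by left; rewrite -(nfK N x) e cats0.
by right; exists s; rewrite e -cat_rcons prefix_prefix.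
Qed.

Hypothesis coneE : exists2 R : set (set G), finite_set R /\ R `<=` span E &
  forall w, exists g, exists2 D, R D & cone w = lset g D.

Lemma almost_cone : exists M, forall w e0, E e0 -> almost M e0 (cone w).
Proof.
have [R [fR RE] cR] := coneE.
have [M hM] : exists M, forall D, R D -> forall e0, E e0 -> almost M e0 D.
  move: fR => /finite_seqP[s Rs].
  have {RE} : forall D, D \in s -> span E D by move=> D Ds; apply: RE; rewrite Rs.
  rewrite Rs {R cR Rs}; elim: s => [_|D s IH RE]; first by exists 0%N.
  have [M hM] : exists M, forall C, [set` s] C -> forall e0, E e0 -> almost M e0 C.
    by apply: IH => C sC; apply: RE; rewrite inE sC orbT.
  have [m hm] := almost_span (RE D (mem_head _ _)).
  exists (M + m)%N => C; rewrite /= inE => /predU1P[->|sC] e0 E0.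
    by have [t tn h] := hm e0 E0; exists t => //; lia.
  by have [t tn h] := hM C sC e0 E0; exists t => //; lia.
exists M => w e0 E0; have [g [D RD ->]] := cR w; apply: almost_lset.
by apply: hM => //; exact: tree_lset.
Qed.

(* An infinite star would follow an infinite path of cones; as the cones have
   empty intersection, more and more of its elements would stay behind. *)
Lemma finite_star e0 : E e0 -> finite_set (star e0).
Proof.
move=> E0; apply: contrapT => inf; have [M hM] := almost_cone.
have path n : exists w t, [/\ size w = n, (size t <= M)%N &
    forall e, star e0 e -> e \notin t -> e `<=` cone w].
  elim: n => [|n [w [t [sw tM h]]]].
    by exists [::], [::]; split=> // e _ _ x _; exact: prefix0s.
  apply: contrapT => no; apply: inf.
  have nos s : exists t' : seq (set G), forall e, star e0 e -> e \notin t' -> e `<=` ~` cone (rcons w s).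
    have [t' t'M [h'|h']] := hM (rcons w s) e0 E0; last by exists t'.
    by case: no; exists (rcons w s), t'; rewrite size_rcons sw.
  pose t' s := sval (cid (nos s)); pose u := t ++ flatten [seq t' s | s : S].
  (* If each next cone misses all but finitely many members of the star, the members outside [u] are
     reduced to the single point [word_val N w]; being pairwise disjoint, at most one exists, and
     the star is finite. *)
  have single e : star e0 e -> e \notin u -> e `<=` [set word_val N w].
    move=> se; rewrite mem_cat negb_or => /andP[et eu] x ex.
    have [//|[s xs]] := cone_rcons (h e se et x ex).
    have := svalP (cid (nos s)) e se _ x ex; case=> //; apply: contra eu => es.
    by apply/flatten_mapP; exists s => //; rewrite mem_enum.
  have [[e1 [s1 n1]]|no1] := pselect (exists e, star e0 e /\ e \notin u).
    apply: (sub_finite_set _ (finite_seq (e1 :: u))) => e se /=; rewrite inE.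
    case: (boolP (e \in u)) => [_|eu]; first by rewrite orbT.
    rewrite orbF; apply/eqP; apply: contrapT => ne.
    have [x ex] := tree_neq0 tE (proj1 se); have [y ey] := tree_neq0 tE (proj1 s1).
    have := star_sub E0 se s1 ne ex; apply.
    by rewrite (single e se eu x ex) -(single e1 s1 n1 y ey).
  apply: (sub_finite_set _ (finite_seq u)) => e se /=.
  by apply: contrapT => /negP eu; apply: no1; exists e.
have [B BE sB] := infinite_set_fset M.+1 inf.
pose pt (e : set G) : G := xget 1 e.
have ptP e : star e0 e -> e (pt e).
  by move=> [Ee _]; have [x ex] := tree_neq0 tE Ee; apply: (@xgetPex _ 1 e); exists x.
pose n := (\max_(e <- B) size (nf N (pt e))).+1%N.
have [w [t [sw tM h]]] := path n.
have : (size (enum_fset B) <= size t)%N.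
  apply: uniq_leq_size (fset_uniq B) _ => e eB.
  apply: contrapT => /negP et; have se : star e0 e := BE e eB.
  have := h e se et _ (ptP e se); rewrite /cone /= => /size_prefix.
  rewrite sw /n ltnNge => /negP; apply.
  by apply: (@leq_bigmax_seq _ (enum_fset B) xpredT (fun e => size (nf N (pt e)))).
by move: sB tM; rewrite -/(size _); clear; lia.
Qed.

End Star.

(** * Finite subgroups and their orders *)

Section Subgroup.
Variables (G : groupType) (K : set G).
Hypothesis cK : group_closed [in K].

Lemma subgroup1 : K 1.
Proof. by case: cK => /set_mem. Qed.

Lemma subgroup_div x y : K x -> K y -> K (x / y).
Proof. by move=> /mem_set Kx /mem_set Ky; apply/set_mem/(proj2 cK). Qed.

Lemma subgroupV x : K x -> K x^-1.
Proof. by move=> Kx; rewrite -div1g; apply: subgroup_div Kx; exact: subgroup1. Qed.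

Lemma subgroupM x y : K x -> K y -> K (x * y).
Proof. by move=> Kx /subgroupV; rewrite -{2}(invgK y); exact: subgroup_div. Qed.

Lemma subgroupX x n : K x -> K (x ^+ n).
Proof.
move=> Kx; elim: n => [|n IH]; first by rewrite expg0; exact: subgroup1.
by rewrite expgS; exact: subgroupM.
Qed.

Lemma subgroup_finite_order x : finite_set K -> K x -> finite_order x.
Proof.
move=> fK Kx.
have : ~ injective (fun n => x ^+ n).
  move=> inj; apply: infinite_nat.
  apply: (sub_finite_set _ (finite_preimage (in2W inj) fK)) => n _.
  exact: subgroupX.
move=> /existsNP[n /existsNP[m /not_implyP[e nm]]].
wlog lt : n m e nm / (n < m)%N.
  move=> h; case: (ltngtP n m) => [lt|lt|//]; first exact: (h n m).
  exact: (h m n (esym e) (nesym nm)).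
exists (m - n)%N; split; first by rewrite subn_gt0.
by apply: (mulgI (x ^+ n)); rewrite -expgnDr subnKC ?(ltnW lt) // -e mulg1.
Qed.
End Subgroup.

Lemma subgroupP (G : groupType) (K : set G) : K 1 ->
  (forall x y, K x -> K y -> K (x / y)) -> group_closed [in K].
Proof.
move=> K1 KB; split; first exact/mem_set.
by move=> x y /set_mem Kx /set_mem Ky; apply/mem_set/KB.
Qed.

Lemma size_fibers (T U : eqType) (f : T -> U) M (t : seq U) (s : seq T) :
  (forall x, x \in s -> f x \in t) ->
  (forall y, (count (fun x => f x == y) s <= M)%N) -> (size s <= size t * M)%N.
Proof.
elim: t s => [|y t IH] s st cM.
  by case: s st {cM} => // x s /(_ x); rewrite inE eqxx => /(_ isT).
rewrite -(count_predC (fun x => f x == y) s) /= mulSn leq_add // -size_filter.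
apply: IH => [x|z].
  by rewrite mem_filter /= => /andP[nxy /st]; rewrite inE (negbTE nxy).
by rewrite count_filter; apply: leq_trans (cM z); apply: sub_count => x /andP[].
Qed.

Lemma set_minimal (T : Type) (P : set (set T)) e : P e ->
  finite_set [set f | P f /\ f `<=` e] ->
  exists f, [/\ P f, f `<=` e & forall g, P g -> g `<=` f -> g = f].
Proof.
have [n] := ubnP (card [set f | P f /\ f `<=` e]).
elim: n e => // n IH e cn Pe fin.
have [h|] := pselect (forall g, P g -> g `<=` e -> g = e); first by exists e; split.
move=> /existsNP[y /not_implyP[Py /not_implyP[ye nye]]].
have sub : [set f | P f /\ f `<=` y] `<=` [set f | P f /\ f `<=` e].
  by move=> f [Pf fy]; split=> //; exact: subset_trans ye.
have [|||x [Px xy xm]] := IH y => //.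
- apply: leq_trans (_ : card _ < card [set f | P f /\ f `<=` e])%N _ => //.
  apply: (card_ltn (x := e)) => //; first by split.
  by move=> [_ ey]; apply: nye; exact/seteqP.
- exact: sub_finite_set fin.
- by exists x; split=> //; exact: subset_trans ye.
Qed.

Record cofinite_tree (G : groupType) (E : set (set G)) : Prop := CofiniteTree {
  cofinite_tree_set : tree_set E;
  cofinite_star : forall e, E e -> finite_set (star E e);
  cofinite_stab : forall e, E e -> finite_set [set g | lset g e = e];
  cofinite_orbits : exists R : set (set G), [/\ finite_set R, R `<=` E &
    forall e, E e -> exists g, exists2 f, R f & e = lset g f] }.

Section FiniteSubgroups.
Variables (G : groupType) (E : set (set G)).
Hypothesis cE : cofinite_tree E.

Let tE := cofinite_tree_set cE.

Lemma orbit_bound (P : set G -> nat) : (forall g e, E e -> P (lset g e) = P e) ->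
  exists M, forall e, E e -> (P e <= M)%N.
Proof.
move=> Pg; have [R [/finite_seqP[s Rs] RE hR]] := cofinite_orbits cE.
exists (\max_(f <- s) P f)%N => e /hR[g [f Rf ->]].
rewrite Pg; last exact: RE.
by rewrite Rs /= in Rf; apply: (@leq_bigmax_seq _ s xpredT P).
Qed.

Lemma star_bound : exists M, forall e, E e -> (card (star E e) <= M)%N.
Proof.
apply: orbit_bound => g e Ee.
have -> : star E (lset g e) = lset g @` star E e.
  apply/seteqP; split=> [f /(star_lset tE g^-1)|_ [f sf <-]]; last exact: star_lset.
  by rewrite lsetK => sf; exists (lset g^-1 f) => //; exact: lsetVK.
by rewrite card_image_inj //; [exact: lset_inj|exact: cofinite_star].
Qed.

Lemma stab_bound : exists M, forall e, E e -> (card [set g | lset g e = e] <= M)%N.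
Proof.
apply: orbit_bound => g e Ee.
pose c x := g * x / g.
have ci : injective c by move=> x y /mulIg/mulgI.
have -> : [set h | lset h (lset g e) = lset g e] = c @` [set h | lset h e = e].
  apply/seteqP; split=> [h /= he|_ [h /= he <-]].
    exists (g^-1 * h * g); last by rewrite /c -!mulgA mulgV mulg1 mulVKg.
    by rewrite /= !lsetM he lsetK.
  by rewrite -lsetM /c mulgVK lsetM he.
by rewrite card_image_inj //; exact: (cofinite_stab cE).
Qed.

(* Among the half-spaces containing at least half of the elements of K, a
   minimal one has few translates under K. *)
Lemma finite_subgroup_bound : E !=set0 ->
  exists M, forall K : set G, finite_subgroup K -> (card K <= M)%N.
Proof.
move=> [e0 E0]; have [M1 hM1] := star_bound; have [M2 hM2] := stab_bound.
(* The [K]-orbit of the minimal half-space [e] lies among [e], its complement, one further [f1] and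
   the complements of a star; each fibre of the orbit map embeds in the stabiliser of [e]. *)
exists ((3 + M1) * M2)%N => K [cK fK].
have K1 := subgroup1 cK.
pose m (e : set G) := card (e `&` K).
have fI e : finite_set (e `&` K) by apply: sub_finite_set fK => x [].
have [s us Ks] := finite_uniq_seq fK.
have ms e : m e = (\sum_(x <- s) `[<(e `&` K) x>])%N.
  by apply: card_sum => //; rewrite -Ks; exact: subIsetr.
have mC e : (m e + m (~` e) = card K)%N.
  rewrite !ms (card_sum us) -?Ks // -big_split; apply: eq_bigr => x _ /=.
  by rewrite !asbool_and !asbool_neg; do 2!case: asbool.
have mS e f : e `<=` f -> (m e <= m f)%N.
  by move=> ef; apply: card_leq => // x [/ef].
have mU e f : e `<=` ~` f -> (m e + m f <= m (e `|` f))%N.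
  move=> ef; rewrite !ms -big_split leq_sum // => x _ /=.
  have : ~~ (`[<e x>] && `[<f x>]) by apply/negP => /andP[/asboolP ex /asboolP]; exact: ef.
  by rewrite !asbool_and asbool_or; do 3!case: asbool.
have mL k e : K k -> m (lset k e) = m e.
  move=> Kk; rewrite /m; have -> : lset k e `&` K = lset k (e `&` K).
    apply/seteqP; split=> x [ex Kx]; split=> //; first by apply: subgroupM => //; exact: subgroupV.
    by rewrite -(mulVKg k x); exact: subgroupM.
  have -> : lset k (e `&` K) = mul k @` (e `&` K).
    apply/seteqP; split=> [x h|_ [x h <-]]; last exact/lset_mul.
    by exists (k^-1 * x) => //; rewrite mulVKg.
  by rewrite card_image_inj //; exact: mulgI.
have K0 : (0 < card K)%N by apply: card_gt0 => //; exists 1.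
pose P := [set e | E e /\ (card K <= 2 * m e)%N].
have PC e : E e -> ~ P e -> P (~` e).
  move=> Ee nP; split; first exact: tree_setC.
  have : ~~ (card K <= 2 * m e)%N by apply/negP => h; apply: nP.
  by have := mC e; lia.
have [e1 P1] : exists e, P e.
  have [?|/(PC _ E0) ?] := pselect (P e0); first by exists e0.
  by exists (~` e0).
have [e [Pe _ me]] : exists f, [/\ P f, f `<=` e1 & forall g, P g -> g `<=` f -> g = f].
  apply: set_minimal => //; have [b nb] := tree_neq0 tE (tree_setC tE (proj1 P1)).
  apply: (@sub_finite_set _ _ (\bigcup_(k in K) [set f | E f /\ f k /\ ~ f b])).
    move=> f [[Ef Kf] fe]; have : (0 < m f)%N by lia.
    rewrite /m /card cardfs_gt0 => /fset0Pn[k]; rewrite in_fset_set // => /set_mem[fk Kk].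
    by exists k => //; split=> //; split=> // /fe.
  by apply: bigcup_finite => // k _; exact: tree_finite.
have Ee := proj1 Pe.
have PL k f : K k -> P f -> P (lset k f).
  by move=> Kk [Ef Kf]; split; [exact: tree_lset|rewrite mL].
have mL' k f : K k -> P f -> f `<=` lset k e -> f = lset k e.
  move=> Kk Pf fk; rewrite -(me (lset k^-1 f)) ?lsetVK //.
    by apply: PL => //; exact: subgroupV.
  by rewrite -(lsetK k e); apply/lset_sub.
(* a translate disjoint from e contains exactly the other half of K *)
have orb : exists f1, forall k, K k -> [\/ lset k e = e, lset k e = ~` e,
    lset k e = f1 | star E (~` e) (~` lset k e)].
  have base k : K k -> [\/ lset k e = e, lset k e = ~` e,
      lset k e `<=` ~` e | star E (~` e) (~` lset k e)].
    move=> Kk; have Ek := tree_lset tE k Ee; have Pk := PL _ _ Kk Pe.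
    have [h|h|h|h] := tree_nest tE Ek Ee.
    - by apply: Or41; exact: me.
    - exact: Or43.
    - have [->|nk] := pselect (lset k e = ~` e); first exact: Or42.
      apply: Or44; split; first exact: tree_setC.
      right; rewrite setCK; split; [exact: subsetCl|exact: nesym|].
      (* Either [x] or its complement has at least half of [K], and both [e] and its translate are
         minimal with that property. *)
      move=> x Ex ex xk; have [Px|/(PC _ Ex) nPx] := pselect (P x).
        by right; exact: mL'.
      by left; rewrite -(me (~` x)) ?setCK //; exact: subsetCl.
    - apply: Or41; apply/esym; apply: mL' => //.
      exact: subsetCC.
  have [[k1 [Kk1 d1]]|no] := pselect (exists k, K k /\ lset k e `<=` ~` e); last first.
    exists e => k Kk; have [h|h|h|h] := base k Kk; [exact: Or41|exact: Or42| |exact: Or44].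
    by case: no; exists k.
  exists (lset k1 e) => k Kk; have [h|h|h|h] := base k Kk; [exact: Or41|exact: Or42| |exact: Or44].
  apply: Or43.
  have Ek := tree_lset tE k Ee; have Ek1 := tree_lset tE k1 Ee.
  have [h'|h'|h'|h'] := tree_nest tE Ek Ek1.
  - by apply: mL' => //; exact: PL.
  (* [e] and the two translates would be pairwise disjoint, each with at least half of the nonempty
     [K]. *)
  - have := mU _ _ h'; have := mS (lset k e `|` lset k1 e) (~` e).
    rewrite !mL // => le1; have {}le1 := le1 (fun x => or_ind (h x) (d1 x)).
    by have := mC e; have := proj2 Pe; lia.
  - have [x ex] := tree_neq0 tE Ee; case: (d1 x) => //; apply: h' => kx.
    exact: h kx ex.
  - apply/esym; apply: mL' => //; first exact: PL.
    exact: subsetCC.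
have [f1 hf1] := orb.
pose t := [:: e, ~` e, f1 & map setC (fset_set (star E (~` e)))].
have fst' := cofinite_star cE (tree_setC tE Ee).
have st : (size t <= 3 + M1)%N.
  rewrite /= size_map; exact: (leq_add (leqnn 3) (hM1 _ (tree_setC tE Ee))).
apply: leq_trans (leq_mul st (leqnn M2)).
have -> : card K = size s by rewrite (card_count us) -?Ks // Ks (eq_in_count (a2 := xpredT)) ?count_predT // => x /= ->; apply/asboolP.
apply: (@size_fibers _ _ (fun k => lset k e)) => [k ks|f].
  have Kk : K k by rewrite Ks.
  rewrite !inE; have [->|->|->|h] := hf1 k Kk; rewrite ?eqxx ?orbT //.
  by rewrite -(setCK (lset k e)) map_f ?orbT // in_fset_set //; exact/mem_set.
have [/hasP[k0 ks /eqP k0f]|/hasPn nof] := boolP (has (fun k => lset k e == f) s); last first.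
  by rewrite (eq_in_count (a2 := xpred0)) ?count_pred0 // => k ks; exact/negbTE/nof.
rewrite -size_filter -(size_map (mul k0^-1)).
apply: leq_trans (card_seq _ (cofinite_stab cE Ee) _) (hM2 e Ee).
  by rewrite map_inj_uniq ?filter_uniq //; exact: mulgI.
move=> x /mapP[k + ->]; rewrite mem_filter => /andP[/eqP kf _].
by rewrite /= lsetM kf -k0f lsetK.
Qed.

End FiniteSubgroups.

(** * Edges with nontrivial stabilisers *)

Section Torsion.
Variable G : groupType.

Lemma lset_sub_pow g (x : set G) n : lset g x `<=` x -> lset (g ^+ n) x `<=` x.
Proof.
move=> h; elim: n => [|n IH]; first by rewrite expg0 lset1.
by rewrite expgS lsetM; apply: subset_trans h; apply/lset_sub.
Qed.

(** The powers of [g] give a decreasing chain that returns to [x]. *)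
Lemma torsion_sub g (x : set G) : finite_order g -> lset g x `<=` x -> lset g x = x.
Proof.
move=> [[|n] [// _ gn]] h; apply/seteqP; split=> //.
rewrite -{1}(lset1 x) -gn expgS lsetM; apply/lset_sub; exact: lset_sub_pow.
Qed.

Lemma torsion_sup g (x : set G) : finite_order g -> x `<=` lset g x -> lset g x = x.
Proof.
move=> [n [n0 gn]] h; have ge : lset g^-1 x = x.
  apply: torsion_sub; first by exists n; rewrite expVgn gn invg1.
  by rewrite -[X in _ `<=` X](lsetK g); apply/lset_sub.
by rewrite -[X in lset g X]ge lsetVK.
Qed.

Variable E : set (set G).
Hypothesis cE : cofinite_tree E.
Let tE := cofinite_tree_set cE.

Definition fixes (a : G) : set (set G) := [set f | E f /\ lset a f = f].

(* A version of Serre's lemma: elements of finite order fixing edges, but no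
   common or adjacent ones, have a hyperbolic product. *)
Lemma product_infinite_order a b e f : finite_order a -> finite_order b ->
  fixes a e -> fixes b f ->
  (forall y m, fixes a y -> E m -> adjacent E y m -> ~ fixes b m) ->
  ~ finite_order (a * b).
Proof.
move=> fa fb; move: e f.
have fixC c x : fixes c x -> fixes c (~` x).
  by move=> [Ex cx]; split; [exact: (tree_setC tE)|rewrite lsetC cx].
suff main e f : fixes a e -> fixes b f -> e `<=` f ->
    (forall y m, fixes a y -> E m -> adjacent E y m -> ~ fixes b m) ->
    ~ finite_order (a * b).
  move=> e f ae bf; have [h|h|h|h] := tree_nest tE (proj1 ae) (proj1 bf).
  - exact: main h. - by apply: main h; [|exact: fixC].
  - by apply: main h; [exact: fixC|]. - by apply: main h; exact: fixC.
move=> ae bf ef sep fab.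
have [Ee aE] := ae; have [Ef bF] := bf.
(* The complement of a minimal such [z] is the last edge fixed by [a] on the way from [e] to [f]. *)
pose P z := [/\ E z, lset a z = z, e `<=` ~` z & ~` z `<=` f].
have [q nfq] := tree_neq0 tE (tree_setC tE Ef).
have [z [[Ez az ez zf] _ zm]] : exists z, [/\ P z, z `<=` ~` e &
    forall w, P w -> w `<=` z -> w = z].
  apply: set_minimal; first by have [? ?] := fixC _ _ ae; split; rewrite ?setCK.
  apply: (@sub_finite_set _ _ (setC @` [set x | E x /\ e `<=` x /\ ~ x q])).
    move=> w [[Ew aw ew wf] _]; exists (~` w); rewrite ?setCK //.
    by split; [exact: (tree_setC tE)|split=> // /wf].
  by apply: finite_image; exact: finite_above.
have Ey := tree_setC tE Ez; have ay : lset a (~` z) = ~` z by rewrite lsetC az.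
have nyf : ~` z <> f.
  by move=> yf; apply: (sep f f) => //; [rewrite -yf|left].
have [m [Em my ym mf am]] := next_above tE Ey Ef zf nyf.
have nbm : lset b m <> m.
  by move=> bm; apply: (sep (~` z) (~` m)) => //; [exact: (tree_setC tE)|exact: fixC].
have nam : lset a m <> m.
  move=> ame; apply: my; rewrite -[LHS]setCK; congr setC; apply: zm.
    split; rewrite ?setCK //; [exact: (tree_setC tE)|by rewrite lsetC ame|exact: subset_trans ym].
  exact: subsetCl.
have yam : ~` z `<=` lset a m by rewrite -ay; apply/lset_sub.
have h1 : lset a (~` m) `<=` m.
  have [h|h|h|h] := tree_nest tE (tree_lset tE a Em) Em.
  - by case: nam; exact: torsion_sub.
  - by case: (tree_disjoint tE Ey Em ym); exact: subset_trans h.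
  - by [].
  - by case: nam; apply: torsion_sup => //; exact: subsetCC.
have h2 : lset b m `<=` ~` m.
  have [h|h|h|h] := tree_nest tE (tree_lset tE b Em) Em.
  - by case: nbm; exact: torsion_sub.
  - by [].
  - case: (tree_cover tE Em Ef mf); apply: subset_trans (subsetCl h) _.
    by rewrite -bF; apply/lset_sub.
  - by case: nbm; apply: torsion_sup => //; exact: subsetCC.
(* Ping-pong: [b] maps [m] into its complement and [a] maps that back into [m]. Torsion of [a * b]
   forces equality, so [m] misses [lset a m], although both contain the complement of [z]. *)
have h3 : lset (a * b) m `<=` lset a (~` m) by rewrite lsetM; apply/lset_sub.
have e3 := torsion_sub fab (subset_trans h3 h1).
have h4 : m `<=` lset a (~` m) by rewrite -{1}e3.
by case: (tree_disjoint tE Ey (tree_lset tE a Em) yam); exact: subset_trans ym h4.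
Qed.

Lemma finite_transporter e f : E e -> finite_set [set g | lset g e = f].
Proof.
move=> Ee; have [[g0 g0e]|no] := pselect (exists g, lset g e = f); last first.
  by apply: (@sub_finite_set _ _ set0) => // g h; case: no; exists g.
apply: (sub_finite_set _ (finite_image (mul g0) (cofinite_stab cE Ee))) => g /= ge.
by exists (g0^-1 * g); rewrite /= ?mulVKg // lsetM ge -g0e lsetK.
Qed.

Lemma stab_subgroup e : E e -> finite_subgroup [set g | lset g e = e].
Proof.
move=> Ee; split; last exact: (cofinite_stab cE).
apply: subgroupP => [|x y xe ye]; rewrite /= ?lset1 // lsetM.
by rewrite -{1}ye lsetK.
Qed.

(** This is the stabiliser of the origin of [e]; it is finite because the star and the edge
    stabilisers are. *)
Lemma star_subgroup e : E e -> finite_subgroup [set g | adjacent E e (lset g e)].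
Proof.
move=> Ee; split.
  apply: subgroupP => [|x y xe ye]; first by rewrite /= lset1; left.
  rewrite /= lsetM; apply: (adjacent_trans tE Ee (tree_lset tE x Ee)) => //.
    by do 2!apply: (tree_lset tE).
  apply: adjacent_lset => //; rewrite -{1}(lsetK y e).
  by apply: adjacent_lset => //; exact: adjacent_sym.
apply: (@sub_finite_set _ _ (\bigcup_(f in star E e) [set g | lset g e = f])).
  by move=> g ge; exists (lset g e) => //; split=> //; exact: (tree_lset tE).
by apply: bigcup_finite => [|f _]; [exact: (cofinite_star cE)|exact: finite_transporter].
Qed.

Hypothesis finC : forall a : G, a <> 1 -> finite_order a -> finite_set [set g | a * g = g * a].
(** On nontrivial torsion elements, [R] is membership in a common maximal finite subgroup under
    condition (2), and torsion of the product under condition (3). *)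
Variable R : G -> G -> Prop.
Hypotheses (Rsym : forall a b, R a b -> R b a)
  (Rtrans : forall a b c, R a b -> R b c -> R a c)
  (Rsub : forall K a b, finite_subgroup K -> K a -> K b -> a <> 1 -> b <> 1 -> R a b)
  (Rprod : forall a b, R a b -> finite_order (a * b)).

(** An edge [lset g r] is fixed by [a] when [g] conjugates [a] to an element [b] of the finite
    stabiliser of [r]; for given [b], such [g] form a coset of the finite centraliser of [a]. *)
Lemma finite_fixes a : a <> 1 -> finite_order a -> finite_set (fixes a).
Proof.
move=> a1 fa; have [Q [fQ QE hQ]] := cofinite_orbits cE.
apply: (@sub_finite_set _ _ (\bigcup_(r in Q) \bigcup_(b in [set b | lset b r = r])
   ((fun g => lset g r) @` [set g | a * g = g * b]))).
  move=> f [Ef af]; have [g [r Qr fr]] := hQ f Ef; exists r => //.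
  exists (g^-1 * a * g); first by rewrite /= !lsetM -fr af fr lsetK.
  by exists g => //=; rewrite -!mulgA mulVKg.
apply: bigcup_finite => // r Qr; apply: bigcup_finite; first exact: (cofinite_stab cE (QE _ Qr)).
move=> b _; apply: finite_image.
have [[g0 g0e]|no] := pselect (exists g, a * g = g * b); last first.
  by apply: (@sub_finite_set _ _ set0) => // g h; case: no; exists g.
apply: (sub_finite_set _ (finite_image (fun g => g * g0) (finC a1 fa))) => g /= ge.
exists (g / g0); last by rewrite mulgVK.
rewrite /= mulgA ge -!mulgA; congr mul; apply: (mulIg g0).
by rewrite mulgVK -mulgA g0e mulKg.
Qed.

Definition nontrivial_stab (e : set G) := exists2 a, a <> 1 & lset a e = e.

Definition class_edges a : set (set G) :=
  [set f | E f /\ exists b, [/\ b <> 1, lset b f = f & R b a]].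

(** Otherwise infinitely many edges of the class are translates [lset h e] of one of them. With [b0]
    fixing [e], the conjugate of [b0] by [h] fixes [lset h e], so it is related to [b0] and their
    product is torsion; for remote [h] this contradicts [product_infinite_order]. *)
Lemma finite_class_edges a : finite_set (class_edges a).
Proof.
apply: contrapT => inf; have [Q [fQ QE hQ]] := cofinite_orbits cE.
have [r [Qr infr]] : exists r, Q r /\ ~ finite_set [set g | class_edges a (lset g r)].
  apply: contrapT => no; apply: inf.
  apply: (@sub_finite_set _ _ (\bigcup_(r in Q)
     ((fun g => lset g r) @` [set g | class_edges a (lset g r)]))).
    by move=> f cf; have [g [r Qr fr]] := hQ f (proj1 cf); exists r => //; exists g; rewrite /= -?fr.
  apply: bigcup_finite => // r Qr; apply: finite_image.
  by apply: contrapT => h; apply: no; exists r.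
have [g0 cg0] : exists g, class_edges a (lset g r).
  by apply: contrapT => no; apply: infr; apply: (@sub_finite_set _ _ set0) => // g h; case: no; exists g.
pose e := lset g0 r; have [Ee [b0 [b01 b0e Rb0]]] := cg0.
have fb0 : finite_order b0.
  by have [cS fS] := stab_subgroup Ee; exact: (subgroup_finite_order cS fS).
have fF := finite_fixes b01 fb0.
pose W := \bigcup_(y in fixes b0) star E y.
have fW : finite_set W by apply: bigcup_finite => // y [Ey _]; exact: (cofinite_star cE).
(* For [h] outside [bad], no edge fixed by [h * b0 / h] is adjacent to an edge fixed by [b0]. *)
pose bad := \bigcup_(y in fixes b0) \bigcup_(w in W) [set h | lset h y = w].
have fbad : finite_set bad.
  by apply: bigcup_finite => // y [Ey _]; apply: bigcup_finite => // w _; exact: finite_transporter.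
have [h [ch nbad]] : exists h, class_edges a (lset h e) /\ ~ bad h.
  apply: contrapT => no; apply: infr.
  apply: (sub_finite_set _ (finite_image (fun h => h * g0) fbad)) => g cg.
  exists (g / g0); last by rewrite mulgVK.
  apply: contrapT => nb; apply: no; exists (g / g0); split=> //.
  by rewrite /e -lsetM mulgVK.
pose b := h * b0 / h.
have bh : lset b (lset h e) = lset h e by rewrite -lsetM /b mulgVK lsetM b0e.
have b1 : b <> 1.
  by move=> e1; apply: b01; apply: (mulgI h); apply: (mulIg h^-1); rewrite mulg1 mulgV.
have [Ehe [b' [b'1 b'e Rb']]] := ch.
have Sb := stab_subgroup Ehe.
have fb : finite_order b by have [cS fS] := Sb; exact: (subgroup_finite_order cS fS).
have Rbb : R b0 b.
  apply: (Rtrans Rb0); apply: Rsym; apply: (Rtrans _ Rb').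
  exact: (Rsub Sb).
apply: (product_infinite_order fb0 fb (e := e) (f := lset h e)) (Rprod Rbb) => //.
move=> y m y0 Em ym [_ bm]; apply: nbad.
exists (lset h^-1 m).
  split; first exact: (tree_lset tE).
  by rewrite -{2}bm -!lsetM; congr (lset _ m); rewrite /b !mulgA mulVg mul1g.
by exists m; [exists y|rewrite /= lsetVK].
Qed.

Lemma adjacent_related e f a b : E e -> E f -> adjacent E e f -> a <> 1 -> b <> 1 ->
  lset a e = e -> lset b f = f -> R a b.
Proof.
move=> Ee Ef ef a1 b1 ae bf; apply: (Rsub (star_subgroup Ee)) => //=.
  by rewrite ae; left.
apply: (adjacent_trans tE Ee Ef) => //; first exact: (tree_lset tE).
by rewrite -{1}bf; apply: adjacent_lset => //; exact: adjacent_sym.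
Qed.

(** Consecutive edges of the path share a vertex, whose finite stabiliser contains both edge
    stabilisers, so [R] propagates by transitivity. *)
Lemma chain_related u v a b : E u -> E v -> u `<=` v ->
  (forall w, E w -> u `<=` w -> w `<=` v -> nontrivial_stab w) ->
  a <> 1 -> b <> 1 -> lset a u = u -> lset b v = v -> R a b.
Proof.
move=> Eu Ev; have [n] := ubnP (card [set x | E x /\ u `<=` x /\ x `<=` v]).
elim: n u v a b Eu Ev => // n IH u v a b Eu Ev cn uv nt a1 b1 au bv.
have [uve|nuv] := pselect (u = v).
  by apply: (adjacent_related Eu Ev) => //; left.
have [x [Ex xu ux xv ax]] := next_above tE Eu Ev uv nuv.
have [c c1 cx] := nt x Ex ux xv.
apply: (@Rtrans _ c).
  apply: (adjacent_related Eu (tree_setC tE Ex)) => //; by rewrite lsetC cx.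
apply: (IH x v) => // [|w Ew xw]; last by apply: nt => //; exact: subset_trans xw.
apply: leq_trans (_ : card _ < card [set x | E x /\ u `<=` x /\ x `<=` v])%N _ => //.
have [q nvq] := tree_neq0 tE (tree_setC tE Ev).
apply: (card_ltn (x := u)) => [|w [Ew [xw wv]]||[_ [xu' _]]].
- by apply: (sub_finite_set _ (finite_above tE q Eu)) => w [Ew [uw wv]]; split=> //; split=> // /wv.
- by split=> //; split=> //; exact: subset_trans xw.
- by split=> //; split.
- by apply: xu; exact/seteqP.
Qed.

Definition free_edges : set (set G) := [set e | E e /\ forall g, lset g e = e -> g = 1].

Lemma not_free e : E e -> ~ free_edges e -> nontrivial_stab e.
Proof.
move=> Ee nf; apply: contrapT => nn; apply: nf; split=> // g ge.
by apply: contrapT => g1; apply: nn; exists g.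
Qed.

Lemma tree_set_free : tree_set free_edges.
Proof.
split=> [e [Ee fe]|g e [Ee fe]|e [Ee _]|e f [Ee _] [Ef _]|x y].
- split; first exact: (tree_setC tE).
  by move=> g; rewrite lsetC => /(congr1 setC); rewrite !setCK => /fe.
- split; first exact: (tree_lset tE).
  move=> h; rewrite -lsetM => he; have : lset (g^-1 * (h * g)) e = e by rewrite lsetM he lsetK.
  by move/fe/(canRL (mulVKg _)); rewrite mulg1 => /(canRL (mulgK _)); rewrite mulgV.
- exact: (tree_neq0 tE Ee).
- exact: (tree_nested tE).
- by apply: (sub_finite_set _ (tree_finite tE x y)) => e [[Ee _] h].
Qed.

(** Only the stars need care. If [x] and [e] become adjacent by contraction, the edges of [E]
    strictly between them have nontrivial stabilisers, all in one class. The first of these is next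
    to [x], which leaves finitely many choices for it and for an element [b] fixing it; the last
    lies in the finite [class_edges b], and [e] is next to it. *)
Lemma cofinite_free : cofinite_tree free_edges.
Proof.
split; first exact: tree_set_free.
- move=> x fx; have [Ex _] := fx.
  apply: (@sub_finite_set _ _ (star E x `|` \bigcup_(z in star E x)
     \bigcup_(b in [set b | lset b z = z]) \bigcup_(y in class_edges b) star E y)).
    move=> e [fe [xe|[xe nxe hx]]]; have [Ee _] := fe.
      by left; split=> //; left.
    have Ene := tree_setC tE Ee.
    have [y1 [E1 y1x xy1 y1e a1]] := next_above tE Ex Ene xe nxe.
    have [y1e'|ny1e] := pselect (y1 = ~` e).
      by left; split=> //; rewrite -(setCK e) -y1e'.
    have nf y : E y -> x `<=` y -> y `<=` ~` e -> y <> x -> y <> ~` e -> nontrivial_stab y.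
      by move=> Ey xy ye n1 n2; apply: not_free => // fy; case: (hx y fy xy ye).
    have nex : e <> ~` x by move=> h; apply: nxe; rewrite h setCK.
    have [y2 [E2 y2e ey2 y2x a2]] := next_above tE Ee (tree_setC tE Ex) (subsetCr xe) nex.
    have Ey := tree_setC tE E2.
    have [yx|nyx] := pselect (~` y2 = x).
      by left; split=> //; rewrite yx in a2; exact: adjacent_sym.
    have xy : x `<=` ~` y2 by exact: subsetCr.
    have ye : ~` y2 `<=` ~` e by exact: subsetC.
    have nye : ~` y2 <> ~` e by move=> /(congr1 setC); rewrite !setCK.
    have [b b1 bn] := nf _ E1 xy1 y1e y1x ny1e.
    have [c c1 cn] := nf _ Ey xy ye nyx nye.
    have nt w u v : u `<=` w -> w `<=` v -> E w -> x `<=` u -> u <> x -> v `<=` ~` e ->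
        v <> ~` e -> nontrivial_stab w.
      move=> uw wv Ew xu ux ve nve; apply: nf => //.
      - exact: subset_trans uw. - exact: subset_trans ve.
      - by move=> wx; apply: ux; apply/seteqP; split=> //; rewrite -wx.
      - by move=> we; apply: nve; apply/seteqP; split=> //; rewrite -we.
    have Rcb : R c b.
      have [h|h|h|h] := tree_nest tE E1 Ey.
      - by apply: Rsym; apply: (chain_related E1 Ey h) => // w Ew ? ?; apply: (nt w y1 (~` y2)).
      - by case: (tree_disjoint tE Ex Ey xy); exact: subset_trans h.
      - by case: (tree_disjoint tE Ee E2 ey2); exact: subset_trans (subsetCr y1e) h.
      - apply: (chain_related Ey E1 (subsetCC h)) => // w Ew ? ?; exact: (nt w (~` y2) y1).
    right; exists (~` y1); first by split=> //; exact: (tree_setC tE).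
    exists b; first by rewrite /= lsetC bn.
    exists (~` y2); first by split=> //; exists c.
    by split=> //; exact: adjacent_sym.
  rewrite finite_setU; split; first exact: (cofinite_star cE).
  apply: bigcup_finite => [|z [Ez _]]; first exact: (cofinite_star cE).
  apply: bigcup_finite => [|b _]; first exact: (cofinite_stab cE).
  apply: bigcup_finite => [|y [Ey _]]; [exact: finite_class_edges|exact: (cofinite_star cE)].
- by move=> e [_ fe]; apply: (sub_finite_set _ (finite_set1 1)) => g /fe.
- have [Q [fQ QE hQ]] := cofinite_orbits cE.
  exists (Q `&` free_edges); split; [by apply: sub_finite_set fQ => x []|exact: subIsetr|].
  move=> e fe; have [g [r Qr er]] := hQ e (proj1 fe); exists g, r => //; split=> //.
  by rewrite -(lsetK g r) -er; exact: (tree_lset tree_set_free).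
Qed.

Hypothesis Esep : forall x y, x <> y -> exists e, [/\ E e, e x & ~ e y].

(** As [E] separates points, no nontrivial element fixes the vertex determined by 1, so the edges
    leaving this vertex have trivial stabilisers. *)
Lemma free_edges_neq0 : free_edges !=set0 \/ forall g : G, g = 1.
Proof.
have [triv|/existsNP[g0 g01]] := pselect (forall g : G, g = 1); [by right|left].
have [e0 [E0 _ ne0]] := Esep g01.
have [e [Ee _ ne em]] := maximal_outside tE E0 ne0.
exists e; split=> // a ae; apply: contrapT => a1.
have na : a^-1 <> 1 by move=> h; apply: a1; rewrite -(invgK a) h invg1.
have [h [Eh ha nh]] := Esep na.
have [f [Ef hf nf fm]] := maximal_outside tE Eh nh.
have ef : adjacent E e f.
  have [->|nef] := pselect (e = f); first by left.
  have [h1|h1|h1] := tree_nest_out tE Ee Ef ne nf.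
  - by case: nef; apply/esym/em.
  - by case: nef; apply: fm.
  right; split=> // [h2|x Ex ex xf]; first by apply: ne; rewrite h2.
  have [x1|nx1] := pselect (x 1); last by left; exact: em.
  by right; rewrite -(fm (~` x)) ?setCK //; [exact: (tree_setC tE)|exact: subsetCr].
have aef : adjacent E e (lset a f) by rewrite -{1}ae; exact: adjacent_lset.
have af1 : lset a f 1 by rewrite /lset /= mulg1; exact: hf.
case: aef => [eaf|[h1 h2 h3]]; first by apply: ne; rewrite eaf.
apply: h2; apply/esym; apply: em => //; apply: (tree_setC tE); exact: (tree_lset tE).
Qed.

End Torsion.

(** * Potentials on a tree and graphs of groups *)

(** Recursion with [rank] as fuel, since [pr] is known to decrease it only on [D]. *)
Lemma ranked_recursion (T U : Type) (D : T -> Prop) (root : T -> bool)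
    (rank : T -> nat) (pr : T -> T) (base : T -> U) (next : T -> U -> U) :
  (forall x, D x -> ~~ root x -> D (pr x) /\ (rank (pr x) < rank x)%N) ->
  exists u : T -> U, forall x, D x -> u x = if root x then base x else next x (u (pr x)).
Proof.
move=> h; pose fix th (n : nat) (x : T) {struct n} : U := if n is n'.+1 then
  if root x then base x else next x (th n' (pr x)) else base x.
have thE n m x : D x -> (rank x <= n)%N -> (rank x <= m)%N -> th n.+1 x = th m.+1 x.
  elim: n m x => [|n IH] m x Dx rn rm /=; case: ifP => // /negbT nr.
    by have [_] := h x Dx nr; lia.
  have [Dp lt] := h x Dx nr; case: m rm => [|m] rm; first by lia.
  by congr next; apply: IH => //; lia.
exists (fun x => th (rank x).+1 x) => x Dx.
rewrite [LHS]/=; case: ifP => // /negbT nr; have [Dp lt] := h x Dx nr.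
by case: (rank x) lt => // n lt; congr next; apply: thE.
Qed.

Section Potential.
Variables (G : groupType) (E : set (set G)).
Hypothesis tE : tree_set E.

Let EC := tree_setC tE.

(** In the tree rooted at the vertex of 1, half-spaces avoiding 1 point away from the root, and [f]
    is the parent edge of [x]. *)
Definition above x f := [/\ E f, ~ f 1, x <> f, x `<=` f & adjacent E x (~` f)].

Lemma above_uniq x f f' : E x -> above x f -> above x f' -> f = f'.
Proof.
move=> Ex [Ef f1 xf sf af] [Ef' f'1 xf' sf' af'].
have key k k' : above x k -> above x k' -> k `<=` k' -> k = k'.
  move=> [Ek k1 xk sk ak] [Ek' k'1 xk' sk' [e|[_ _ h]]] kk'.
    by case: (tree_disjoint tE Ex Ek' sk'); rewrite e.
  by have := h k Ek sk; rewrite setCK => /(_ kk')[e|//]; case: xk.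
have [h|h|h] := tree_nest_out tE Ef Ef' f1 f'1.
- exact: key h. - by apply/esym; apply: key h.
- by case: (tree_disjoint tE Ex Ef' sf'); exact: subset_trans h.
Qed.

Lemma maximal_adjacent x y : E x -> E y -> ~ x 1 -> ~ y 1 ->
  (forall f, ~ above x f) -> (forall f, ~ above y f) -> adjacent E x y.
Proof.
move=> Ex Ey x1 y1 nx ny.
have key k k' : E k -> E k' -> ~ k' 1 -> (forall f, ~ above k f) -> k `<=` k' -> k = k'.
  move=> Ek Ek' k'1 nk kk'; apply: contrapT => ne.
  have [z [Ez zk kz zk' az]] := next_above tE Ek Ek' kk' ne.
  by case: (nk z); split=> // [/zk'//|/esym].
have [h|h|h] := tree_nest_out tE Ex Ey x1 y1.
- by left; exact: key h. - by left; apply/esym; exact: key h.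
right; split=> // [e|z Ez xz zy]; first by apply: x1; rewrite e.
have [z1|nz1] := pselect (z 1); last by left; apply/esym; exact: key xz.
right; rewrite -(setCK z); congr setC; apply/esym; apply: (key y (~` z)) => //; [exact: EC|exact: subsetCr].
Qed.

Let outside x : nat := card [set f | E f /\ x `<=` f /\ ~ f 1].
(** An edge pointing away from the root comes right before its reversal. The predecessor of a
    reversed edge is the edge itself; that of an outgoing edge is its reversed parent, which has the
    same origin. *)
Let rank x : nat := if `[<x 1>] then (2 * outside (~` x)).+1 else (2 * outside x)%N.
Let root x : bool := `[<~ x 1 /\ forall f, ~ above x f>].
Let up x := xget set0 [set f | above x f].
Let pr x := if `[<x 1>] then ~` x else ~` up x.

Let pr_in x : x 1 -> pr x = ~` x.
Proof. by move=> /asboolP x1; rewrite /pr x1. Qed.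

Let pr_above x f : E x -> ~ x 1 -> above x f -> pr x = ~` f.
Proof.
move=> Ex /asboolPn/negbTE x1 xf; rewrite /pr x1; congr setC; apply: (above_uniq Ex) => //.
by apply: (@xgetPex _ set0 [set f | above x f]); exists f.
Qed.

Let not_root x : ~ x 1 -> ~~ root x -> exists f, above x f.
Proof.
by move=> x1 /asboolPn nr; apply: contrapT => no; apply: nr; split=> // f xf; apply: no; exists f.
Qed.

Let above_not_root x f : above x f -> ~~ root x.
Proof. by move=> xf; apply/asboolPn => -[_ /(_ f)]. Qed.

Let in_not_root x : x 1 -> ~~ root x.
Proof. by move=> x1; apply/asboolPn => -[]. Qed.

Let pr_rank x : E x -> ~~ root x -> E (pr x) /\ (rank (pr x) < rank x)%N.
Proof.
move=> Ex nr; have [x1|x1] := pselect (x 1).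
  rewrite pr_in //; split; first exact: EC.
  have nx1 : `[<(~` x) 1>] = false by apply/asboolPn; apply.
  by rewrite /rank nx1; move/asboolP: x1 => ->.
have [f xf] := not_root x1 nr; rewrite (pr_above Ex x1 xf).
have [Ef f1 nxf sxf _] := xf; split; first exact: EC.
have nf1 : `[<(~` f) 1>] by apply/asboolP.
have x1' : `[<x 1>] = false by apply/asboolPn.
rewrite /rank nf1 x1' setCK.
have : (outside f < outside x)%N; last by lia.
apply: (card_ltn (x := x)) => [|z [Ez [fz z1]]||[_ [fx _]]].
- exact: finite_above.
- by split=> //; split=> //; exact: subset_trans fz.
- by split=> //; split.
- by apply: nxf; exact/seteqP.
Qed.

(** Both closure conditions are reversible, so it is enough to look at a root: if [Y] fails there,
    its complement spreads over the whole tree and reaches [x0]. *)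
Lemma tree_connected (Y : set (set G)) :
  (forall x y, E x -> E y -> adjacent E x y -> Y x -> Y y) ->
  (forall x, E x -> Y x -> Y (~` x)) ->
  (exists2 x, E x & Y x) -> forall x, E x -> Y x.
Proof.
move=> Ya Yc [x0 E0 Y0] x Ex.
have key (Z : set (set G)) x1 : (forall x y, E x -> E y -> adjacent E x y -> Z x -> Z y) ->
    (forall x, E x -> Z x -> Z (~` x)) -> E x1 -> root x1 -> Z x1 -> forall x, E x -> Z x.
  move=> Za Zc E1 /asboolP[x11 no1] Z1 y; have [n] := ubnP (rank y).
  elim: n y => // n IH y rn Ey; have [/asboolP[y1 ny]|nr] := boolP (root y).
    by apply: Za Z1 => //; exact: maximal_adjacent.
  have [Ep rp] := pr_rank Ey nr; have Zp : Z (pr y) by apply: IH => //; lia.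
  have [y1|y1] := pselect (y 1).
    by rewrite pr_in // in Ep Zp; rewrite -(setCK y); exact: Zc.
  have [f yf] := not_root y1 nr; rewrite (pr_above Ey y1 yf) in Ep Zp.
  by apply: Za Zp => //; apply: adjacent_sym => //; case: yf.
have [r [Er rr]] : exists r, E r /\ root r.
  have [e [Ee e1]] : exists e, E e /\ ~ e 1.
    have [x1|?] := pselect (x0 1); last by exists x0.
    by exists (~` x0); split; [exact: EC|apply].
  have [r [Er _ r1 rm]] := maximal_outside tE Ee e1.
  exists r; split=> //; apply/asboolP; split=> // f [Ef f1 nrf rf _].
  by apply: nrf; apply/esym; exact: rm.
have [Yr|nYr] := pselect (Y r); first exact: (key Y r).
suff : (~` Y) x0 by [].
apply: (key (~` Y) r) => //.
- by move=> u v Eu Ev uv nYu Yv; apply: nYu; apply: Ya Yv => //; exact: adjacent_sym.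
- by move=> u Eu nYu Yv; apply: nYu; rewrite -(setCK u); apply: Yc => //; exact: EC.
Qed.

Variables (P : groupType) (c1 c2 : set G -> set G -> P).
Hypothesis c1M : forall x y z, E x -> E y -> E z ->
  adjacent E x y -> adjacent E y z -> c1 x y * c1 y z = c1 x z.
Hypothesis c2V : forall x, E x -> c2 x (~` x) * c2 (~` x) x = 1.

(** Simple connectivity of the tree: [u] is built outwards from the root, and the cocycle identities
    settle the pairs that the recursion does not follow. *)
Lemma tree_potential : exists u : set G -> P,
  (forall x y, E x -> E y -> adjacent E x y -> u y = u x * c1 x y) /\
  (forall x, E x -> u (~` x) = u x * c2 x (~` x)).
Proof.
have c1x x : E x -> c1 x x = 1.
  move=> Ex; apply: (mulgI (c1 x x)); rewrite mulg1; apply: c1M => //; by left.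
have c1V x y : E x -> E y -> adjacent E x y -> c1 x y * c1 y x = 1.
  by move=> Ex Ey xy; rewrite c1M ?c1x //; exact: adjacent_sym.
(* All edges leaving the root vertex are measured against this one. *)
pose r0 := xget set0 [set r | E r /\ root r].
pose next x (p : P) := if `[<x 1>] then p * c2 (pr x) x else p * c1 (pr x) x.
have [u uE] := ranked_recursion (c1 r0) next pr_rank.
have u_in x : E x -> x 1 -> u x = u (~` x) * c2 (~` x) x.
  move=> Ex x1; rewrite uE // (negbTE (in_not_root x1)) /next pr_in //.
  by move/asboolP: x1 => ->.
have u_up x f : E x -> ~ x 1 -> above x f -> u x = u (~` f) * c1 (~` f) x.
  move=> Ex x1 xf; rewrite uE // (negbTE (above_not_root xf)) /next (pr_above Ex x1 xf).
  by move/asboolPn/negbTE: x1 => ->.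
have u_adj x y : E x -> E y -> y 1 -> adjacent E x y -> x <> y -> u x = u y * c1 y x.
  move=> Ex Ey y1 [//|[h1 h2 h3]] nxy; rewrite -{1 2}(setCK y); apply: u_up => //.
    by move=> /h1.
  by split=> //; [exact: EC|rewrite setCK; right].
exists u; split=> [x y Ex Ey xy|x Ex].
  have [<-|nxy] := pselect (x = y); first by rewrite c1x // mulg1.
  have [y1|y1] := pselect (y 1).
    by rewrite (u_adj x y) // -mulgA c1V ?mulg1 //; exact: adjacent_sym.
  have [x1|x1] := pselect (x 1).
    by rewrite (u_adj y x) //; [exact: adjacent_sym|exact: nesym].
  have up_of v w f : E v -> E w -> ~ v 1 -> ~ w 1 -> adjacent E v w -> above v f -> above w f.
    move=> Ev Ew v1 w1 vw [Ef f1 nvf vf af].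
    have wf : adjacent E w (~` f).
      by apply: (adjacent_trans tE Ew Ev (EC Ef)) => //; exact: adjacent_sym.
    have ne : w <> ~` f by move=> e; apply: w1; rewrite e.
    have [//|[h1 h2 _]] := wf; rewrite setCK in h1 h2.
    by split.
  have [[f xf]|nx] := pselect (exists f, above x f).
    have yf : above y f by exact: (up_of x y).
    have [Ef f1 _ _ af] := xf.
    rewrite (u_up x f) // (u_up y f) // -mulgA c1M //; [exact: EC|exact: adjacent_sym].
  have ny : ~ exists f, above y f.
    by move=> [f yf]; apply: nx; exists f; apply: (up_of y x) => //; exact: adjacent_sym.
  have rx : root x by apply/asboolP; split=> // f h; apply: nx; exists f.
  have ry : root y by apply/asboolP; split=> // f h; apply: ny; exists f.
  have [Er0 /asboolP[r1 nr]] : E r0 /\ root r0.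
    by apply: (@xgetPex _ set0 [set r | E r /\ root r]); exists x.
  rewrite (uE x) // (uE y) // rx ry c1M //; apply: maximal_adjacent => // f h; apply: nx; by exists f.
have [x1|x1] := pselect (x 1).
  by have := c2V (EC Ex); rewrite setCK (u_in x) // -mulgA => ->; rewrite mulg1.
by rewrite (u_in (~` x)) ?setCK //; exact: EC.
Qed.

End Potential.

(* Data for a graph of finite groups with trivial edge groups whose fundamental
   group is G: its Bass-Serre tree is connected, and simply connected. *)
Record graph_of_groups (G : groupType) (I K : finType) := GraphOfGroups {
  vertex_group : I -> set G;
  edge_source : K -> I;
  edge_target : K -> I;
  edge_elt : K -> G;
  vertex_group_finite : forall i, finite_subgroup (vertex_group i);
  gog_connected : forall Z : G -> I -> Prop, (exists g i, Z g i) ->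
    (forall g i h, vertex_group i h -> Z g i -> Z (g * h) i) ->
    (forall g k, Z g (edge_source k) <-> Z (g * edge_elt k) (edge_target k)) ->
    forall g i, Z g i;
  gog_potential : forall (P : groupType) (f : I -> G -> P) (tau : K -> P),
    (forall i h h', vertex_group i h -> vertex_group i h' ->
      f i (h * h') = f i h * f i h') ->
    exists psi : G -> I -> P,
      (forall g i h, vertex_group i h -> psi (g * h) i = psi g i * f i h) /\
      (forall g k, psi (g * edge_elt k) (edge_target k) = psi g (edge_source k) * tau k) }.

(** * The quotient graph of groups of a tree with trivial edge stabilisers *)

Section Tree.
Variables (G : groupType) (E : set (set G)).
Hypothesis cE : cofinite_tree E.
Hypothesis freeE : forall e g, E e -> lset g e = e -> g = 1.
Variable e0 : set G.
Hypothesis E0 : E e0.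

Let tE := cofinite_tree_set cE.

(* The tree is subdivided: [incident true] is having the same origin, and
   [incident false] being carried by the same unoriented edge. *)
Definition incident (b : bool) (x y : set G) :=
  if b then adjacent E x y else y = x \/ y = ~` x.

Lemma incident_refl b x : incident b x x.
Proof. by case: b; left. Qed.

Lemma incident_sym b x y : incident b x y -> incident b y x.
Proof.
by case: b => [/(adjacent_sym tE)//|[->|->]]; [left|right; rewrite setCK].
Qed.

Lemma incident_trans b x y z : E x -> E y -> E z ->
  incident b x y -> incident b y z -> incident b x z.
Proof.
case: b => Ex Ey Ez; first exact: adjacent_trans.
by move=> [->|->] [->|->]; rewrite ?setCK; [left|right|right|left].
Qed.

Lemma incident_lset b g x y : incident b x y -> incident b (lset g x) (lset g y).
Proof. by case: b => [|[->|->]]; [exact: adjacent_lset|left|right]. Qed.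

Let EL := tree_lset tE.

(** Orbit representatives, of vertices ([rp], moved into place by [mv]) and of oriented edges ([o]
    and [tr]). As [xget] depends only on the set of candidates, representatives are constant on
    orbits. *)
Let rp b e := xget set0 [set f | E f /\ exists g, incident b e (lset g f)].
Let mv b e := xget 1 [set g | incident b e (lset g (rp b e))].

Let rpP b e : E e -> E (rp b e) /\ exists g, incident b e (lset g (rp b e)).
Proof.
move=> Ee; apply: (@xgetPex _ set0 [set f | E f /\ exists g, incident b e (lset g f)]).
by exists e; split=> //; exists 1; rewrite lset1; exact: incident_refl.
Qed.

Let rpE b e : E e -> E (rp b e). Proof. by case/(rpP b). Qed.

Let mvP b e : E e -> incident b e (lset (mv b e) (rp b e)).
Proof.
move=> /(rpP b)[_ h].
exact: (@xgetPex _ 1 [set g | incident b e (lset g (rp b e))]).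
Qed.

Let rp_eq b e f g : E e -> E f -> incident b e (lset g f) -> rp b e = rp b f.
Proof.
move=> Ee Ef ef; rewrite /rp; congr xget; apply/seteqP; split=> x [Ex [h hx]].
  split=> //; exists (g^-1 * h); rewrite lsetM -{1}(lsetK g f).
  apply: incident_lset; apply: incident_trans hx => //; try exact: EL.
  exact: incident_sym.
split=> //; exists (g * h); rewrite lsetM; apply: incident_trans ef _ => //;
  [exact: EL|by do 2!apply: EL|exact: incident_lset].
Qed.

Let rpK b e : E e -> rp b (rp b e) = rp b e.
Proof. by move=> Ee; apply/esym; apply: rp_eq (mvP b Ee) => //; exact: rpE. Qed.

Let rpL b g e : E e -> rp b (lset g e) = rp b e.
Proof. by move=> Ee; apply: (@rp_eq _ _ _ g) => //; [exact: EL|exact: incident_refl]. Qed.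

Let o e := xget set0 [set f | E f /\ exists g, e = lset g f].
Let tr e := xget 1 [set g | e = lset g (o e)].

Let oP e : E e -> E (o e) /\ exists g, e = lset g (o e).
Proof.
move=> Ee; apply: (@xgetPex _ set0 [set f | E f /\ exists g, e = lset g f]).
by exists e; split=> //; exists 1; rewrite lset1.
Qed.

Let oE e : E e -> E (o e). Proof. by case/oP. Qed.

Let trP e : E e -> e = lset (tr e) (o e).
Proof. by move=> /oP[_ h]; apply: (@xgetPex _ 1 [set g | e = lset g (o e)]). Qed.

Let oL g e : o (lset g e) = o e.
Proof.
rewrite /o; congr xget; apply/seteqP; split=> f [Ef [h hf]]; split=> //.
  by exists (g^-1 * h); rewrite lsetM -hf lsetK.
by exists (g * h); rewrite lsetM -hf.
Qed.

Let oK e : E e -> o (o e) = o e.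
Proof. by move=> Ee; rewrite {2}(trP Ee) oL. Qed.

Let tr_uniq e g f : E f -> e = lset g f -> o f = f -> tr e = g.
Proof.
move=> Ef eg of'; have Ee : E e by rewrite eg; exact: EL.
have := trP Ee; rewrite {1 3}eg oL of' => h.
have : g^-1 * tr e = 1 by apply: (freeE Ef); rewrite lsetM -h lsetK.
by move/(canRL (mulVKg _)); rewrite mulg1.
Qed.

Let finite_nodes : finite_set [set p : bool * set G | exists2 e, E e & p = (p.1, rp p.1 e)].
Proof.
have [Q [fQ QE hQ]] := cofinite_orbits cE.
apply: (@sub_finite_set _ _ (((fun e => (true, rp true e)) @` Q) `|` ((fun e => (false, rp false e)) @` Q))).
  move=> [b x] [e /hQ[g [f Qf ->]] /= ->]; rewrite rpL; last exact: QE.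
  by case: b; [left|right]; exists f.
by rewrite finite_setU; split; exact: finite_image.
Qed.

Let finite_edges : finite_set [set f | exists2 e, E e & f = o e].
Proof.
have [Q [fQ QE hQ]] := cofinite_orbits cE.
apply: (sub_finite_set _ (finite_image o fQ)) => f [e /hQ[g [h Qh ->]] ->].
by rewrite oL; exists h.
Qed.

(** Vertices and edges of the quotient of the subdivided tree: a node is an orbit of origins or of
    midpoints, told apart by the Boolean, and each orbit of oriented edges joins an origin to a
    midpoint. *)
Let ns := fset_set [set p : bool * set G | exists2 e, E e & p = (p.1, rp p.1 e)].
Let ks := fset_set [set f | exists2 e, E e & f = o e].
Local Notation I := (fset_sub_type ns).
Local Notation K := (fset_sub_type ks).

Let in_ns b e : E e -> (b, rp b e) \in ns.
Proof. by move=> Ee; rewrite in_fset_set //; apply/mem_set; exists e. Qed.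

Let in_ks e : E e -> o e \in ks.
Proof. by move=> Ee; rewrite in_fset_set //; apply/mem_set; exists e. Qed.

Let node b e : I := insubd (FSetSub (in_ns true E0)) (b, rp b e).
Let edge e : K := insubd (FSetSub (in_ks E0)) (o e).

Let nodeE b e : E e -> val (node b e) = (b, rp b e).
Proof. by move=> Ee; rewrite val_insubd in_ns. Qed.

Let edgeE e : E e -> val (edge e) = o e.
Proof. by move=> Ee; rewrite val_insubd in_ks. Qed.

Let IP (i : I) : E (val i).2 /\ rp (val i).1 (val i).2 = (val i).2.
Proof.
have := valP i; rewrite in_fset_set // => /set_mem[e Ee ->] /=.
by split; [exact: rpE|exact: rpK].
Qed.

Let KP (k : K) : E (val k) /\ o (val k) = val k.
Proof.
have := valP k; rewrite in_fset_set // => /set_mem[e Ee ->] /=.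
by split; [exact: oE|exact: oK].
Qed.

(** The stabiliser of the representative vertex. At a midpoint it may contain an element inverting
    the edge, which is the reason for subdividing. *)
Let H (i : I) := [set h | incident (val i).1 (val i).2 (lset h (val i).2)].

Let H_finite i : finite_subgroup (H i).
Proof.
have [Ex _] := IP i; rewrite /H; move: (val i) Ex => [[] x] /= Ex; first exact: star_subgroup.
split.
  apply: subgroupP => [|g h gx hx]; first by left; rewrite lset1.
  have {}hx : lset h^-1 x = x \/ lset h^-1 x = ~` x.
    by case: hx => /(congr1 (lset h^-1)); rewrite lsetK => e; [left|right; rewrite [in RHS]e lsetC setCK].
  rewrite /= lsetM; case: hx => ->; case: gx => e; rewrite ?lsetC e ?setCK; by [left|right].
apply: (@sub_finite_set _ _ ([set g | lset g x = x] `|` [set g | lset g x = ~` x])) => //.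
by rewrite finite_setU; split; exact: (finite_transporter cE).
Qed.

Let node_lset (i : I) g : node (val i).1 (lset g (val i).2) = i.
Proof.
have [Ex rx] := IP i; apply: val_inj; rewrite nodeE ?rpL ?rx //; last exact: EL.
by case: (val i).
Qed.

(* [v b y] is the position of the vertex of y in the tree. *)
Let v b y := tr y * mv b (o y).

Let rpo b y : E y -> rp b (o y) = rp b y.
Proof. by move=> Ey; rewrite [in RHS](trP Ey) rpL //; exact: oE. Qed.

Let vP b y : E y -> incident b y (lset (v b y) (rp b y)).
Proof.
move=> Ey; rewrite {1}(trP Ey) lsetM; apply: incident_lset.
by rewrite -(rpo b Ey); apply: mvP; exact: oE.
Qed.

Let vH b y g : E y -> incident b y (lset g (rp b y)) -> H (node b y) ((v b y)^-1 * g).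
Proof.
move=> Ey yg; rewrite /H nodeE //= lsetM -{1}(lsetK (v b y) (rp b y)).
have Er := rpE b Ey; apply: incident_lset; apply: incident_trans yg => //; do ?exact: EL.
by apply: incident_sym; exact: vP.
Qed.

Let node_eq b x y : E x -> E y -> incident b x y -> node b x = node b y.
Proof.
move=> Ex Ey xy; apply: val_inj; rewrite !nodeE //; congr pair.
by apply: (@rp_eq _ _ _ 1) => //; rewrite lset1.
Qed.

Let s (k : K) := node true (val k).
Let t (k : K) := node false (val k).
(** The edge [val k] joins the [mv true] translate of its source representative to the [mv false]
    translate of its target representative. *)
Let gam (k : K) := (mv true (val k))^-1 * mv false (val k).

Let v_edge (b : bool) (k : K) g : v b (lset (g / mv true (val k)) (val k)) = g / mv true (val k) * mv b (val k).
Proof.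
have [Ek ok] := KP k; rewrite /v oL ok; congr mul.
by apply: tr_uniq Ek _ ok.
Qed.

(** [Z] is read at the two ends of each half edge, where its closure properties become invariance
    under adjacency and reversal. *)
Let connected_data (Z : G -> I -> Prop) : (exists g i, Z g i) ->
  (forall g i h, H i h -> Z g i -> Z (g * h) i) ->
  (forall g k, Z g (s k) <-> Z (g * gam k) (t k)) ->
  forall g i, Z g i.
Proof.
move=> [g0 [i0 Z0]] ZH Zst.
pose Y b y := Z (v b y) (node b y).
have YH b y g : E y -> incident b y (lset g (rp b y)) -> Z g (node b y) <-> Y b y.
  move=> Ey yg; have h := vH Ey yg; split=> [Zg|/(ZH _ _ _ h)]; last by rewrite mulVKg.
  have [cH _] := H_finite (node b y).
  have := ZH _ _ _ (subgroupV cH h) Zg.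
  by rewrite invgM invgK mulVKg.
have YR b x y : E x -> E y -> incident b x y -> Y b x -> Y b y.
  move=> Ex Ey xy; rewrite /Y (node_eq Ex Ey xy) => Yx; apply/(YH b y (v b x)) => //.
  have rxy : rp b x = rp b y by have := congr1 (fun i => (val i).2) (node_eq Ex Ey xy); rewrite !nodeE.
  rewrite -rxy; apply: (@incident_trans _ _ x) => //; [exact/EL/rpE|exact: incident_sym|exact: vP].
have Yb b b' y : E y -> Y b y -> Y b' y.
  move=> Ey; suff : Y true y <-> Y false y by case: b b' => [] [] // [].
  have := Zst (v true y) (edge y); rewrite /Y /s /t edgeE //.
  have no c : node c (o y) = node c y.
    by apply: val_inj; rewrite !nodeE ?rpo //; exact: oE.
  by rewrite !no /gam edgeE // /v mulgA mulgK.
have Yall : forall y, E y -> Y true y.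
  apply: (tree_connected tE).
  - by move=> x y Ex Ey xy; apply: YR.
  - move=> x Ex Yx; have Enx := tree_setC tE Ex; apply: (Yb false) => //.
    by apply: (YR false x) => //; [right|exact: Yb Yx].
  - have [Ex rx] := IP i0; exists (lset g0 (val i0).2); first exact: EL.
    apply: (Yb (val i0).1); first exact: EL.
    apply/(YH _ _ g0); rewrite ?node_lset ?rpL ?rx //; [exact: EL|exact: incident_refl].
move=> g i; have [Ex rx] := IP i; rewrite -(node_lset i g).
apply/YH; [exact: EL|by rewrite rpL // rx; exact: incident_refl|].
by apply: (Yb true); [exact: EL|exact/Yall/EL].
Qed.

(** Positions of one vertex differ by elements of a vertex group; their images under [f] give a
    cocycle [c], which is integrated over the tree. The value of [psi] at a vertex is then
    independent of the half-space used to reach it. *)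
Let potential_data (P : groupType) (f : I -> G -> P) (tau : K -> P) :
  (forall i h h', H i h -> H i h' -> f i (h * h') = f i h * f i h') ->
  exists psi : G -> I -> P, (forall g i h, H i h -> psi (g * h) i = psi g i * f i h) /\
    (forall g k, psi (g * gam k) (t k) = psi g (s k) * tau k).
Proof.
move=> fM.
(* [tau] is charged on passing from the origin of an oriented edge to its midpoint. *)
pose sg (b : bool) y := if b then 1 else tau (edge y).
pose F b y g := f (node b y) ((v b y)^-1 * g).
pose c b x y := sg b x * F b x (v b y) / sg b y.
have FM b x y g : E x -> E y -> incident b x y -> incident b x (lset g (rp b x)) ->
    F b x (v b y) * F b y g = F b x g.
  move=> Ex Ey xy xg; rewrite /F -(node_eq Ex Ey xy) -fM; first by rewrite -mulgA mulVKg.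
    apply: vH => //; have -> : rp b x = rp b y.
      by apply: (@rp_eq _ _ _ 1) => //; rewrite lset1.
    by apply: (@incident_trans _ _ y) => //; [exact/EL/rpE|exact: vP].
  rewrite (node_eq Ex Ey xy); apply: vH => //.
  have <- : rp b x = rp b y by apply: (@rp_eq _ _ _ 1) => //; rewrite lset1.
  by apply: (@incident_trans _ _ x) => //; [exact/EL/rpE|exact: incident_sym].
have vI b x y : E x -> E y -> incident b x y -> incident b x (lset (v b y) (rp b x)).
  move=> Ex Ey xy; have -> : rp b x = rp b y by apply: (@rp_eq _ _ _ 1) => //; rewrite lset1.
  by apply: (@incident_trans _ _ y) => //; [exact/EL/rpE|exact: vP].
have cM b x y z : E x -> E y -> E z -> incident b x y -> incident b y z ->
    c b x y * c b y z = c b x z.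
  move=> Ex Ey Ez xy yz; rewrite /c -!mulgA mulKg [F b x _ * _]mulgA FM //.
  by apply: vI => //; exact: incident_trans yz.
have cx b x : E x -> c b x x = 1.
  by move=> Ex; apply: (mulgI (c b x x)); rewrite mulg1; apply: cM => //; exact: incident_refl.
have [th [th1 th2]] : exists u : set G -> P,
    (forall x y, E x -> E y -> adjacent E x y -> u y = u x * c true x y) /\
    (forall x, E x -> u (~` x) = u x * c false x (~` x)).
  apply: (tree_potential tE) => [x y z|x Ex]; first exact: (cM true).
  have Enx := tree_setC tE Ex.
  rewrite (cM false) ?cx //; [by right|by right; rewrite setCK].
have thR b x y : E x -> E y -> incident b x y -> th y = th x * c b x y.
  case: b => Ex Ey; first exact: th1.
  by move=> [->|->]; [rewrite cx // mulg1|exact: th2].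
pose psi g (i : I) := let b := (val i).1 in let y := lset g (val i).2 in
  th y * sg b y * F b y g.
have psiE g i y : E y -> i = node (val i).1 y -> incident (val i).1 y (lset g (val i).2) ->
    psi g i = th y * sg (val i).1 y * F (val i).1 y g.
  move=> Ey ei yg; rewrite /psi; set b := (val i).1 in ei yg *; set x := (val i).2 in yg *.
  have [Ex rx] := IP i.
  have ry : rp b y = x by have := congr1 (fun i => (val i).2) ei; rewrite nodeE.
  rewrite (thR b y) //; last exact: EL.
  rewrite /c -!mulgA; congr mul; rewrite mulKg; congr mul.
  by apply: FM => //; [exact: EL|rewrite ry].
exists psi; split=> [g i h Hh|g k].
  have [Ex rx] := IP i; set y := lset g (val i).2.
  have Ey : E y by exact: EL.
  have yh : incident (val i).1 y (lset (g * h) (val i).2).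
    by rewrite lsetM; exact: incident_lset.
  have ei : i = node (val i).1 y by rewrite node_lset.
  rewrite (psiE _ _ y) // (psiE g _ y) //; last exact: incident_refl.
  rewrite -!mulgA; congr mul; congr mul; rewrite /F -ei mulgA.
  rewrite fM //; have := @vH (val i).1 y g Ey; rewrite -ei; apply.
  by rewrite rpL // rx; exact: incident_refl.
have [Ek ok] := KP k; pose y := lset (g / mv true (val k)) (val k).
have Ey : E y by exact: EL.
have vt : v true y = g by rewrite v_edge mulgVK.
have vf : v false y = g * gam k by rewrite v_edge -mulgA.
have nk b : node b y = node b (val k) by apply: val_inj; rewrite !nodeE // rpL.
have ek : edge y = k by apply: val_inj; rewrite edgeE // oL.
have F1 b : F b y (v b y) = 1.
  rewrite /F mulVg; have [cH _] := H_finite (node b y); have H1 := subgroup1 cH.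
  by apply: (mulgI (f (node b y) 1)); rewrite mulg1 -fM // mul1g.
have vPk b : incident b y (lset (v b y) (rp b (val k))).
  by rewrite -(rpL b (g / mv true (val k))) //; exact: vP.
have sb : (val (s k)).1 = true by rewrite nodeE.
have tb : (val (t k)).1 = false by rewrite nodeE.
rewrite (psiE g (s k) y) ?sb ?nk //; last first.
  by rewrite nodeE //=; have := vPk true; rewrite vt.
rewrite (psiE _ (t k) y) ?tb ?nk //; last first.
  by rewrite nodeE //=; have := vPk false; rewrite vf.
have := F1 true; have := F1 false; rewrite vt vf => -> ->.
by rewrite /sg ek !mulg1.
Qed.

Lemma tree_graph_of_groups : exists (I K : finType) (i : I), inhabited (graph_of_groups G I K).
Proof.
exists I, K, (node true e0).
exact: (inhabits (GraphOfGroups H_finite connected_data potential_data)).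
Qed.

End Tree.

(** * Free products *)

Section FinSub.
Variables (G : groupType) (H : set G).

Definition finsub (_ : finite_subgroup H) : Type := fset_sub_type (fset_set H).

Variable fH : finite_subgroup H.
Local Notation FS := (finsub fH).

HB.instance Definition _ := Finite.copy FS (fset_sub_type (fset_set H)).

Let cH := proj1 fH.

Definition finsub_val (x : FS) : G := fsval x.

Lemma finsub_valP x : H (finsub_val x).
Proof. by have := valP (x : fset_sub_type (fset_set H)); rewrite in_fset_set => [/set_mem|]; [|case: fH]. Qed.

Lemma finsub_val_inj : injective finsub_val.
Proof. exact: val_inj. Qed.

Lemma in_finsub x : H x -> x \in fset_set H.
Proof. by move=> Hx; rewrite in_fset_set; [exact/mem_set|case: fH]. Qed.

Definition finsub_one : FS := FSetSub (in_finsub (subgroup1 cH)).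
Definition finsub_mul (x y : FS) : FS :=
  FSetSub (in_finsub (subgroupM cH (finsub_valP x) (finsub_valP y))).
Definition finsub_inv (x : FS) : FS :=
  FSetSub (in_finsub (subgroupV cH (finsub_valP x))).

Lemma finsub_mulA : associative finsub_mul.
Proof. by move=> x y z; apply: finsub_val_inj; rewrite /= mulgA. Qed.

Lemma finsub_mul1 : left_id finsub_one finsub_mul.
Proof. by move=> x; apply: finsub_val_inj; rewrite /= mul1g. Qed.

Lemma finsub_mulV : left_inverse finsub_one finsub_inv finsub_mul.
Proof. by move=> x; apply: finsub_val_inj; rewrite /= mulVg. Qed.

HB.instance Definition _ := Finite_isGroup.Build FS finsub_mulA finsub_mul1 finsub_mulV.

Definition to_finsub (h : G) : FS := insubd finsub_one h.

Lemma to_finsubK h : H h -> finsub_val (to_finsub h) = h.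
Proof. by move=> Hh; rewrite /finsub_val /to_finsub val_insubd in_finsub. Qed.

Lemma to_finsubM h k : H h -> H k -> to_finsub (h * k) = to_finsub h * to_finsub k.
Proof.
move=> Hh Hk; apply: finsub_val_inj.
rewrite to_finsubK; last exact: subgroupM.
by rewrite -{1}(to_finsubK Hh) -{1}(to_finsubK Hk).
Qed.

Lemma finsub_valK x : to_finsub (finsub_val x) = x.
Proof. by apply: finsub_val_inj; rewrite to_finsubK //; exact: finsub_valP. Qed.

Lemma finsub_conj_morphism (u : G) :
  monoid_morphism (fun x : FS => u * finsub_val x / u).
Proof.
split; first by rewrite [finsub_val _](_ : _ = 1) // mulg1 mulgV.
move=> x y; rewrite [finsub_val _](_ : _ = finsub_val x * finsub_val y) //.
by rewrite !mulgA mulgVK.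
Qed.

End FinSub.

Definition zexp (G : groupType) (a : G) (z : int) : G :=
  match z with Posz n => a ^+ n | Negz n => (a ^+ n.+1)^-1 end.

Lemma zexpS (G : groupType) (a : G) (z : int) : zexp a (z + Posz 1)%R = zexp a z * a.
Proof.
case: z => n; first by rewrite -PoszD addn1 /= expgSr.
case: n => [|n]; first by rewrite (_ : (_ + _)%R = Posz 0) /= ?expg1 ?mulVg //; lia.
rewrite (_ : (_ + _)%R = Negz n); last by lia.
by rewrite /= [a ^+ n.+2]expgS invgM mulgVK.
Qed.

Lemma zexpD (G : groupType) (a : G) (y z : int) :
  zexp a (y + z)%R = zexp a y * zexp a z.
Proof.
have h n x : zexp a (x + Posz n)%R = zexp a x * a ^+ n.
  elim: n x => [|n IH] x; first by rewrite (_ : (_ + _)%R = x) ?mulg1 //; lia.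
  by rewrite (_ : (_ + _)%R = (x + Posz n + Posz 1)%R) ?zexpS ?IH ?expgSr ?mulgA //; lia.
case: z => n; first exact: h.
apply: (mulIg (a ^+ n.+1)); rewrite -h /= mulgVK.
by rewrite (_ : (_ + _)%R = y) //; lia.
Qed.

Lemma morph_expg (G P : groupType) (f : G -> P) a n : monoid_morphism f ->
  f (a ^+ n) = f a ^+ n.
Proof. by move=> [f1 fM]; elim: n => [|n IH]; rewrite ?expg0 // !expgS fM IH. Qed.

Lemma morph_inv (G P : groupType) (f : G -> P) a : monoid_morphism f -> f a^-1 = (f a)^-1.
Proof. by move=> [f1 fM]; apply: (mulgI (f a)); rewrite mulgV -fM mulgV. Qed.

Section FreeProduct.
Variables (I : choiceType) (F : I -> groupType).

Definition syllable (i : I) (g : F i) : free_prod F :=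
  word_class (@free_prod_rules I F) [:: letter g].

Lemma syllable_morphism i : monoid_morphism (@syllable i).
Proof.
split; first by apply/word_classP; exact: cong_one.
move=> g h; rewrite [RHS]pm_mulE; apply/word_classP; apply: rst_sym; exact: cong_mul.
Qed.

Lemma free_prod_ind (Q : free_prod F -> Prop) : Q 1 ->
  (forall i (g : F i) p, Q p -> Q (syllable g * p)) -> forall p, Q p.
Proof.
move=> Q1 QS p; rewrite -(word_classK p); elim: (repr p) => [|[i g] w IH] //.
by have := QS i g _ IH; rewrite [_ * _]pm_mulE.
Qed.

Variables (G : groupType) (phi : forall i, F i -> G).
Hypothesis phiM : forall i, monoid_morphism (@phi i).

Let ev (w : seq (free_prod_letter F)) : G := foldr (fun a g => phi (projT2 a) * g) 1 w.

Let ev_cat u v : ev (u ++ v) = ev u * ev v.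
Proof. by elim: u => [|a u IH] /=; rewrite ?mul1g // IH mulgA. Qed.

Let ev_congruent u v : congruent (@free_prod_rules I F) u v -> ev u = ev v.
Proof.
elim=> {u v} [u v [p [q [l [r [lr -> ->]]]]]|//|//|u v w _ -> _ -> //].
rewrite !ev_cat; congr (_ * (_ * _)).
case: lr => [[i [-> ->]]|[i [g [h [-> ->]]]]] /=; rewrite mulg1.
  by have [-> _] := phiM i.
by have [_ ->] := phiM i; rewrite mulg1.
Qed.

(** The existence half of the universal property of the free product. *)
Lemma free_prod_lift : exists f : free_prod F -> G,
  monoid_morphism f /\ forall i (g : F i), f (syllable g) = phi g.
Proof.
have E w : ev (repr (word_class (@free_prod_rules I F) w)) = ev w.
  by apply: ev_congruent; apply/word_classP; rewrite word_classK.
exists (fun p => ev (repr p)); split; last by move=> i g; rewrite E /= mulg1.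
split; first exact: (E [::]).
by move=> x y; rewrite [X in ev (repr X)](_ : _ = pm_mul x y) // /pm_mul E ev_cat.
Qed.

End FreeProduct.

(** * From a graph of groups to a free product *)

Section SpanningTree.
Variables (G : groupType) (I K : finType) (s t : K -> I) (gam : K -> G) (i0 : I).
Hypothesis conn : forall J : {set I}, i0 \in J ->
  (forall k, (s k \in J) = (t k \in J)) -> J = [set: I]%SET.

(* A gauge [u] trivialising the labels of the edges of a spanning tree. *)
Lemma spanning_tree : exists (u : I -> G) (Tr : {set K}),
  (forall k, k \in Tr -> u (t k) = u (s k) * gam k) /\
  forall J : {set I}, i0 \in J -> (forall k, k \in Tr -> (s k \in J) = (t k \in J)) ->
    J = [set: I]%SET.
Proof.
suff grow n : exists (J : {set I}) (u : I -> G) (Tr : {set K}),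
    [/\ i0 \in J, (J == [set: I]%SET) || (n <= #|J|)%N,
      forall k, k \in Tr -> [/\ s k \in J, t k \in J & u (t k) = u (s k) * gam k] &
      forall J' : {set I}, i0 \in J' -> (forall k, k \in Tr -> (s k \in J') = (t k \in J')) ->
        J \subset J'].
  (* More than [#|I|] vertices cannot be reached, so the grown tree spans. *)
  have [J [u [Tr [J0 JT uT JJ]]]] := grow #|I|.+1.
  have {}JT : J = [set: I]%SET.
    by case/orP: JT => [/eqP//|]; rewrite leqNgt ltnS max_card.
  exists u, Tr; split=> [k /uT[]//|J' J'0 hJ'].
  by apply/eqP; rewrite finset.eqEsubset finset.subsetT -JT JJ.
elim: n => [|n [J [u [Tr [J0 JT uT JJ]]]]].
  exists [set i0]%SET, (fun=> 1), finset.set0; split=> //; first by rewrite finset.set11.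
    by rewrite leq0n orbT.
  - by move=> k; rewrite finset.in_set0.
  - by move=> J' h _; rewrite finset.sub1set.
have [JT'|nJT] := eqVneq J [set: I]%SET.
  by exists J, u, Tr; split=> //; rewrite JT' eqxx.
have [k kJ] : exists k, (s k \in J) != (t k \in J).
  apply/existsP; rewrite -negb_forall; apply: contra nJT => /forallP h.
  by apply/eqP; apply: conn => // k; apply/eqP; exact: h.
rewrite (negbTE nJT) /= in JT.
pose j := if s k \in J then t k else s k.
have jJ : j \notin J by rewrite /j; case: ifP kJ => // ->.
pose v i := if i == j then (if s k \in J then u (s k) * gam k else u (t k) / gam k) else u i.
have vJ i : i \in J -> v i = u i.
  by rewrite /v; case: eqP => // ->; rewrite (negbTE jJ).
exists (j |: J)%SET, v, (k |: Tr)%SET; split.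
- by rewrite finset.inE J0 orbT.
- by rewrite cardsU1 jJ add1n ltnS JT orbT.
- move=> l; rewrite finset.in_setU1 => /orP[/eqP ->|/uT[sl tl e]]; last first.
    by rewrite !finset.in_setU1 sl tl !orbT !vJ.
  have vj : v j = if s k \in J then u (s k) * gam k else u (t k) / gam k.
    by rewrite /v eqxx.
  rewrite !finset.in_setU1; case: (boolP (s k \in J)) => sk.
    have jt : j = t k by rewrite /j sk.
    by rewrite -jt eqxx orbT vj sk vJ.
  have tk : t k \in J by move: kJ; rewrite (negbTE sk); case: (t k \in J).
  have js : j = s k by rewrite /j (negbTE sk).
  by rewrite -js eqxx tk orbT vj (negbTE sk) vJ // mulgVK.
- move=> J' J'0 h; have JJ' : J \subset J'.
    by apply: JJ => // l lT; apply: h; rewrite finset.in_setU1 lT orbT.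
  rewrite finset.subUset JJ' andbT finset.sub1set.
  have /(_ (finset.setU11 _ _)) e := h k; rewrite /j.
  case: (boolP (s k \in J)) => sk; first by rewrite -e (fintype.subsetP JJ').
  by rewrite e (fintype.subsetP JJ') //; move: kJ; rewrite (negbTE sk); case: (t k \in J).
Qed.
End SpanningTree.

Section Plain.
Variables (G : groupType) (I K : finType) (i0 : I) (D : graph_of_groups G I K).

Local Notation s := (edge_source D).
Local Notation t := (edge_target D).
Local Notation gam := (edge_elt D).

(** The potential yields a map [psi] from [G] to [P] that multiplies correctly by generators of [G],
    hence a morphism; it is inverse to [pi] on generators of both sides. *)
Lemma graph_of_groups_isomorphic (u : I -> G) (Tr : {set K})
    (P : groupType) (f : I -> G -> P) (tau : K -> P) (pi : P -> G) :
  (forall k, k \in Tr -> u (t k) = u (s k) * gam k) ->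
  (forall J : {set I}, i0 \in J -> (forall k, k \in Tr -> (s k \in J) = (t k \in J)) ->
    J = [set: I]%SET) ->
  (forall i h h', vertex_group D i h -> vertex_group D i h' -> f i (h * h') = f i h * f i h') ->
  (forall k, k \in Tr -> tau k = 1) ->
  monoid_morphism pi ->
  (forall i h, vertex_group D i h -> pi (f i h) = u i * h / u i) ->
  (forall k, k \notin Tr -> pi (tau k) = u (s k) * gam k / u (t k)) ->
  (forall Q : P -> Prop, Q 1 ->
    (forall i h p, vertex_group D i h -> Q p -> Q (f i h * p)) ->
    (forall k p, Q p <-> Q (tau k * p)) -> forall p, Q p) ->
  isomorphic G P.
Proof.
move=> uT TrJ fM tauT pi_mor pif pit genP.
have [psi0 [psiH psiE]] := @gog_potential _ _ _ D P f tau fM.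
pose psi1 g := psi0 (g * u i0) i0.
(* Along [Tr] the gauge absorbs [gam] and [tau] is 1, so every base vertex gives the same
   function. *)
have psi0E i : forall g, psi0 (g * u i) i = psi1 g.
  have e : [set i | `[<forall g, psi0 (g * u i) i = psi1 g>]]%SET = [set: I]%SET.
    apply: TrJ => [|k kT]; first by rewrite finset.inE; apply/asboolP.
    have E g : psi0 (g * u (s k)) (s k) = psi0 (g * u (t k)) (t k).
      by rewrite uT // mulgA psiE tauT // mulg1.
    by rewrite !finset.inE; apply/asboolP/asboolP => h g; rewrite -h E.
  have : i \in [set: I]%SET by rewrite finset.in_setT.
  by rewrite -e finset.inE => /asboolP.
pose psi g := (psi1 1)^-1 * psi1 g.
pose av i h := u i * h / u i.
pose ae k := u (s k) * gam k / u (t k).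
have psiV g i h : vertex_group D i h -> psi (g * av i h) = psi g * f i h.
  move=> hi; rewrite /psi -mulgA; congr mul.
  by rewrite -(psi0E i) /av -!mulgA mulVg mulg1 mulgA psiH // psi0E.
have psiA g k : psi (g * ae k) = psi g * tau k.
  rewrite /psi -mulgA; congr mul.
  by rewrite -(psi0E (t k)) /ae -!mulgA mulVg mulg1 !mulgA psiE psi0E.
have psi_1 : psi 1 = 1 by exact: mulVg.
clearbody psi.
(* Connectedness of the Bass-Serre tree says that the conjugated vertex groups and the edge elements
   generate [G]. *)
have gen (Q : G -> Prop) : Q 1 ->
    (forall g i h, vertex_group D i h -> Q g -> Q (g * av i h)) ->
    (forall g k, Q g <-> Q (g * ae k)) -> forall g, Q g.
  move=> Q1 QV QA g; rewrite -[g](mulgK (u i0)).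
  apply: (@gog_connected _ _ _ D (fun g i => Q (g / u i))) => [|g' i h hi|g' k].
  - by exists (u i0), i0; rewrite mulgV.
  - by move/(QV _ i _ hi); rewrite /av !mulgA mulgVK.
  - by rewrite (QA _ k) /ae !mulgA mulgVK.
have psiM g g' : psi (g * g') = psi g * psi g'.
  move: g' g; apply: gen => [g|g' i h hi IH g|g' k].
  - by rewrite mulg1 psi_1 mulg1.
  - by rewrite mulgA !psiV // IH mulgA.
  - split=> IH g; first by rewrite mulgA !psiA IH mulgA.
    by apply: (mulIg (tau k)); rewrite -mulgA -!psiA -mulgA IH.
have [pi1 piM] := pi_mor.
have pit' k : pi (tau k) = ae k.
  have [kT|/pit//] := boolP (k \in Tr).
  by rewrite tauT // pi1 /ae uT // mulgV.
exists psi; split=> //; exists pi.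
  apply: gen => [|g i h hi IH|g k]; first by rewrite psi_1 pi1.
    by rewrite psiV // piM IH pif.
  by rewrite psiA piM pit'; split=> [->//|/mulIg].
apply: genP => [|i h p hi IH|k p]; first by rewrite pi1 psi_1.
  by rewrite piM psiM IH pif // -[_ / _]mul1g psiV // psi_1 mul1g.
by rewrite piM psiM pit' -[ae k]mul1g psiA psi_1 mul1g; split=> [->//|/mulgI].
Qed.

(** Vertex groups become the finite factors; each edge outside the spanning tree gives a copy of Z,
    whose generator maps to the loop closed by that edge. *)
Lemma plain_of_graph_of_groups : plain G.
Proof.
have [|u [Tr [uT TrJ]]] := @spanning_tree G I K s t gam i0.
  move=> J J0 h; apply/finset.setP => i; rewrite finset.in_setT.
  apply: (@gog_connected _ _ _ D (fun _ i => i \in J) _ _ _ 1) => [|//|_ k]; first by exists 1, i0.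
  by rewrite h.
pose n := #|I|; pose A := (~: Tr)%SET; pose m := #|A|.
pose F (j : 'I_n) : finGroupType := finsub (vertex_group_finite D (enum_val j)).
pose PF := @plain_factor n m F.
exists n, m, F.
pose fj (j : 'I_n) (h : G) :=
  @syllable _ PF (inl j) (to_finsub (vertex_group_finite D (enum_val j)) h).
pose zj (j : 'I_m) (z : int) := @syllable _ PF (inr j) z.
pose tau k := if [pick j : 'I_m | enum_val j == k] is Some j then zj j (Posz 1) else 1.
pose phi (i : ('I_n + 'I_m)%type) : PF i -> G := match i with
  | inl j => fun h => u (enum_val j) * (finsub_val h) / u (enum_val j)
  | inr j => fun z => zexp (u (s (enum_val j)) * gam (enum_val j) / u (t (enum_val j))) z end.
have [|pi [pi_mor piE]] := @free_prod_lift _ PF G phi.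
  case=> j; first exact: finsub_conj_morphism.
  by split=> // y z; exact: zexpD.
apply: (graph_of_groups_isomorphic (f := fun i => fj (enum_rank i)) (tau := tau) uT TrJ _ _ pi_mor).
- move=> i h h' hi hi'; have [_ M] := @syllable_morphism _ PF (inl (enum_rank i)).
  by rewrite -M -to_finsubM ?enum_rankK.
- move=> k kT; rewrite /tau; case: pickP => // j /eqP jk.
  by have := enum_valP j; rewrite jk finset.inE kT.
- by move=> i h hi; rewrite /fj piE /= to_finsubK enum_rankK.
- move=> k kT; rewrite /tau; case: pickP => [j /eqP jk|no].
    by rewrite /zj piE /= jk expg1.
  have kA : k \in A by rewrite finset.inE kT.
  by have := no (enum_rank_in kA k); rewrite enum_rankK_in // eqxx.
- move=> Q Q1 QV Qt; apply: free_prod_ind => // -[j|j] g p Qp.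
    have := QV (enum_val j) (finsub_val g) p (finsub_valP g) Qp.
    by rewrite enum_valK /fj finsub_valK.
  have tj : tau (enum_val j) = zj j (Posz 1).
    by rewrite /tau; case: pickP => [j' /eqP /enum_val_inj ->//|/(_ j)]; rewrite eqxx.
  have zS z q : zj j (Posz 1) * (zj j z * q) = zj j (z + Posz 1)%R * q.
    rewrite mulgA; congr (_ * _); rewrite /zj (_ : (z + Posz 1)%R = (Posz 1 + z)%R); last by lia.
    by have [_ M] := @syllable_morphism _ PF (inr j); rewrite -M.
  have z0 q : zj j (Posz 0) * q = q.
    by have [e _] := @syllable_morphism _ PF (inr j); rewrite -[RHS]mul1g -e.
  have Qz z : Q (zj j z * p) <-> Q (zj j (z + Posz 1)%R * p).
    by rewrite -zS -tj; exact: Qt.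
  suff : Q (zj j g * p) by [].
  case: g => k; elim: k => [|k IH].
  + by rewrite z0.
  + by move/Qz: IH; rewrite -PoszD addn1.
  + by apply/Qz; rewrite (_ : (_ + _)%R = Posz 0) ?z0 //; lia.
  + by apply/Qz; rewrite (_ : (_ + _)%R = Negz k) //; lia.
Qed.
End Plain.

(** * Reduced words and torsion in free products *)

Section NormalForm.
Variables (I : choiceType) (F : I -> groupType).

Local Notation L := (free_prod_letter F).
Local Notation cong := (congruent (@free_prod_rules I F)).
Local Notation wi := (@word_inv I F).

Definition free_prod_word (w : seq L) : free_prod F := word_class (@free_prod_rules I F) w.
Local Notation wc := free_prod_word.

Definition far (a b : L) := projT1 a != projT1 b.
Definition nontrivial_letter (a : L) := projT2 a != 1.
Definition reduced (w : seq L) := all nontrivial_letter w && sorted far w.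

(** A cast of the second letter into the factor of the first; the default 1 stands for letters of
    distinct factors. *)
Definition same_factor (a b : L) : F (projT1 a) :=
  match projT1 b =P projT1 a with
  | ReflectT e => eq_rect _ (fun i => F i : Type) (projT2 b) _ e
  | ReflectF _ => 1
  end.

Lemma same_factorE i (g h : F i) : same_factor (letter g) (letter h) = h.
Proof.
rewrite /same_factor /=; case: eqP => // e.
by rewrite (eq_irrelevance e erefl).
Qed.

(** Van der Waerden's method: letters act on reduced words, and the defining rules hold for this
    action, so [normalise] is constant on congruence classes. *)
Definition cons_letter (a : L) (w : seq L) : seq L :=
  if projT2 a == 1 then w else if w is b :: w' then
    if projT1 a == projT1 b then
      let c := projT2 a * same_factor a b in
      if c == 1 then w' else letter c :: w'
    else a :: w
  else [:: a].

Definition normalise := foldr cons_letter [::].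

Lemma cons_letter1 i w : cons_letter (letter (1 : F i)) w = w.
Proof. by rewrite /cons_letter eqxx. Qed.

Lemma cons_letter_same i (g h : F i) w : cons_letter (letter g) (letter h :: w) =
  if g == 1 then letter h :: w else if g * h == 1 then w else letter (g * h) :: w.
Proof. by rewrite /cons_letter /= eqxx same_factorE. Qed.

Lemma cons_letter_far i (g : F i) a w : i != projT1 a -> g != 1 ->
  cons_letter (letter g) (a :: w) = letter g :: a :: w.
Proof. by move=> /negbTE ia /negbTE g1; rewrite /cons_letter /= g1 ia. Qed.

Lemma reduced_cons a w : reduced (a :: w) -> reduced w.
Proof. by move=> /andP[/andP[_ aw] /path_sorted p]; apply/andP. Qed.

Lemma reduced_replace i (g h : F i) w : g != 1 -> reduced (letter h :: w) ->
  reduced (letter g :: w).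
Proof.
move=> g1 /andP[/andP[_ aw] p]; apply/andP; split; first exact/andP.
by case: w p {aw}.
Qed.

Lemma reduced_push a b w : far a b -> nontrivial_letter a -> reduced (b :: w) ->
  reduced (a :: b :: w).
Proof.
move=> ab a1 /andP[aw p]; apply/andP; split; apply/andP => //.
Qed.

Lemma cons_letter_reduced a w : reduced w -> reduced (cons_letter a w).
Proof.
case: a => i g; rewrite -/(letter g); have [->|g1] := eqVneq g 1.
  by rewrite cons_letter1.
case: w => [_|[j h] w rw]; first by rewrite /cons_letter /= (negbTE g1) /reduced /= /nontrivial_letter g1.
have [e|ij] := eqVneq i j; last by rewrite cons_letter_far //; exact: reduced_push.
subst j; rewrite -/(letter h) in rw *; rewrite cons_letter_same (negbTE g1).
case: ifP => [_|/negbT gh]; [exact: reduced_cons rw|exact: reduced_replace rw].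
Qed.

Lemma cons_letterM i (g h : F i) w : reduced w ->
  cons_letter (letter g) (cons_letter (letter h) w) = cons_letter (letter (g * h)) w.
Proof.
have [->|g1] := eqVneq g 1; first by rewrite cons_letter1 mul1g.
have [->|h1] := eqVneq h 1; first by rewrite cons_letter1 mulg1.
have nilE k : cons_letter (letter (k : F i)) [::] = if k == 1 then [::] else [:: letter k] by [].
case: w => [_|[j k] w rw].
  by rewrite (nilE h) (negbTE h1) cons_letter_same (negbTE g1) nilE.
have [e|ij] := eqVneq i j; last first.
  rewrite (cons_letter_far _ (a := existT _ j k)) // cons_letter_same (negbTE g1).
  case: eqP => [->|/eqP gh]; first by rewrite cons_letter1.
  by rewrite cons_letter_far.
subst j; rewrite -/(letter k) in rw *.
have k1 : k != 1 by case/andP: rw => /andP[].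
rewrite !cons_letter_same (negbTE h1).
case: eqP => [hk|/eqP hk].
  have gk : g = g * h * k by rewrite -mulgA hk mulg1.
  case: w rw => [_|b w rw].
    rewrite /= nilE (negbTE g1); case: eqP => [e|_]; last by rewrite -gk (negbTE g1).
    by move: gk; rewrite e mul1g => ->.
  have ib : i != projT1 b by case/andP: rw => _ /= /andP[].
  rewrite cons_letter_far //; case: eqP => [e|_]; last by rewrite -gk (negbTE g1).
  by move: gk; rewrite e mul1g => ->.
rewrite cons_letter_same (negbTE g1) mulgA; case: (eqVneq (g * h) 1) => [e|//].
by rewrite e mul1g (negbTE k1).
Qed.

Lemma normalise_reduced w : reduced (normalise w).
Proof. by elim: w => //= a w; exact: cons_letter_reduced. Qed.

Lemma normalise_cat u v : normalise (u ++ v) = foldr cons_letter (normalise v) u.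
Proof. exact: foldr_cat. Qed.

Lemma normalise_congruent u v : cong u v -> normalise u = normalise v.
Proof.
elim=> {u v} [u v [p [q [l [r [lr -> ->]]]]]|//|//|u v w _ -> _ -> //].
rewrite !normalise_cat; congr foldr.
case: lr => [[i [-> ->]]|[i [g [h [-> ->]]]]] /=; first exact: cons_letter1.
by rewrite cons_letterM //; exact: normalise_reduced.
Qed.

Lemma normalise_id w : reduced w -> normalise w = w.
Proof.
elim: w => //= -[i g] w IH rw; rewrite IH; last exact: reduced_cons rw.
have g1 : g != 1 by case/andP: rw => /andP[].
case: w rw {IH} => [_|b w rw]; first by rewrite /cons_letter /= (negbTE g1).
have ib : i != projT1 b by case/andP: rw => _ /= /andP[].
exact: cons_letter_far.
Qed.

Lemma wc_cat u v : wc (u ++ v) = wc u * wc v.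
Proof. by rewrite [RHS]pm_mulE. Qed.

Lemma wc_cons i (g : F i) w : wc (letter g :: w) = syllable g * wc w.
Proof. exact: (wc_cat [:: letter g] w). Qed.

Lemma wc_cons_letter i (g : F i) w : wc (cons_letter (letter g) w) = syllable g * wc w.
Proof.
have [s1 sM] := @syllable_morphism I F i.
have [->|g1] := eqVneq g 1; first by rewrite cons_letter1 s1 mul1g.
case: w => [|[j h] w]; first by rewrite /cons_letter /= (negbTE g1) wc_cons.
have [e|ij] := eqVneq i j; last by rewrite cons_letter_far // wc_cons.
subst j; rewrite -/(letter h) cons_letter_same (negbTE g1) (wc_cons h) mulgA -sM.
by case: eqP => [->|_]; [rewrite s1 mul1g|rewrite wc_cons].
Qed.

Lemma wc_normalise w : wc (normalise w) = wc w.
Proof. by elim: w => [//|[i g] w IH]; rewrite [normalise _]/= (wc_cons_letter g) IH (wc_cons g). Qed.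

Lemma reduced_word (x : free_prod F) : exists2 w, reduced w & x = wc w.
Proof.
exists (normalise (repr x)); first exact: normalise_reduced.
by rewrite wc_normalise; apply/esym; exact: word_classK.
Qed.

Lemma reduced_inj u v : reduced u -> reduced v -> wc u = wc v -> u = v.
Proof. by move=> ru rv /word_classP/normalise_congruent; rewrite !normalise_id. Qed.

Lemma syllable_inj i (g : F i) : syllable g = 1 -> g = 1.
Proof.
move=> e; apply: contrapT => /eqP g1.
by have := @reduced_inj [:: letter g] [::] _ _ e; rewrite /reduced /= /nontrivial_letter /= g1 => /(_ isT isT).
Qed.

Lemma wc_inv w : wc (wi w) = (wc w)^-1.
Proof.
apply: (mulgI (wc w)); rewrite mulgV -wc_cat; apply/word_classP; exact: word_mulV.
Qed.

Lemma reduced_cat u a v : reduced (rcons u a) -> reduced (a :: v) -> reduced (u ++ a :: v).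
Proof.
move=> /andP[au su] /andP[av sv]; rewrite all_rcons in au; case/andP: au => a1 au.
apply/andP; split; first by rewrite all_cat au.
case: u {au} su => [_|b u] //=.
by rewrite rcons_path cat_path => /andP[-> e] /=; rewrite e.
Qed.

(** The word is cyclically reduced of length at least two, so all its powers are reduced. *)
Lemma infinite_order_reduced a w b : reduced (a :: rcons w b) -> far b a ->
  ~ finite_order (wc (a :: rcons w b)).
Proof.
move=> rw ba [n [n0 e]]; set x := a :: rcons w b in rw e.
have wcX k : (wc x) ^+ k = wc (flatten (nseq k x)).
  by elim: k => [//|k IH]; rewrite expgS IH /= -wc_cat.
have rX k : reduced (flatten (nseq k.+1 x)).
  elim: k => [|k IH]; first by rewrite /= cats0.
  have -> : flatten (nseq k.+2 x) = (a :: w) ++ b :: flatten (nseq k.+1 x).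
    by rewrite [LHS]/= -[RHS]/(a :: (w ++ b :: _)) cat_rcons.
  apply: reduced_cat; first by rewrite rcons_cons.
  have b1 : nontrivial_letter b by case/andP: rw => /=; rewrite all_rcons => /and3P[].
  exact: reduced_push.
case: n n0 e => // n _; rewrite wcX => e.
by have := reduced_inj (v := [::]) (rX n) isT e.
Qed.

(** Cyclic reduction: when the end letters belong to one factor, conjugating by the first letter
    merges them and shortens the word. *)
Lemma torsion_conjugate (x : free_prod F) : x <> 1 -> finite_order x ->
  exists (p : free_prod F) i (g : F i), g <> 1 /\ x = p * syllable g / p.
Proof.
have [w rw ->] := reduced_word x; have [n] := ubnP (size w).
elim: n w rw => // n IH [//|a w] rw sw x1 fx.
case/lastP: w rw sw x1 fx => [|m b] rw sw x1 fx.
  case: a rw {sw x1 fx} => i g /andP[/andP[/eqP g1 _] _].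
  by exists 1, i, g; rewrite invg1 mul1g mulg1.
have [ab|ba] := boolP (~~ far b a); last first.
  by case: (infinite_order_reduced rw _ fx); rewrite negbK in ba.
case: a b ab rw sw x1 fx => i g [j h]; rewrite /far negbK /= => /eqP e; subst j.
rewrite -/(letter g) -/(letter h) => rw sw x1 fx.
have [s1 sM] := @syllable_morphism I F i.
pose w' := if h * g == 1 then m else rcons m (letter (h * g)).
have ew : wc w' = (syllable g)^-1 * wc (letter g :: rcons m (letter h)) * syllable g.
  rewrite wc_cons mulKg -cats1 wc_cat -mulgA -[wc [:: letter h]]/(syllable h) -sM /w'.
  by case: eqP => [->|_]; [rewrite s1 mulg1|rewrite -cats1 wc_cat].
have ew' : wc (letter g :: rcons m (letter h)) = syllable g * wc w' / syllable g.
  by rewrite ew !mulgA mulgV mul1g mulgK.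
have rw' : reduced w'.
  move: rw => /andP[/= /andP[_ al] p]; rewrite all_rcons in al; case/andP: al => h1 am.
  rewrite rcons_path in p; case/andP: p => p pl.
  rewrite /w'; case: eqP => [_|/eqP hg]; first by rewrite /reduced am (path_sorted p).
  apply/andP; split; first by rewrite all_rcons am /nontrivial_letter /= hg.
  by apply: (path_sorted (x := letter g)); rewrite rcons_path p.
have sw' : (size w' < n)%N.
  by move: sw; rewrite /w' /= size_rcons; case: ifP; rewrite ?size_rcons; lia.
have x1' : wc w' <> 1.
  by move=> e; apply: x1; rewrite ew' e mulg1 mulgV.
have fx' : finite_order (wc w').
  case: fx => k [k0 ek]; exists k; split=> //.
  have -> : wc w' = (wc (letter g :: rcons m (letter h))) ^ syllable g.
    by rewrite conjgE ew mulgA.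
  by rewrite -conjXg ek conj1g.
have [p [k [l [l1 el]]]] := IH w' rw' sw' x1' fx'.
exists (syllable g * p), k, l; split=> //.
by rewrite ew' el invgM !mulgA.
Qed.

Lemma reduced_word_inv w : reduced w -> reduced (wi w).
Proof.
move=> /andP[aw sw]; apply/andP; split.
  rewrite /word_inv all_rev all_map; apply: sub_all aw => -[i g] /=.
  by rewrite /nontrivial_letter /= invg_eq1.
rewrite /word_inv rev_sorted sorted_map; apply: sub_sorted sw => a b ab.
by rewrite /= /far eq_sym.
Qed.

(** A first letter of [q] in the factor of [g] is absorbed into [g] by conjugation, a last letter in
    the factor of [h] into [h]. When neither applies to a nonempty [q], the product is cyclically
    reduced and has infinite order. *)
Lemma product_torsion i (g : F i) q j (h : F j) : g <> 1 -> h <> 1 -> reduced q ->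
  finite_order (syllable g * (wc q * syllable h / wc q)) ->
  exists k : F i, wc q * syllable h / wc q = syllable k.
Proof.
have [n] := ubnP (size q); elim: n g q j h => // n IH g [|f q] j h sq g1 h1 rq fo.
  have w1 : wc [::] = 1 by [].
  rewrite w1 mul1g invg1 mulg1 in fo *.
  have [e|ij] := eqVneq i j; first by subst j; exists h.
  move/eqP: g1 => g1; move/eqP: h1 => h1.
  case: (@infinite_order_reduced (letter g) [::] (letter h)); rewrite ?/far ?[_ == i]eq_sym //=.
    by rewrite /reduced /= /nontrivial_letter /= g1 h1 /far /= ij.
  by rewrite (wc_cat [:: _]).
case: f sq rq fo => k f; rewrite -/(letter f) => sq rq fo.
have [e|ik] := eqVneq i k.
  subst k; have [s1 sM] := @syllable_morphism I F i.
  have sV : syllable f^-1 = (syllable f)^-1 by apply: morph_inv; exact: syllable_morphism.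
  have [||k ek] := IH (f^-1 * g * f) q j h sq _ h1 (reduced_cons rq).
  - by move=> e; apply: g1; apply: (mulgI f^-1); apply: (mulIg f); rewrite e mulg1 mulVg.
  - case: fo => m [m0 em]; exists m; split=> //.
    rewrite -(conj1g (syllable f)) -em conjXg; congr (_ ^+ _).
    by rewrite conjgE !sM sV wc_cons invgM !mulgA mulgVK.
  exists (f * k * f^-1); rewrite !sM sV -ek wc_cons invgM !mulgA; by [].
have [m [[l b] eQ]] : exists m b, letter f :: q = rcons m b.
  by exists (belast (letter f) q), (last (letter f) q); exact: lastI.
rewrite -/(letter b) in eQ.
have rb : reduced [:: letter b].
  move: rq; rewrite eQ => /andP[]; rewrite all_rcons => /andP[b1 _] _.
  by rewrite /reduced /= b1.
have rm : reduced m.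
  move: rq; rewrite eQ => /andP[]; rewrite all_rcons => /andP[_ am] sm.
  by apply/andP; split=> //; move: sm; case: (m) => //= a m'; rewrite rcons_path => /andP[].
have [e|lj] := eqVneq l j.
  subst l; have [s1 sM] := @syllable_morphism I F j.
  have sV : syllable b^-1 = (syllable b)^-1 by apply: morph_inv; exact: syllable_morphism.
  have eb : wc (letter f :: q) * syllable h / wc (letter f :: q) =
      wc m * syllable (b * h * b^-1) / wc m.
    by rewrite eQ -cats1 wc_cat !sM sV invgM !mulgA.
  rewrite eb in fo *; apply: (IH g m j _ _ g1) => //.
  + by move: sq; have := congr1 size eQ; rewrite /= size_rcons; lia.
  + by move=> e; apply: h1; apply: (mulgI b); apply: (mulIg b^-1); rewrite e mulg1 mulgV.
exfalso; move/eqP: g1 => g1; move/eqP: h1 => h1.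
have ewi : wi (letter f :: q) = rcons (wi q) (letter f^-1).
  by rewrite -cat1s word_inv_cat cats1.
have ewb : wi (letter f :: q) = letter b^-1 :: wi m.
  by rewrite eQ -cats1 word_inv_cat.
have r1 : reduced (letter h :: wi (letter f :: q)).
  have := reduced_word_inv rq; rewrite ewb => r.
  by apply: reduced_push => //; rewrite /far /= eq_sym.
have r2 : reduced ((letter f :: q) ++ letter h :: wi (letter f :: q)).
  apply: reduced_cat r1; rewrite eQ -cats1 cat_rcons.
  apply: reduced_cat; first by rewrite -eQ.
  apply: reduced_push => //; first by case/andP: rb => /andP[].
  by rewrite /reduced /= /nontrivial_letter /= h1.
have r3 : reduced (letter g :: rcons ((letter f :: q) ++ letter h :: wi q) (letter f^-1)).
  rewrite rcons_cat rcons_cons -ewi.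
  exact: (@reduced_push (letter g) (letter f) _ ik g1 r2).
apply: (infinite_order_reduced r3); first by rewrite /far /= eq_sym.
rewrite rcons_cat rcons_cons -ewi (wc_cons g) wc_cat (wc_cons h) wc_inv.
by rewrite !mulgA in fo *.
Qed.

(** Conjugation by [p] reduces the claim on [c] to [product_torsion]. *)
Lemma torsion_component (b : free_prod F) : b <> 1 -> finite_order b ->
  exists (p : free_prod F) i (g : F i), [/\ g <> 1, finite_order g, b = p * syllable g / p &
    forall c, c <> 1 -> finite_order c -> finite_order (b * c) ->
      exists k : F i, c = p * syllable k / p].
Proof.
move=> b1 fb; have [p [i [g [g1 eb]]]] := torsion_conjugate b1 fb.
have cj (x y : free_prod F) : finite_order x -> finite_order (x ^ y).
  by move=> [n [n0 e]]; exists n; split=> //; rewrite -conjXg e conj1g.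
exists p, i, g; split=> //.
  have [n [n0 e]] := cj _ p fb; exists n; split=> //; apply: syllable_inj.
  rewrite morph_expg; last exact: syllable_morphism.
  by rewrite -[RHS]e eb conjgE !mulgA mulVg mul1g mulgVK.
move=> c c1 fc fbc; pose c' := c ^ p.
have c'1 : c' <> 1 by move=> e; apply: c1; apply: (conjg_inj p); rewrite conj1g.
have [q0 [j [h [h1 ec]]]] := torsion_conjugate c'1 (cj _ p fc).
have [q rq eq] := reduced_word q0.
have [|k ek] := product_torsion g1 h1 rq.
  rewrite -eq -ec; have := cj _ p fbc; rewrite conjMg eb conjgE.
  by rewrite !mulgA mulVg mul1g mulgVK.
exists k; rewrite -ek -eq -ec /c' conjgE !mulgA mulgV mul1g.
by rewrite mulgK.
Qed.

End NormalForm.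

(** * Torsion elements of plain groups *)

Lemma mulz_torsion (z : Algebra.to_multiplicative int) : finite_order z -> z = 1.
Proof.
move=> [[|n] [// _ e]].
have zE (w : int) m : (w : Algebra.to_multiplicative int) ^+ m =
    if w is Posz k then Posz (m * k) else if w is Negz k then (- Posz (m * k.+1))%R else w.
  elim: m => [|m IH]; first by case: w.
  rewrite expgS IH; case: w {IH} => k.
    by rewrite mulSn PoszD.
  change ((Negz k + - Posz (m * k.+1))%R = (- Posz (m.+1 * k.+1))%R); lia.
move: e; rewrite zE; case: z => k e.
  by have : (n.+1 * k)%N = 0%N; [case: e|move/eqP; rewrite muln_eq0 => /eqP ->].
by move: e; rewrite mulSn.
Qed.

(* In a plain group, K is a conjugate of a finite free factor. *)
Definition torsion_isolated (G : groupType) := forall b : G, nontrivial_torsion b ->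
  exists K : set G, [/\ finite_subgroup K, K b &
    forall c, nontrivial_torsion c -> finite_order (b * c) -> K c].

Lemma free_prod_torsion_isolated n m (F : 'I_n -> finGroupType) :
  torsion_isolated (free_prod (@plain_factor n m F)).
Proof.
move=> b [b1 fb]; have [p [i [g [g1 fg eb iso]]]] := torsion_component b1 fb.
case: i g g1 fg eb iso => j g g1 fg eb iso; last by case: g1; exact: mulz_torsion.
have sylM := @syllable_morphism _ (@plain_factor n m F) (inl j).
have [syl1 sylD] := sylM.
pose syl (k : F j) := @syllable _ (@plain_factor n m F) (inl j) k.
pose K := (fun k : F j => p * syl k / p) @` setT.
exists K; split.
- split; last by apply: finite_image; exact: finite_finset.
  apply: subgroupP.
    by exists 1 => //; rewrite [syl _]syl1 mulg1 mulgV.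
  move=> _ _ [x _ <-] [y _ <-]; exists (x / y) => //.
  have -> : syl (x / y) = syl x / syl y.
    by rewrite /syl -(morph_inv _ sylM); exact: sylD.
  by rewrite !invgM invgK !mulgA mulgVK.
- by exists g.
- by move=> c [c1 fc] fbc; have [k ->] := iso c c1 fc fbc; exists k.
Qed.

Lemma isomorphic_torsion_isolated (G P : groupType) : isomorphic G P ->
  torsion_isolated P -> torsion_isolated G.
Proof.
move=> [f [fM fB]] iP b [b1 fb]; have [f1 fD] := fM.
have ford x : finite_order x -> finite_order (f x).
  by move=> [n [n0 e]]; exists n; split=> //; rewrite -morph_expg // e f1.
have fnt x : nontrivial_torsion x -> nontrivial_torsion (f x).
  move=> [x1 fx]; split; last exact: ford.
  by rewrite -f1 => /(bij_inj fB).
have [K [[cK fK] Kb iK]] := iP (f b) (fnt b (conj b1 fb)).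
exists (f @^-1` K); split=> [||c tc fbc] //; last first.
  by apply: iK; [exact: fnt|rewrite -fD; exact: ford].
split; last by apply: finite_preimage => //; exact: (in2W (bij_inj fB)).
apply: subgroupP => [|x y Kx Ky]; rewrite /preimage /=.
  by rewrite f1; exact: subgroup1.
by rewrite fD (morph_inv _ fM); exact: subgroup_div.
Qed.

Lemma plain_torsion_isolated (G : groupType) : plain G -> torsion_isolated G.
Proof.
move=> [n [m [F h]]]; apply: isomorphic_torsion_isolated h _.
exact: free_prod_torsion_isolated.
Qed.

(** Elements of a finite subgroup through [a] have torsion products with [a], so [K] contains every
    such subgroup. *)
Lemma torsion_isolated_maximal (G : groupType) : torsion_isolated G ->
  forall a : G, nontrivial_torsion a ->
    exists! H : set G, maximal_finite_subgroup H /\ H a.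
Proof.
move=> iG a ta; have [K [fK Ka iK]] := iG a ta.
have sub M : finite_subgroup M -> M a -> M `<=` K.
  move=> fM Ma x Mx; have [cM finM] := fM; have [->|x1] := pselect (x = 1).
    by case: fK => cK _; exact: subgroup1.
  apply: iK; first by split=> //; exact: (subgroup_finite_order cM finM).
  by apply: (subgroup_finite_order cM finM); exact: subgroupM.
exists K; split.
  split=> //; split=> // M fM KM; apply/seteqP; split=> //.
  by apply: sub => //; exact: KM.
by move=> M [[fM mM] Ma]; apply: mM => //; exact: sub.
Qed.

(** [a] and [c] both lie in the finite subgroup attached to [b], since [b * a] is conjugate to
    [a * b]. *)
Lemma torsion_isolated_transitive (G : groupType) : torsion_isolated G ->
  forall a b c : G, nontrivial_torsion a -> nontrivial_torsion b -> nontrivial_torsion c ->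
    prod_finite_order a b -> prod_finite_order b c -> prod_finite_order a c.
Proof.
move=> iG a b c ta tb tc ab bc; have [K [[cK fK] Kb iK]] := iG b tb.
apply: (subgroup_finite_order cK fK); apply: (subgroupM cK); last exact: iK.
apply: iK => //; move: ab => [n [n0 e]]; exists n; split=> //.
have -> : b * a = (a * b) ^ a by rewrite conjgE !mulgA mulVg mul1g.
by rewrite -conjXg e conj1g.
Qed.

(** * Cones and the equivalences *)

Section Cones.
Variables (G : groupType) (S : finType) (N : normal_forms G S).

Definition generator (s : S) : G := word_val N [:: s].

Lemma generatorP (Q : set G) g0 : Q g0 ->
  (forall g s, Q g <-> Q (g * generator s)) -> forall g, Q g.
Proof.
move=> Q0 QS g; rewrite -(mulVKg g0 g) -(nfK N (g0^-1 * g)).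
move: (nf N _) => w; elim: w g0 Q0 => [|s w IH] g0 Q0; first by rewrite word_val_nil mulg1.
by rewrite -cat1s word_val_cat mulgA; apply: IH; exact: (proj1 (QS g0 s)).
Qed.

(** Right multiplication by [p] alters only the last [C] letters of a normal form, so it cannot
    disturb the prefix [w] of a longer one. *)
Lemma cone_leave p : exists C, forall w x, cone N w x -> ~ cone N w (x * p) ->
  (size (nf N x) <= size w + C)%N.
Proof.
have [C hC] := nf_mulr N p; exists C => w x /prefixP[t wt] nw.
have [w1 [w2 [q [e1 e2 s2]]]] := hC _ (nf_irr N x); rewrite nfK in e2.
rewrite e1 size_cat; apply: leq_add => //; rewrite leqNgt; apply/negP => lt.
apply: nw; rewrite /cone /= e2 prefixE take_cat lt.
by have := congr1 (take (size w)) wt; rewrite e1 (take_size_cat t erefl) take_cat lt => ->.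
Qed.

Lemma cut_cone w : cut generator (cone N w).
Proof.
(* An edge may enter the cone as well as leave it, so [generator s] and its inverse both count. *)
have [C hC] : exists C, forall s x, (cone N w x -> ~ cone N w (x * generator s) ->
    (size (nf N x) <= size w + C)%N) /\
    (cone N w x -> ~ cone N w (x / generator s) -> (size (nf N x) <= size w + C)%N).
  pose C1 s := sval (cid (cone_leave (generator s))).
  pose C2 s := sval (cid (cone_leave (generator s)^-1)).
  exists (\max_(s : S) maxn (C1 s) (C2 s))%N => s x.
  have le := @leq_bigmax _ (fun s => maxn (C1 s) (C2 s)) s.
  by split=> h1 h2; [have := svalP (cid (cone_leave (generator s))) w x h1 h2
    |have := svalP (cid (cone_leave (generator s)^-1)) w x h1 h2];
    rewrite -/(C1 s) -/(C2 s); move: le; rewrite geq_max => /andP[]; lia.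
pose B := [set x | (size (nf N x) <= size w + C)%N].
apply: (@sub_finite_set _ _ (\bigcup_(s in [set: S])
   (((fun x => (x, s)) @` B) `|` ((fun x => (x / generator s, s)) @` B)))).
  move=> [x s] h; exists s => //.
  have [h1 h2] := hC s x; have [h3 h4] := hC s (x * generator s).
  move: h; rewrite /bd /=; case: asboolP => c1; case: asboolP => // c2 _.
    by left; exists x => //; exact: h1.
  by right; exists (x * generator s); rewrite ?mulgK //; apply: h4 => //; rewrite mulgK.
apply: bigcup_finite; first exact: finite_finset.
by move=> s _; rewrite finite_setU; split; apply: finite_image; exact: finite_ball.
Qed.

(** When [v] is as long as the overlap, which continuations of [u ++ v] are irreducible depends on
    [v] alone. *)
Lemma cone_suffix u v : (overlap N <= size v)%N -> irreducible N (u ++ v) ->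
  cone N (u ++ v) = lset (word_val N (u ++ v)) (lset (word_val N v)^-1 (cone N v)).
Proof.
move=> ov iuv; rewrite -lsetM word_val_cat mulgK.
have key a b x : irreducible N (a ++ v) -> irreducible N (b ++ v) ->
    prefix (a ++ v) (nf N x) -> prefix (b ++ v) (nf N (word_val N b / word_val N a * x)).
  move=> ia ib /prefixP[t e]; rewrite -(nfK N x) e !word_val_cat !mulgA mulgVK -!word_val_cat -catA nf_word_val.
    by rewrite catA prefix_prefix.
  apply: irreducible_overlap => //; apply: (@irreducible_suffix _ _ _ a).
  by rewrite catA -e; exact: nf_irr.
have iv := irreducible_suffix iuv.
apply/seteqP; split=> x; rewrite /lset /cone /= => h.
  by have := key u [::] x iuv iv h; rewrite word_val_nil div1g.
have := key [::] u _ iv iuv h; rewrite word_val_nil invg1 mulg1.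
by rewrite mulVKg.
Qed.

Lemma cone_types : exists2 R : set (set G), finite_set R /\ R `<=` cut generator &
  forall w, exists g, exists2 D, R D & cone N w = lset g D.
Proof.
(* Reducible words have empty cones; any other cone is determined, up to translation, by the last
   [overlap N] letters. *)
exists ([set set0] `|` (fun v => lset (word_val N v)^-1 (cone N v)) @` [set v | (size v <= overlap N)%N]).
  split.
    by rewrite finite_setU; split; [exact: finite_set1|apply: finite_image; exact: finite_words].
  move=> _ [->|[v _ <-]]; first by rewrite /cut bd0; exact: finite_set0.
  by apply: cut_lset; exact: cut_cone.
move=> w; have [[x wx]|no] := pselect (exists x, cone N w x); last first.
  exists 1, set0; first by left.
  by apply/seteqP; split=> x //= wx; apply: no; exists x.
have iw : irreducible N w.
  by case/prefixP: wx => t e; apply: (@irreducible_prefix _ _ _ w t); rewrite -e; exact: nf_irr.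
have [le|lt] := leqP (size w) (overlap N).
  exists (word_val N w), (lset (word_val N w)^-1 (cone N w)); last by rewrite lsetVK.
  by right; exists w.
pose k := (size w - overlap N)%N.
have sk : size (drop k w) = overlap N by rewrite size_drop /k; lia.
exists (word_val N w), (lset (word_val N (drop k w))^-1 (cone N (drop k w))).
  by right; exists (drop k w) => //=; rewrite sk.
by rewrite -{1 2}(cat_take_drop k w) cone_suffix ?sk // cat_take_drop.
Qed.

Lemma cut_singleton g : cut generator [set g].
Proof.
apply: (@sub_finite_set _ _ (\bigcup_(s in [set: S]) [set (g, s); (g / generator s, s)])).
  move=> [x s] h; exists s => //; move: h; rewrite /bd /=.
  case: asboolP => [->|_]; first by left.
  by case: asboolP => // <- _; right; rewrite /= mulgK.
by apply: bigcup_finite => [|s _]; [exact: finite_finset|exact: finite_set2].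
Qed.

Lemma exists_separating_tree : exists E : set (set G), cofinite_tree E /\
  forall x y, x <> y -> exists e, [/\ E e, e x & ~ e y].
Proof.
have [R [fR Rcut] hR] := cone_types.
pose one1 : set G := [set 1].
(* The bound covers the singleton of 1, for separation of points, and the cone types, for local
   finiteness. *)
have [M [hM1 hM2]] : exists M, (bsize generator one1 <= M)%N /\
    forall D, R D -> (bsize generator D <= M)%N.
  have /finite_seqP[l Rl] := fR.
  exists (maxn (bsize generator one1) (\max_(D <- l) bsize generator D))%N.
  split=> [|D]; first exact: leq_maxl.
  rewrite Rl /= => Dl; apply: leq_trans (leq_maxr _ _).
  by apply: (@leq_bigmax_seq _ l xpredT (fun D => bsize generator D)).
pose E := optimal generator M.
have tE : tree_set E.
  split=> [e|g e|e|e f|x y].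
  - exact: optimalC.
  - exact: (optimal_lset generatorP).
  - exact: optimal_neq0.
  - exact: (optimal_nested generatorP).
  - apply: (sub_finite_set _ (finite_edge_cuts generatorP M x y)) => e [Ee h].
    by split=> //; exact: (optimal_edge_cut generatorP).
exists E; split.
  split=> //.
  - move=> e Ee; apply: (finite_star tE (N := N)) => //.
    by exists R => //; split=> // D RD; apply: optimal_span; [exact: Rcut|exact: hM2].
  - by move=> e Ee; have [] := optimal_stab generatorP Ee.
  - exact: (optimal_finite_orbits generatorP).
move=> x y xy; apply: contrapT => no.
have exy e : E e -> e x -> e y.
  by move=> Ee ex; apply: contrapT => ney; apply: no; exists e.
(* If no half-space separated [x] from [y], no Boolean combination would, not even the singleton of
   [x]. *)
have : span E [set x].
  apply: optimal_span; first exact: cut_singleton.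
  have -> : [set x] = lset x one1.
    apply/seteqP; split=> z; rewrite /lset /one1 /=; first by move=> ->; rewrite mulVg.
    by move=> e; rewrite -(mulVKg x z) e mulg1.
  by rewrite bsize_lset //; exact: cut_singleton.
suff h A : span E A -> (A x <-> A y).
  by move=> sx; have [/(_ erefl) yx _] := h _ sx; apply: xy.
elim=> {A} [A EA||A _ IH|A B _ IHA _ IHB] //.
- split; first exact: exy.
  move=> Ay; apply: contrapT => nAx.
  exact: (exy _ (tree_setC tE EA) nAx Ay).
- by rewrite /setC /= IH.
- by rewrite /setU /= IHA IHB.
Qed.

End Cones.

Lemma trivial_plain (G : groupType) : (forall g : G, g = 1) -> plain G.
Proof.
move=> triv; pose F (j : 'I_0) : finGroupType := False_rect finGroupType (notF (ltn_ord j)).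
exists 0%N, 0%N, F, (fun=> 1); split; first by split=> // x y; rewrite mulg1.
exists (fun=> 1) => [x|]; first by rewrite [x]triv.
by apply: free_prod_ind => // -[[]|[]].
Qed.

Lemma exists_maximal_finite (G : groupType) (M : nat) (K : set G) :
  (forall L : set G, finite_subgroup L -> (card L <= M)%N) ->
  finite_subgroup K -> exists2 L, maximal_finite_subgroup L & K `<=` L.
Proof.
move=> bnd; have [n] := ubnP (M.+1 - card K); elim: n K => // n IH K nK fK.
have [mK|] := pselect (maximal_finite_subgroup K); first by exists K.
move=> /not_andP[//|/existsNP[L /not_implyP[fL /not_implyP[KL LK]]]].
have lt : (card K < card L)%N.
  have [x Lx nKx] : exists2 x, L x & ~ K x.
    apply: contrapT => no; apply: LK; apply/seteqP; split=> // x Lx.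
    by apply: contrapT => nKx; apply: no; exists x.
  by apply: (card_ltn (x := x)) => //; case: fL.
have [|L' mL' LL'] := IH L _ fL; last by exists L' => //; exact: subset_trans LL'.
by have := bnd _ fL; lia.
Qed.

(** * Plainness from the torsion conditions *)

Section Criterion.
Variables (G : groupType) (S : finType) (N : normal_forms G S).

Lemma plain_of_torsion_relation (R : G -> G -> Prop) :
  (forall a b, R a b -> R b a) ->
  (forall a b c, R a b -> R b c -> R a c) ->
  (forall K a b, finite_subgroup K -> K a -> K b -> a <> 1 -> b <> 1 -> R a b) ->
  (forall a b, R a b -> finite_order (a * b)) -> plain G.
Proof.
move=> Rs Rt RK RM; have [E [cE sE]] := exists_separating_tree N.
have cF := cofinite_free cE (finite_centraliser N) Rs Rt RK RM.
have [[e0 F0]|triv] := free_edges_neq0 cE sE; last exact: trivial_plain.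
have [I [K [i [D]]]] := tree_graph_of_groups cF (fun e g h => proj2 h g) F0.
exact: (plain_of_graph_of_groups i D).
Qed.

(** Uniqueness makes membership in a common maximal finite subgroup transitive; the bound on orders
    of finite subgroups places any finite subgroup in a maximal one. *)
Lemma plain_of_unique_maximal :
  (forall a : G, nontrivial_torsion a -> exists! H : set G, maximal_finite_subgroup H /\ H a) ->
  plain G.
Proof.
move=> uniqH; have [E [cE sE]] := exists_separating_tree N.
pose R (a b : G) := [/\ nontrivial_torsion a, nontrivial_torsion b &
  exists H : set G, [/\ maximal_finite_subgroup H, H a & H b]].
apply: (@plain_of_torsion_relation R).
- by move=> a b [ta tb [H [mH Ha Hb]]]; split=> //; exists H.
- move=> a b c [ta tb [H [mH Ha Hb]]] [_ tc [H' [mH' Hb' Hc]]]; split=> //.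
  have [H0 [_ u]] := uniqH b tb; exists H; split=> //.
  by rewrite -(u H) // (u H').
- move=> K a b fK Ka Kb a1 b1; have [cK finK] := fK.
  have [M bnd] : exists M, forall L : set G, finite_subgroup L -> (card L <= M)%N.
    by apply: (finite_subgroup_bound cE); have [e [Ee _ _]] := sE a 1 a1; exists e.
  have [H mH KH] := exists_maximal_finite bnd fK.
  split; [by split=> //; exact: (subgroup_finite_order cK finK)| |].
    by split=> //; exact: (subgroup_finite_order cK finK).
  by exists H; split=> //; exact: KH.
- move=> a b [_ _ [H [[[cH fH] _] Ha Hb]]].
  by apply: (subgroup_finite_order cH fH); exact: subgroupM.
Qed.

Lemma plain_of_transitive :
  (forall a b c : G,
    nontrivial_torsion a -> nontrivial_torsion b -> nontrivial_torsion c ->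
    prod_finite_order a b -> prod_finite_order b c -> prod_finite_order a c) ->
  plain G.
Proof.
move=> tr; pose R (a b : G) := [/\ nontrivial_torsion a, nontrivial_torsion b & finite_order (a * b)].
apply: (@plain_of_torsion_relation R).
- move=> a b [ta tb [n [n0 e]]]; split=> //; exists n; split=> //.
  have -> : b * a = (a * b) ^ a by rewrite conjgE !mulgA mulVg mul1g.
  by rewrite -conjXg e conj1g.
- by move=> a b c [ta tb ab] [_ tc bc]; split=> //; exact: (tr a b c).
- move=> K a b [cK fK] Ka Kb a1 b1; have o x := @subgroup_finite_order _ _ cK x fK.
  by split; [split=> //; exact: o|split=> //; exact: o|apply: o; exact: subgroupM].
- by move=> a b [].
Qed.

End Criterion.

Theorem lemma11 (Sigma : finType) (T : set (seq Sigma * seq Sigma))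
  (G : groupType) :
  (0 < #|Sigma|)%N ->
  finite_set T ->
  length_reducing T ->
  convergent T ->
  isomorphic (presented_monoid T) G ->
  [<-> plain G;
       forall a : G, nontrivial_torsion a ->
         exists! H : set G, maximal_finite_subgroup H /\ H a;
       forall a b c : G,
         nontrivial_torsion a -> nontrivial_torsion b -> nontrivial_torsion c ->
         prod_finite_order a b -> prod_finite_order b c ->
         prod_finite_order a c].
Proof.
move=> _ finT redT [_ conT] [f [fM fB]].
pose N := presented_normal_forms finT redT conT fM fB.
tfae.
- by move=> /plain_torsion_isolated/torsion_isolated_maximal.
(* The passage from (2) to (3) goes through (1). *)
- by move=> /(plain_of_unique_maximal N)/plain_torsion_isolated/torsion_isolated_transitive.
- exact: (plain_of_transitive N).
Qed.
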